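(* Consider a sequence, indexed by $N\to\infty$, of hierarchical stochastic block models $G=G_N$ on $[N]$ with tree $\mathcal{T}$, community probability vector $\pi$ and connection probabilities $p$. Suppose that $\mathcal{T}$ is a rooted binary tree with $K$ leaves, independent of $N$; that $\pi\in(0,1)^K$ is independent of $N$ with $\min_a\pi_a>0$; and that $p(t)=a(t)\,\delta_N$ for every node $t\in\mathcal{T}$, where $(a(t))_{t\in\mathcal{T}}$ are positive constants independent of $N$. Let $d_{\mathcal{T}}$ be the depth of $\mathcal{T}$, let $q\in\{1,\dots,d_{\mathcal{T}}\}$, and let $$I_q=\min_{\substack{a\ne b\in\mathcal{L}_{\mathcal{T}}\\ \mathrm{lca}(a,b)\in\mathcal{S}_{\le q-1}}}\mathrm{CH}(a,b),\qquad \mathrm{CH}(a,b)=\sup_{t\in(0,1)}(1-t)\sum_{c\in\mathcal{L}_{\mathcal{T}}}\pi_c\,D_t\big(\mathrm{Ber}(p_{ac})\,\|\,\mathrm{Ber}(p_{bc})\big).$$ Then: (i) if $\limsup_{N\to\infty}\frac{N I_q}{\log N}<1$, exact recovery of the super-communities at depth $q$ is impossible, i.e. no estimator achieves it; (ii) if $\liminf_{N\to\infty}\frac{N I_q}{\log N}>1$, exact recovery of the super-communities at depth $q$ is possible, i.e. some estimator achieves it.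
   Context: **Tree notation.** $\mathcal{T}$ is a rooted binary tree, $\mathcal{L}_{\mathcal{T}}$ its set of leaves, $\mathrm{lca}(a,b)$ the lowest common ancestor of $a$ and $b$, and $|u|$ the distance of $u$ from the root. **Hierarchical stochastic block model (HSBM).** Let $\pi=(\pi_a)_{a\in\mathcal{L}_{\mathcal{T}}}$ be a probability vector and $p:\mathcal{T}\to[0,1]$ a function on the nodes of $\mathcal{T}$ with $p(u)<p(v)$ whenever $v$ is a child of $u$. The HSBM is the random undirected graph on $[N]=\{1,\dots,N\}$ where each node is independently assigned to a community $C_a$, with $a\in\mathcal{L}_{\mathcal{T}}$ sampled from $\pi$, and then, independently over pairs, two nodes $i\in C_a$, $j\in C_b$ are connected with probability $p_{ab}:=p(\mathrm{lca}(a,b))$. **Depth sets and super-communities.** Set $$\mathcal{S}_q=\{u\in\mathcal{T}:|u|=q,\ \text{or}\ (|u|<q\text{ and }u\text{ is a leaf})\},\qquad \mathcal{S}_{\le q}=\bigcup_{r\le q}\mathcal{S}_r.$$ The super-communities at depth $q$ are the sets $C_u$, $u\in\mathcal{S}_q$, where $C_u$ is the union of the $C_a$ over all leaves $a$ of the subtree of $\mathcal{T}$ rooted at $u$. They partition $[N]$. **Rényi divergence.** For $t\in(0,1)$, $D_t(\mathrm{Ber}(p)\|\mathrm{Ber}(q))=\frac{1}{t-1}\log\big((1-p)^t(1-q)^{1-t}+p^tq^{1-t}\big)$, where $\mathrm{Ber}(p)$ is the Bernoulli distribution with parameter $p$. **Exact recovery.** An estimator of the super-communities at depth $q$ is a (sequence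 of) functions mapping the observed graph $G_N$ to a partition $(\widehat{C}_u)_{u\in\mathcal{S}_q}$ of $[N]$ into $|\mathcal{S}_q|$ sets (the community assignment is not observed). Its loss is $$\mathrm{loss}_N=\min_{\tau}\sum_{u\in\mathcal{S}_q}\big|C_u\,\triangle\,\widehat{C}_{\tau(u)}\big|,$$ where $\triangle$ denotes symmetric difference and the minimum is over all permutations $\tau$ of $\mathcal{S}_q$. The estimator achieves exact recovery of the super-communities at depth $q$ if $\mathrm{loss}_N\to0$ almost surely as $N\to\infty$.
   Formalization: The English fixes no joint law of the graphs over N; ''loss tends to 0 almost surely'' is read as holding on some probability space carrying the sequence, so (ii) amounts to failure probability tending to 0. With independent graphs, (ii) fails when N I_q/log N is slightly above 1. *)

(* Defs.v *)
(* MathComp and MathComp-Analysis. *)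
From HB Require Import structures.
From mathcomp Require Import all_boot all_order all_algebra all_fingroup.
From mathcomp Require Import all_classical all_reals all_analysis.

Set Implicit Arguments.
Unset Strict Implicit.
Unset Printing Implicit Defensive.

Import Order.TTheory GRing.Theory Num.Theory.
Import numFieldNormedType.Exports.

Local Open Scope ring_scope.

(* Binary trees are full: every internal node has exactly two children. *)
Inductive btree := Leaf | Node of btree & btree.

(* A node is encoded by its address: the word of left (false) and right (true)
   turns leading to it from the root. Its depth is the length of the word, and
   u is an ancestor of v (possibly v itself) when u is a prefix of v. *)
Fixpoint addresses (t : btree) : seq (seq bool) :=
  if t is Node l r then
    [::] :: [seq false :: u | u <- addresses l]
         ++ [seq true :: u | u <- addresses r]
  else [:: [::]].

Definition node (t : btree) : finType := seq_sub (addresses t).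

Lemma tree_root_subproof (t : btree) : [::] \in addresses t.
Proof. by case: t => *; rewrite inE eqxx. Qed.

Definition tree_root (t : btree) : node t := SeqSub (tree_root_subproof t).

Definition level (t : btree) (u : node t) : nat := size (val u).

Definition ancestor (t : btree) (u v : node t) : bool := prefix (val u) (val v).

Definition child (t : btree) (u v : node t) : bool :=
  [exists b : bool, val v == rcons (val u) b].

Definition is_leaf (t : btree) (u : node t) : bool :=
  ~~ [exists v : node t, child u v].

Definition leaf (t : btree) : finType := {u : node t | is_leaf u}.

Definition lca (t : btree) (a b : leaf t) : node t :=
  [arg max_(u > tree_root t | ancestor u (val a) && ancestor u (val b)) level u].

Definition tree_depth (t : btree) : nat := (\max_(u : node t) level u)%N.

Definition depth_set (t : btree) (q : nat) : {set node t} :=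
  [set u : node t | (level u == q) || ((level u < q)%N && is_leaf u)]%SET.

Definition depth_set_le (t : btree) (q : nat) : {set node t} :=
  (\bigcup_(r < q.+1) depth_set t r)%SET.

Definition super (t : btree) (q : nat) : finType :=
  {u : node t | u \in depth_set t q}.

Definition graph (N : nat) : finType :=
  {e : {ffun 'I_N * 'I_N -> bool} |
     [forall i, ~~ e (i, i)] && [forall i, forall j, e (i, j) == e (j, i)]}.

Definition adj (N : nat) (g : graph N) (i j : 'I_N) : bool := val g (i, j).

Definition assignment (t : btree) (N : nat) : finType := {ffun 'I_N -> leaf t}.

Section Model.
Variables (R : realType) (t : btree).
Implicit Types (pi : leaf t -> R) (p : node t -> R).

Definition connection_function p : Prop :=
  (forall u, 0 <= p u <= 1) /\ (forall u v, child u v -> p u < p v).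

(* Joint law of the community assignment and of the graph. *)
Definition hsbm_pmf pi p (N : nat) (s : assignment t N) (g : graph N) : R :=
  (\prod_(i < N) pi (s i)) *
  \prod_(i < N) \prod_(j < N | (i < j)%N)
     (if adj g i j then p (lca (s i) (s j)) else 1 - p (lca (s i) (s j))).

Definition hsbm pi p (N : nat) (d : measure_display) (T : measurableType d)
    (P : probability T R) (S : T -> assignment t N) (G : T -> graph N) : Prop :=
  forall (s : assignment t N) (g : graph N),
    measurable [set w | S w = s /\ G w = g]%classic /\
    P [set w | S w = s /\ G w = g]%classic = (hsbm_pmf pi p s g)%:E.

Definition renyi_bernoulli (x p q : R) : R :=
  (x - 1)^-1 * ln ((1 - p) `^ x * (1 - q) `^ (1 - x) + p `^ x * q `^ (1 - x)).

Definition CH pi p (a b : leaf t) : R :=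
  sup [set (1 - x) * \sum_(c : leaf t)
             pi c * renyi_bernoulli x (p (lca a c)) (p (lca b c))
      | x in [set x : R | 0 < x < 1]]%classic.

(* The value +oo is only a unit for min: for 1 <= q <= tree_depth t there are
   leaves a, b below distinct children of the root, which is at depth 0. *)
Definition min_CH pi p (q : nat) : \bar R :=
  \big[Order.min/+oo%E]_(ab : leaf t * leaf t |
      (ab.1 != ab.2) && (lca ab.1 ab.2 \in depth_set_le t q.-1))
    (CH pi p ab.1 ab.2)%:E.

Definition super_community (q N : nat) (s : assignment t N) (u : super t q) :
    {set 'I_N} :=
  [set i : 'I_N | ancestor (val u) (val (s i))]%SET.

(* Blocks may be empty, as super-communities themselves may. *)
Record estimator (q : nat) := Estimator {
  estimate :> forall N, graph N -> super t q -> {set 'I_N};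
  estimate_disjoint : forall N (g : graph N) (u v : super t q),
    u != v -> [disjoint estimate g u & estimate g v];
  estimate_cover : forall N (g : graph N),
    (\bigcup_(u : super t q) estimate g u)%SET = [set: 'I_N]%SET }.

Definition mismatch (q N : nat) (s : assignment t N)
    (C : super t q -> {set 'I_N}) (tau : {perm super t q}) : nat :=
  (\sum_(u : super t q)
     #|(super_community s u :\: C (tau u)) :|:
       (C (tau u) :\: super_community s u)|)%N.

Definition loss (q N : nat) (s : assignment t N) (C : super t q -> {set 'I_N}) :
    nat :=
  \big[minn/mismatch s C 1%g]_(tau : {perm super t q}) mismatch s C tau.

(* A sequence of models prescribes the law of each (S N, G N), but not their
   joint law over N, on which almost sure convergence depends. An estimator
   achieves exact recovery when there is a probability space carrying such a
   sequence on which its loss tends to 0 almost surely. Thus, that no estimator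
   achieves exact recovery excludes every coupling over N. Conversely, recovery
   under every coupling cannot be asked for: just above the threshold, failure
   probabilities may decay only like N^(-e) with e < 1, so that for independent
   (S N, G N) failures occur infinitely often almost surely. *)
Definition exact_recovery pi (p : nat -> node t -> R) (q : nat)
    (est : estimator q) : Prop :=
  exists (d : measure_display) (T : measurableType d) (P : probability T R)
    (S : forall N, T -> assignment t N) (G : forall N, T -> graph N),
    (forall N, hsbm pi (p N) P (S N) (G N)) /\
    {ae P, forall w,
       ((fun N => (loss (S N w) (est N (G N w)))%:R : R) @ \oo --> (0 : R))%classic}.

End Model.

(* Main.v *)
(* Write A x y = a (lca x y) and J for the minimum, over pairs of communities x, y
   in different super-communities, of the supremum over s of
   sum_c pi c (s A x c + (1 - s) A y c - A x c ^ s * A y c ^ (1 - s)), the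
   Chernoff-Hellinger divergence for Poisson instead of Bernoulli edges.
   Then delta_N J <= I_N <= delta_N J + O(delta_N ^ 2), so I_N may be replaced by
   delta_N J in both thresholds.
   Recovery. For each vertex i, a labelling of the others is obtained by maximising
   the Poisson likelihood of the edges that avoid i. Outside an event of
   negligible probability it is correct, up to a permutation of the
   communities that preserves A (hence every super-community) and up to a small
   fraction of the vertices. It is independent of the edges at i, from which i is
   then labelled by likelihood again; by Chernoff's bound i lands in a wrong
   super-community with probability N ^ - (1 + e), and a union bound concludes.
   Impossibility. Let x, y attain J. Change of measure to the edge rates
   A x c ^ s * A y c ^ (1 - s), where s makes both likelihoods nearly equal, shows
   that a given vertex of x is, as far as its edges tell, as likely to be in y with
   probability N ^ - (1 - e). By the second moment method such a vertex exists with
   probability bounded below. Moving it to y yields a configuration of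
   comparable probability with the same graph, and an estimator cannot be right
   for both.
   Exact recovery amounts to the failure probability tending to 0: almost sure
   convergence gives it by continuity from above, and conversely one realises all
   the models on [0,1], with the failures of the N-th one on an initial interval
   whose length tends to 0. *)

(* Super-communities must be readable from the rates alone, since the likelihood sees nothing else:
   among the pairs inside a class at depth q, those separated at depth q + 1 are exactly the pairs
   of smallest rate ([same_superS]). The undetermined automorphism may change from one leave-one-out
   labelling to the next, so these labellings are compared through one common reference before the
   final labels are assembled. No maximiser in s is ever identified. For recovery a near-optimal s
   suffices; for impossibility s is taken where the derivative of the exponent is a small e > 0,
   which slightly favours y, and the relative entropy to be paid is then at most J + e
   ([tilt_divergence]). The obstacle to the second moment is that the vertices of x share edges.
   Only a set W of about eta N of them is used, and a candidate must have no edge inside W: this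
   costs a small power of N, and the events of two candidates then share a single edge. Nothing says
   that delta_N tends to 0. Below the threshold this follows from N delta_N J = O(log N); above it,
   the indices with delta_N bounded below are treated apart. *)
Require Import Defs.
From mathcomp Require Import all_boot all_order all_algebra all_fingroup.
From mathcomp Require Import all_classical all_reals all_analysis.
From mathcomp Require Import ring lra.
Import Order.TTheory GRing.Theory Num.Theory.
Import numFieldNormedType.Exports.
Set Implicit Arguments.
Unset Strict Implicit.
Unset Printing Implicit Defensive.
Local Open Scope ring_scope.

(** * Addresses and super-communities *)

Section Tree.
Variable t : btree.
Implicit Types (a b c : leaf t) (u v : node t).

Lemma addresses_prefix (s : btree) (x y : seq bool) :
  y \in addresses s -> prefix x y -> x \in addresses s.
Proof.
elim: s x y => [|l IHl r IHr] x y /=.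
  by rewrite inE => /eqP ->; case: x.
case: x => [//|c x].
rewrite !inE !mem_cat => /orP[/eqP -> //|/orP[]] /mapP[z zin ->] /=.
  by move=> /andP[/eqP -> xz]; apply/orP; left; rewrite map_f // (IHl _ z).
by move=> /andP[/eqP -> xz]; apply/orP; right; rewrite map_f // (IHr _ z).
Qed.

Lemma map_cons_in (s : seq (seq bool)) (b c : bool) (x : seq bool) :
  (b :: x \in [seq c :: y | y <- s]) = (b == c) && (x \in s).
Proof.
apply/mapP/andP => [[y ys [-> ->]]|[/eqP -> xs]]; first by rewrite eqxx.
by exists x.
Qed.

(** Fullness of the tree in terms of addresses. It yields leaves on both sides of an internal node,
    as [same_superS] and [exists_split_pair] require. *)
Lemma addresses_sibling (s : btree) (x : seq bool) (b c : bool) :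
  rcons x b \in addresses s -> rcons x c \in addresses s.
Proof.
elim: s x => [|l IHl r IHr] x /=; first by case: x.
case: x => [|d x] /=; rewrite !inE !mem_cat !map_cons_in /=.
  have nilt s : [::] \in addresses s by case: s => *; rewrite inE eqxx.
  by rewrite !nilt; case: (c).
by move=> /orP[] /andP[/eqP -> /=] => [/IHl|/IHr] ->; rewrite ?orbT.
Qed.

Definition addr a : seq bool := val (val a).

Lemma addr_inj : injective addr.
Proof. by move=> a b /val_inj /val_inj. Qed.

Lemma leaf_no_child a (d : bool) : rcons (addr a) d \notin addresses t.
Proof.
apply/negP => H; have /negP := valP a; apply.
by apply/existsP; exists (SeqSub H); apply/existsP; exists d => /=.
Qed.

Lemma prefix_rcons_drop (x y : seq bool) :
  prefix x y -> x != y -> exists d, prefix (rcons x d) y.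
Proof.
move=> /prefixP[z ->]; case: z => [|d z]; first by rewrite cats0 eqxx.
by move=> _; exists d; rewrite -cat_rcons prefix_prefix.
Qed.

Lemma leaf_prefix a (x : seq bool) :
  x \in addresses t -> prefix (addr a) x -> x = addr a.
Proof.
move=> xt ax; apply/eqP; rewrite eq_sym; apply/negPn/negP => ne.
have [d /(addresses_prefix xt)] := prefix_rcons_drop ax ne.
by apply/negP/leaf_no_child.
Qed.

Lemma leaf_below (x : seq bool) :
  x \in addresses t -> exists a, prefix x (addr a).
Proof.
move=> xt.
pose P := [pred u : node t | prefix x (val u)].
have P0 : P (SeqSub xt) by rewrite /= prefix_refl.
case: (@arg_maxnP _ (SeqSub xt) P (@level t) P0) => u Pu umax.
have lu : is_leaf u.
  apply/negP => /existsP[v /existsP[d /eqP vE]].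
  have := umax v; rewrite /= /level vE size_rcons ltnn => H.
  suff /H : prefix x (ssval v) by [].
  by move: vE; rewrite /= => ->; apply: prefix_trans Pu (prefix_rcons _ _).
by exists (exist _ u lu).
Qed.

(** The address of [lca] in recursive form ([val_lca]); [prefix_lcp] is the universal property of a
    meet. *)
Fixpoint lcp (x y : seq bool) : seq bool :=
  match x, y with
  | b :: x', c :: y' => if b == c then b :: lcp x' y' else [::]
  | _, _ => [::]
  end.

Lemma lcpC x y : lcp x y = lcp y x.
Proof. by elim: x y => [|b x IH] [|c y] //=; rewrite eq_sym; case: eqP => // ->; rewrite IH. Qed.

Lemma prefix_lcp z x y : prefix z (lcp x y) = prefix z x && prefix z y.
Proof.
elim: x y z => [|b x IH] [|c y] [|d z] //=; rewrite ?prefix0s ?andbF //.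
case: (b =P c) => [bc|bc] /=; first by rewrite bc IH; case: (d == c).
by case: (d =P b) => //= ->; case: (b =P c) => //=; rewrite ?andbF.
Qed.

Lemma lcp_prefixl x y : prefix (lcp x y) x.
Proof. by have := prefix_lcp (lcp x y) x y; rewrite prefix_refl => /esym /andP[]. Qed.

Lemma lcp_prefixr x y : prefix (lcp x y) y.
Proof. by rewrite lcpC lcp_prefixl. Qed.

Lemma prefix_size_eq (x y : seq bool) : prefix x y -> (size y <= size x)%N -> x = y.
Proof.
move=> /prefixP[z ->]; rewrite size_cat -[X in (_ <= X)%N]addn0 leq_add2l leqn0 size_eq0.
by move=> /eqP ->; rewrite cats0.
Qed.

Lemma addr_in a : addr a \in addresses t.
Proof. exact: valP. Qed.

Lemma val_lca a b : val (lca a b) = lcp (addr a) (addr b).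
Proof.
have Lt : lcp (addr a) (addr b) \in addresses t.
  exact: addresses_prefix (addr_in a) (lcp_prefixl _ _).
rewrite /lca; case: arg_maxnP => [|u /andP[ua ub] umax].
  by rewrite /ancestor /= !prefix0s.
apply: prefix_size_eq; first by rewrite prefix_lcp; apply/andP.
by apply: (umax (SeqSub Lt)); rewrite /ancestor /= lcp_prefixl lcp_prefixr.
Qed.

Lemma lcaC a b : lca a b = lca b a.
Proof. by apply: val_inj; rewrite !val_lca lcpC. Qed.

Lemma lcaa a : lca a a = val a.
Proof.
apply: val_inj; rewrite val_lca; apply: prefix_size_eq; first exact: lcp_prefixl.
by apply: size_prefix; rewrite prefix_lcp prefix_refl.
Qed.

Lemma increasing_ancestor (R : realType) (f : node t -> R) :
  (forall u v, child u v -> f u < f v) ->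
  forall u v, ancestor u v -> f u <= f v ?= iff (u == v).
Proof.
move=> fc u v /prefixP[z vE].
elim/last_ind: z v vE => [|z d IH] v vE.
  have -> : v = u by apply: val_inj; rewrite vE cats0.
  by rewrite eqxx; apply/leif_refl.
have wt : val u ++ z \in addresses t.
  apply: addresses_prefix (valP v) _.
  by rewrite vE -rcons_cat prefix_rcons.
have wv : f (SeqSub wt) < f v.
  by apply: fc; apply/existsP; exists d; rewrite vE -rcons_cat.
have lt := le_lt_trans (IH (SeqSub wt) erefl).1 wv.
have -> : (u == v) = false.
  by apply/negbTE; apply: contraTneq lt => ->; rewrite ltxx.
by apply/leifP.
Qed.

(** A leaf shallower than [q] keeps its whole address under [take q], in agreement with the second
    clause of [depth_set]. *)
Definition same_super (q : nat) a b : bool := take q (addr a) == take q (addr b).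

Lemma lca_leaf_inj a b : is_leaf (lca a b) -> a = b.
Proof.
move=> lf; apply: addr_inj.
have E : addr (exist _ (lca a b) lf) = lcp (addr a) (addr b) by rewrite -val_lca.
have Ea := @leaf_prefix (exist _ (lca a b) lf) _ (addr_in a).
have Eb := @leaf_prefix (exist _ (lca a b) lf) _ (addr_in b).
rewrite E in Ea Eb; exact: etrans (Ea (lcp_prefixl _ _)) (esym (Eb (lcp_prefixr _ _))).
Qed.

Lemma same_superE q a b : a != b -> same_super q a b = (q <= level (lca a b))%N.
Proof.
move=> ab; rewrite /level val_lca; apply/eqP/idP => [E|].
  have P : prefix (take q (addr a)) (lcp (addr a) (addr b)).
    by rewrite prefix_lcp {2}E !prefix_take.
  have := size_prefix P; rewrite size_take_min.
  case: (leqP q (size (addr a))) => [//|qa].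
  case/eqP: ab; apply: addr_inj; apply/esym/leaf_prefix; first exact: addr_in.
  by have := prefix_take (addr b) q; rewrite -E take_oversize // ltnW.
move=> qs; have H x : prefix (lcp (addr a) (addr b)) x ->
    take q x = take q (lcp (addr a) (addr b)).
  by move=> /prefixP[z ->]; rewrite takel_cat.
by rewrite (H _ (lcp_prefixl _ _)) (H _ (lcp_prefixr _ _)).
Qed.

Lemma same_super_refl q a : same_super q a a.
Proof. exact: eqxx. Qed.

(** The lca of two distinct leaves is internal, so only the first clause of [depth_set] can apply to
    it and the condition becomes [level (lca a b) < q]. *)
Lemma split_pairE q a b : (0 < q)%N ->
  (a != b) && (lca a b \in depth_set_le t q.-1) = ~~ same_super q a b.
Proof.
move=> q0; case: (eqVneq a b) => [->|ab]; first by rewrite same_super_refl.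
rewrite (same_superE _ ab) -ltnNge /=; apply/bigcupP/idP => [[r _]|lq].
  rewrite inE => /orP[/eqP ->|/andP[_ /lca_leaf_inj E]]; last by rewrite E eqxx in ab.
  by rewrite -ltnS -[q in (_ < q.+1)%N]prednK // ltnS ltn_ord.
have lq' : (level (lca a b) < q.-1.+1)%N by rewrite prednK.
by exists (Ordinal lq') => //; rewrite inE /= eqxx.
Qed.

(** Within a class at depth [q], the least value of [f] is attained exactly at the pairs whose lca
    is the node of depth [q], and these are the pairs that separate at the next depth. The criterion
    involves only [f] of an lca and the previous depth, so that invariance under automorphisms
    follows by induction on [q]. *)
Lemma same_superS (R : realType) (f : node t -> R) q a b :
  (forall u v, child u v -> f u < f v) -> a != b ->
  reflect (same_super q a b /\ exists c d, [/\ same_super q a c, same_super q a d &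
     f (lca c d) < f (lca a b)]) (same_super q.+1 a b).
Proof.
move=> fc ab; rewrite !same_superE //; apply: (iffP idP) => [ql|[ql [c [d [ac ad lt]]]]].
  split; first exact: ltnW.
  (* The ancestor [x] at depth [q] lies strictly above the lca, hence has two children; leaves [c]
     and [d] below them have lca [x]. *)
  pose x := take q (val (lca a b)).
  have sx : size x = q by rewrite size_takel // ltnW.
  have xl : prefix x (val (lca a b)) by exact: prefix_take.
  have xne : x != val (lca a b).
    by apply/eqP => E; move: ql; rewrite /level -E sx ltnn.
  have [d0 xd] := prefix_rcons_drop xl xne.
  have xd0 := addresses_prefix (valP (lca a b)) xd.
  have [c cP] := leaf_below (addresses_sibling false xd0).
  have [d dP] := leaf_below (addresses_sibling true xd0).
  have xa : take q (addr a) = x.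
    rewrite /x val_lca; have /prefixP[z {1}->] := lcp_prefixl (addr a) (addr b).
    by rewrite takel_cat // -val_lca ltnW.
  have H y e : prefix (rcons x e) y -> take q y = x.
    by move=> /prefixP[z ->]; rewrite cat_rcons -{1}sx take_size_cat.
  exists c, d; rewrite /same_super xa (H _ _ cP) (H _ _ dP) !eqxx; split => //.
  have E : val (lca c d) = x.
    rewrite val_lca; move: cP dP => /prefixP[z ->] /prefixP[z' ->].
    by rewrite !cat_rcons; elim: (x) => //= ? ? ->; rewrite eqxx.
  rewrite lt_neqAle; have anc : ancestor (lca c d) (lca a b) by rewrite /ancestor E.
  have [-> ->] := increasing_ancestor fc anc.
  by rewrite andbT; apply: contra xne => /eqP <-; rewrite E.
(* Were the lca at depth exactly [q], it would be an ancestor of every lca inside the class, and no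
   smaller value of [f] could occur there. *)
rewrite ltn_neqAle ql andbT; apply/eqP => E.
suff : f (lca a b) <= f (lca c d) by rewrite leNgt lt.
apply: (increasing_ancestor fc _).1.
have lE : val (lca a b) = take q (addr a).
  rewrite val_lca; have /prefixP[z {2}->] := lcp_prefixl (addr a) (addr b).
  by rewrite E /level val_lca take_size_cat.
rewrite /ancestor lE val_lca prefix_lcp; apply/andP; split.
  by move/eqP: ac => ->; exact: prefix_take.
by move/eqP: ad => ->; exact: prefix_take.
Qed.

Lemma automorphism_same_super (R : realType) (f : node t -> R) (g : leaf t -> leaf t) :
  (forall u v, child u v -> f u < f v) -> injective g ->
  (forall a b, f (lca (g a) (g b)) = f (lca a b)) ->
  forall q a b, same_super q (g a) (g b) = same_super q a b.
Proof.
move=> fc gi gf; elim=> [|q IH] a b; first by rewrite /same_super !take0 !eqxx.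
case: (eqVneq a b) => [->|ab]; first by rewrite !same_super_refl.
have gab : g a != g b by rewrite (inj_eq gi).
have [g' gK g'K] := injF_bij gi.
apply/(same_superS q fc gab)/(same_superS q fc ab).
  rewrite IH gf => -[-> [c [d [ac ad lt]]]]; split=> //; exists (g' c), (g' d).
  by rewrite -!(IH a) !g'K; split=> //; rewrite -gf !g'K.
by rewrite IH gf => -[-> [c [d [ac ad lt]]]]; split=> //; exists (g c), (g d); rewrite !IH gf.
Qed.

Section Super.
Variable q : nat.

Lemma superP a (u : super t q) : ancestor (val u) (val a) = (val (val u) == take q (addr a)).
Proof.
apply/idP/eqP => [ua|uE]; last by rewrite /ancestor uE prefix_take.
have : val u \in depth_set t q := valP u.
rewrite inE => /orP[/eqP lu|/andP[lu lf]].
  by apply/esym/eqP; move: ua; rewrite /ancestor prefixE [size _]lu.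
have := @leaf_prefix (exist _ (val u) lf) _ (addr_in a) ua; rewrite /addr /= => E.
by rewrite take_oversize E // ltnW.
Qed.

Lemma super_of_subproof a : exists u : super t q, val (val u) == take q (addr a).
Proof.
have xt : take q (addr a) \in addresses t by apply: addresses_prefix (addr_in a) (prefix_take _ _).
have xd : SeqSub xt \in depth_set t q.
  rewrite inE /level /= size_take_min; case: (leqP q (size (addr a))) => qa.
    by rewrite eqxx.
  apply/orP; right; rewrite qa /=.
  have -> : SeqSub xt = val a by apply: val_inj; rewrite /= take_oversize // ltnW.
  exact: (valP a).
by exists (@exist _ (fun u => u \in depth_set t q) _ xd).
Qed.

Definition super_of a : super t q := xchoose (super_of_subproof a).

Lemma val_super_of a : val (val (super_of a)) = take q (addr a).
Proof. exact/eqP/(xchooseP (super_of_subproof a)). Qed.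

Lemma ancestor_super a (u : super t q) : ancestor (val u) (val a) = (u == super_of a).
Proof. by rewrite superP -val_super_of !(inj_eq val_inj). Qed.

Lemma super_of_eq a b : (super_of a == super_of b) = same_super q a b.
Proof. by rewrite /same_super -!val_super_of !(inj_eq val_inj). Qed.

Lemma super_of_surj (u : super t q) : exists a, super_of a = u.
Proof.
have [a ua] := leaf_below (valP (val u)).
by exists a; apply/eqP; rewrite eq_sym -ancestor_super.
Qed.

End Super.

Lemma exists_split_pair q : (1 <= q <= tree_depth t)%N -> exists a b, ~~ same_super q a b.
Proof.
move=> /andP[q1 qd].
have [u uq] : exists u, (q <= level u)%N.
  case: (@arg_maxnP _ (tree_root t) predT (@level t) isT) => u _ umax.
  by exists u; rewrite (leq_trans qd) //; apply/bigmax_leqP => v _; exact: umax.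
have us : (0 < size (val u))%N by exact: leq_trans q1 uq.
have [d u1] : exists d, [:: d] \in addresses t.
  case E : (val u) us => [//|d x] _; exists d.
  by apply: addresses_prefix (valP u) _; rewrite E /= eqxx prefix0s.
have [a aP] := leaf_below (@addresses_sibling _ [::] d false u1).
have [b bP] := leaf_below (@addresses_sibling _ [::] d true u1).
exists a, b; move: aP bP; rewrite /same_super.
by case: q q1 {qd uq} => // q _; case: (addr a) => [//|[] ?]; case: (addr b) => [//|[] ?].
Qed.

End Tree.

(** * Finite product laws *)

Section ProductLaw.
Variables (R : realType) (I T : finType) (w : I -> T -> R).

(** All estimates are made on weighted finite sums; measures enter only with almost sure
    convergence. *)
Definition mass (x : {ffun I -> T}) : R := \prod_i w i (x i).
Definition expect (f : {ffun I -> T} -> R) : R := \sum_x mass x * f x.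
Definition prob (A : pred {ffun I -> T}) : R := expect (fun x => (A x)%:R).

Lemma eq_expect f g : f =1 g -> expect f = expect g.
Proof. by move=> fg; apply: eq_bigr => x _; rewrite fg. Qed.

Lemma expectD f g : expect (fun x => f x + g x) = expect f + expect g.
Proof. by rewrite -big_split; apply: eq_bigr => x _; rewrite mulrDr. Qed.

Lemma expectZ c f : expect (fun x => c * f x) = c * expect f.
Proof. by rewrite /expect big_distrr; apply: eq_bigr => x _; rewrite mulrCA. Qed.

Lemma expect_sum (J : Type) (s : seq J) (P : pred J) (f : J -> {ffun I -> T} -> R) :
  expect (fun x => \sum_(j <- s | P j) f j x) = \sum_(j <- s | P j) expect (f j).
Proof. by rewrite /expect exchange_big; apply: eq_bigr => x _; rewrite big_distrr. Qed.

Lemma expect_prod (f : I -> T -> R) :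
  expect (fun x => \prod_i f i (x i)) = \prod_i \sum_s w i s * f i s.
Proof. by rewrite bigA_distr_bigA; apply: eq_bigr => x _; rewrite big_split. Qed.

Hypothesis w_ge0 : forall i s, 0 <= w i s.
Hypothesis w_sum1 : forall i, \sum_s w i s = 1.

Lemma mass_ge0 x : 0 <= mass x.
Proof. by apply: prodr_ge0. Qed.

Lemma ler_expect f g : (forall x, f x <= g x) -> expect f <= expect g.
Proof. by move=> fg; apply: ler_sum => x _; rewrite ler_wpM2l // mass_ge0. Qed.

Lemma expect_cst c : expect (fun=> c) = c.
Proof.
rewrite /expect -big_distrl /=.
suff -> : \sum_x mass x = 1 by rewrite mul1r.
transitivity (expect (fun x => \prod_(i : I) 1)).
  by apply: eq_bigr => x _; rewrite big1 ?mulr1.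
by rewrite (expect_prod (fun _ _ => 1)) big1 // => i _; rewrite -[RHS](w_sum1 i); apply: eq_bigr => s _; rewrite mulr1.
Qed.

(** By injectivity each coordinate carries at most one factor; a coordinate without factor
    integrates to 1. *)
Lemma expect_prod_inj (J : finType) (P : pred J) (idx : J -> I) (f : J -> T -> R) :
  {in P &, injective idx} ->
  expect (fun x => \prod_(j | P j) f j (x (idx j))) =
  \prod_(j | P j) \sum_s w (idx j) s * f j s.
Proof.
move=> idxI.
transitivity (expect (fun x => \prod_i \prod_(j | P j && (idx j == i)) f j (x i))).
  apply: eq_expect => x; rewrite (partition_big idx predT) //=.
  by apply: eq_bigr => i _; apply: eq_bigr => j /andP[_ /eqP ->].
rewrite (expect_prod (fun i s => \prod_(j | P j && (idx j == i)) f j s)) [RHS](partition_big idx predT) //=.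
apply: eq_bigr => i _.
case: (pickP (fun j => P j && (idx j == i))) => [j0 /andP[Pj0 /eqP ij0]|none].
  have E : (fun j => P j && (idx j == i)) =1 pred1 j0.
    move=> j; apply/andP/eqP => [[Pj /eqP ij]|->]; last by rewrite ij0.
    by apply: idxI => //; rewrite ij.
  rewrite (big_pred1 _ E) ij0; apply: eq_bigr => s _.
  by rewrite (big_pred1 _ E).
rewrite [RHS]big_pred0 // -[RHS](w_sum1 i); apply: eq_bigr => s _.
by rewrite big_pred0 ?mulr1.
Qed.

Lemma expect_coord i (f : T -> R) : expect (fun x => f (x i)) = \sum_s w i s * f s.
Proof.
have := @expect_prod_inj unit predT (fun=> i) (fun=> f) (fun j k _ _ _ => match j, k with tt, tt => erefl end).
rewrite (big_pred1 tt) => [<-|[]//]; apply: eq_expect => x.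
by rewrite (big_pred1 tt) // => -[].
Qed.

Lemma expect_coord2 i j (f g : T -> R) : i != j ->
  expect (fun x => f (x i) * g (x j)) = (\sum_s w i s * f s) * (\sum_s w j s * g s).
Proof.
move=> ij.
have := @expect_prod_inj bool predT (fun b => if b then i else j) (fun b => if b then f else g).
rewrite big_bool => <-; first by apply: eq_expect => x; rewrite big_bool.
by move=> [] [] _ _ // E; move: ij; rewrite E eqxx.
Qed.

(* Swapping the coordinates outside S between two independent copies of x
   preserves the product law. *)
Lemma expect_indep (S : pred I) f g :
  (forall x y : {ffun I -> T}, (forall i, S i -> x i = y i) -> f x = f y) ->
  (forall x y : {ffun I -> T}, (forall i, ~~ S i -> x i = y i) -> g x = g y) ->
  expect (fun x => f x * g x) = expect f * expect g.
Proof.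
move=> fS gS.
pose sw (p : {ffun I -> T} * {ffun I -> T}) : {ffun I -> T} * {ffun I -> T} :=
  ([ffun i => if S i then p.1 i else p.2 i], [ffun i => if S i then p.2 i else p.1 i]).
have swK : involutive sw.
  by case=> x y; rewrite /sw; congr pair; apply/ffunP => i; rewrite !ffunE; case: (S i).
rewrite -[LHS]mulr1 -[1 in LHS](expect_cst 1) /expect !big_distrlr /= !pair_bigA /=.
rewrite (reindex_inj (inv_inj swK)) /=; apply: eq_bigr => -[x y] _ /=.
rewrite mulr1 (fS _ x); last by move=> i Si; rewrite ffunE Si.
rewrite (gS _ y); last by move=> i Si; rewrite ffunE (negbTE Si).
have -> : mass (sw (x, y)).1 * (f x * g y) * mass (sw (x, y)).2 =
  (mass (sw (x, y)).1 * mass (sw (x, y)).2) * (f x * g y) by rewrite mulrAC.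
suff -> : mass (sw (x, y)).1 * mass (sw (x, y)).2 = mass x * mass y by rewrite mulrACA.
rewrite /mass -!big_split; apply: eq_bigr => i _ /=; rewrite !ffunE.
by case: ifP => // _; rewrite mulrC.
Qed.

(** After centring, the cross terms vanish by independence, and a variance is at most the second
    moment. *)
Lemma expect_sqr_sum (J : finType) (P : pred J) (idx : J -> I) (f : J -> T -> R) :
  {in P &, injective idx} ->
  expect (fun x => (\sum_(j | P j) f j (x (idx j)) - \sum_(j | P j) \sum_s w (idx j) s * f j s) ^+ 2)
  <= \sum_(j | P j) \sum_s w (idx j) s * f j s ^+ 2.
Proof.
move=> idxI; pose e j := \sum_s w (idx j) s * f j s.
have e0 j : \sum_s w (idx j) s * (f j s - e j) = 0.
  under eq_bigr do rewrite mulrBr.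
  by rewrite sumrB -big_distrl /= w_sum1 mul1r subrr.
have -> : expect (fun x => (\sum_(j | P j) f j (x (idx j)) - \sum_(j | P j) e j) ^+ 2) =
  expect (fun x => \sum_(j | P j) \sum_(k | P k) (f j (x (idx j)) - e j) * (f k (x (idx k)) - e k)).
  by apply: eq_expect => x; rewrite -sumrB expr2 big_distrlr.
rewrite expect_sum; apply: ler_sum => j Pj; rewrite expect_sum (bigD1 j) //= [X in _ + X]big1 ?addr0.
  rewrite (expect_coord _ (fun s => (f j s - e j) * (f j s - e j))).
  have -> : \sum_s w (idx j) s * ((f j s - e j) * (f j s - e j)) =
      \sum_s w (idx j) s * f j s ^+ 2 - e j ^+ 2.
    transitivity (\sum_s (w (idx j) s * f j s ^+ 2 - (e j *+ 2 * (w (idx j) s * f j s) - e j ^+ 2 * w (idx j) s))).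
      by apply: eq_bigr => s _; ring.
    by rewrite !sumrB -!big_distrr /= w_sum1 -/(e j); ring.
  by rewrite gerBl sqr_ge0.
move=> k /andP[Pk kj].
rewrite (expect_coord2 (fun s => f j s - e j) (fun s => f k s - e k)) ?e0 ?mul0r //.
by apply: contra kj => /eqP /idxI -> .
Qed.

Lemma eq_prob A B : A =1 B -> prob A = prob B.
Proof. by move=> AB; apply: eq_expect => x; rewrite AB. Qed.

Lemma prob_ge0 A : 0 <= prob A.
Proof. by apply: sumr_ge0 => x _; rewrite mulr_ge0 ?mass_ge0. Qed.

Lemma le_prob (A B : pred {ffun I -> T}) : (forall x, A x -> B x) -> prob A <= prob B.
Proof. by move=> AB; apply: ler_expect => x; rewrite ler_nat; case: (A x) (AB x) => // ->. Qed.

Lemma prob_le1 A : prob A <= 1.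
Proof. by rewrite -[1](expect_cst 1); apply: ler_expect => x; rewrite lern1 leq_b1. Qed.

Lemma probC A : prob (predC A) = 1 - prob A.
Proof.
apply/eqP; rewrite -(expect_cst 1) eq_sym subr_eq /prob -expectD; apply/eqP.
by apply: eq_expect => x /=; case: (A x); rewrite ?add0r ?addr0.
Qed.

Lemma probU A B : prob (predU A B) <= prob A + prob B.
Proof.
rewrite /prob -expectD; apply: ler_expect => x /=; rewrite -natrD ler_nat.
by case: (A x); case: (B x).
Qed.

Lemma prob_exists (J : finType) (A : J -> pred {ffun I -> T}) :
  prob (fun x => [exists j, A j x]) <= \sum_j prob (A j).
Proof.
rewrite /prob -expect_sum; apply: ler_expect => x; rewrite -natr_sum ler_nat.
case: existsP => // -[j Aj]; by rewrite (bigD1 j) //= Aj.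
Qed.

Lemma markov_expect (A : pred {ffun I -> T}) (f : {ffun I -> T} -> R) : (forall x, 0 <= f x) -> (forall x, A x -> 1 <= f x) ->
  prob A <= expect f.
Proof. by move=> f0 f1; apply: ler_expect => x; case: (boolP (A x)) => // /f1. Qed.

Lemma chebyshev_sum (J : finType) (P : pred J) (idx : J -> I) (f : J -> T -> R) (v c : R) :
  {in P &, injective idx} -> 0 < c ->
  \sum_(j | P j) \sum_s w (idx j) s * f j s ^+ 2 <= v ->
  prob (fun x => c <= `|\sum_(j | P j) f j (x (idx j)) -
                        \sum_(j | P j) \sum_s w (idx j) s * f j s|) <= v / c ^+ 2.
Proof.
move=> idxI c0 vP.
apply: le_trans (_ : expect (fun x => (c ^+ 2)^-1 * (\sum_(j | P j) f j (x (idx j)) -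
   \sum_(j | P j) \sum_s w (idx j) s * f j s) ^+ 2) <= _).
  apply: markov_expect => x; first by rewrite mulr_ge0 ?sqr_ge0 // invr_ge0 sqr_ge0.
  move=> cx; rewrite mulrC ler_pdivlMr ?exprn_gt0 // mul1r -[X in _ <= X]real_normK ?num_real //.
  by rewrite lerXn2r ?nnegrE ?normr_ge0 // ltW.
rewrite expectZ mulrC ler_pM2r ?invr_gt0 ?exprn_gt0 //.
exact: le_trans (expect_sqr_sum _ idxI) vP.
Qed.

(** The exponential Markov inequality at threshold 0; the Chernoff parameter is absorbed into
    [f]. *)
Lemma chernoff_sum (J : finType) (P : pred J) (idx : J -> I) (f : J -> T -> R) (u : J -> R) :
  {in P &, injective idx} ->
  (forall j, P j -> \sum_s w (idx j) s * expR (f j s) <= expR (u j)) ->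
  prob (fun x => 0 <= \sum_(j | P j) f j (x (idx j))) <= expR (\sum_(j | P j) u j).
Proof.
move=> idxI fu.
apply: le_trans (_ : expect (fun x => \prod_(j | P j) expR (f j (x (idx j)))) <= _).
  apply: markov_expect => x; first by apply: prodr_ge0 => *; exact: expR_ge0.
  by rewrite -expR_sum -expR0 ler_expR.
rewrite (expect_prod_inj (fun j s => expR (f j s)) idxI) expR_sum.
apply: ler_prod => j Pj; rewrite fu // andbT.
by apply: sumr_ge0 => s _; rewrite mulr_ge0 ?expR_ge0.
Qed.

End ProductLaw.

(** * Poisson approximation of the divergence *)

Section Divergence.
Variable R : realType.
Implicit Types (s x y z d : R).

(** Exponential form of the weighted geometric mean: its logarithm is affine in [s], which makes
    scaling, continuity and tilting immediate. *)
Definition geo_mean s x y : R := expR (s * ln x + (1 - s) * ln y).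

(* First-order term, for Poisson rates x and y, of the exponent in Chernoff's
   bound with parameter s. *)
Definition poisson_div s x y : R := s * x + (1 - s) * y - geo_mean s x y.

Lemma ln_le_sub1 x : 0 < x -> ln x <= x - 1.
Proof. by move=> x0; have := expR_ge1Dx (ln x); rewrite lnK ?posrE //; lra. Qed.

Lemma ln1B_ge x : 0 <= x <= 1 / 2 -> - x - 2 * x ^+ 2 <= ln (1 - x).
Proof.
move=> /andP[x0 x1]; have p : 0 < 1 - x by lra.
have := @ln_le_sub1 (1 - x)^-1; rewrite invr_gt0 lnV ?posrE // => /(_ p) H.
suff : (1 - x)^-1 <= 1 + x + 2 * x ^+ 2 by lra.
rewrite -[(1 - x)^-1]mul1r ler_pdivrMr //.
have : 0 <= x ^+ 2 * (1 - 2 * x) by rewrite mulr_ge0 ?sqr_ge0 //; lra.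
by rewrite !expr2; nra.
Qed.

Lemma geo_mean_gt0 s x y : 0 < geo_mean s x y.
Proof. exact: expR_gt0. Qed.

(** Weighted AM-GM. The tangent inequality [key] is averaged over [x] and [y] with weights [s] and
    [1 - s]; the logarithms then add up to [ln g] and cancel. *)
Lemma geo_mean_le s x y : 0 <= s <= 1 -> 0 < x -> 0 < y ->
  geo_mean s x y <= s * x + (1 - s) * y.
Proof.
move=> /andP[s0 s1] x0 y0; set g := geo_mean s x y.
have g0 : 0 < g by exact: geo_mean_gt0.
have lg : ln g = s * ln x + (1 - s) * ln y by rewrite /g /geo_mean expRK.
have key (u : R) : 0 < u -> g * (1 + ln u - ln g) <= u.
  move=> u0; have ug : 0 < u / g by rewrite divr_gt0.
  have := ln_le_sub1 ug; rewrite ln_div ?posrE // => H.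
  have := ler_wpM2l (ltW g0) H; rewrite mulrBr mulrBr mulrCA divff ?gt_eqF //.
  lra.
have kx := ler_wpM2l s0 (key _ x0).
have s1' : 0 <= 1 - s by lra.
have ky := ler_wpM2l s1' (key _ y0).
apply: le_trans (lerD kx ky).
by rewrite lg le_eqVlt; apply/orP; left; apply/eqP; ring.
Qed.

Lemma poisson_div_ge0 s x y : 0 <= s <= 1 -> 0 < x -> 0 < y -> 0 <= poisson_div s x y.
Proof. by move=> s01 x0 y0; rewrite subr_ge0 geo_mean_le. Qed.

Lemma poisson_div_le s x y : 0 <= s <= 1 -> 0 < x -> 0 < y -> poisson_div s x y <= x + y.
Proof.
move=> /andP[s0 s1] x0 y0; have := geo_mean_gt0 s x y; rewrite /poisson_div.
have : s * x <= x by rewrite ler_piMl // ltW.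
have s1' : 1 - s <= 1 by lra.
have : (1 - s) * y <= y by rewrite ler_piMl // ltW.
lra.
Qed.

(** At [s = 1/2] the divergence is half the square of the difference of the square roots. *)
Lemma poisson_div_half_gt0 x y : 0 < x -> 0 < y -> x != y -> 0 < poisson_div 2^-1 x y.
Proof.
move=> x0 y0 xy.
have E (u : R) : 0 < u -> u = expR (2^-1 * ln u) ^+ 2.
  by move=> u0; rewrite -expRM_natl mulrA divff ?mul1r ?lnK ?posrE.
have -> : poisson_div 2^-1 x y = 2^-1 * (expR (2^-1 * ln x) - expR (2^-1 * ln y)) ^+ 2.
  rewrite /poisson_div /geo_mean (_ : 1 - 2^-1 = 2^-1 :> R); last by field.
  by rewrite expRD {1}(E _ x0) {1}(E _ y0); field.
rewrite mulr_gt0 ?invr_gt0 // lt_neqAle sqr_ge0 eq_sym sqrf_eq0 subr_eq0 andbT.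
by apply: contra xy => /eqP e; rewrite (E _ x0) (E _ y0) e.
Qed.

Lemma geo_meanE s x y : 0 < x -> x * expR ((1 - s) * (ln y - ln x)) = geo_mean s x y.
Proof. by move=> x0; rewrite -{1}(@lnK _ x) ?posrE // -expRD; congr expR; ring. Qed.

Lemma geo_meanZ d s x y : 0 < d -> 0 < x -> 0 < y ->
  geo_mean s (x * d) (y * d) = d * geo_mean s x y.
Proof.
move=> d0 x0 y0; rewrite /geo_mean !lnM ?posrE // -[X in _ = X * _](@lnK _ d) ?posrE // -expRD.
by congr expR; ring.
Qed.

Lemma ln_geo_mean s x y : ln (geo_mean s x y) = s * ln x + (1 - s) * ln y.
Proof. exact: expRK. Qed.

(** By [1 + u <= expR u], the moment generating function of a Bernoulli edge is at most that of a
    Poisson edge of the same mean. This is why scoring with the Poisson likelihood produces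
    [poisson_div] without any error term. The true rate [z] may differ from [x], which accounts for
    wrongly labelled neighbours. *)
Lemma poisson_score_mgf d s z x y : 0 <= z * d <= 1 ->
  z * d * expR ((1 - s) * (ln y - ln x - d * (y - x))) +
  (1 - z * d) * expR ((1 - s) * (- d * (y - x)))
  <= expR (d * (z * expR ((1 - s) * (ln y - ln x)) - z - (1 - s) * (y - x))).
Proof.
move=> zd; set E := expR ((1 - s) * (ln y - ln x)).
have -> : expR ((1 - s) * (ln y - ln x - d * (y - x))) = E * expR (- d * ((1 - s) * (y - x))).
  by rewrite -expRD; congr expR; ring.
have -> : expR ((1 - s) * (- d * (y - x))) = expR (- d * ((1 - s) * (y - x))).
  by congr expR; ring.
have -> : d * (z * E - z - (1 - s) * (y - x)) = z * d * (E - 1) + - d * ((1 - s) * (y - x)) by ring.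
rewrite expRD mulrA -mulrDl ler_pM2r ?expR_gt0 //.
by apply: le_trans (expR_ge1Dx _); lra.
Qed.

Definition renyi_sum s x y : R := (1 - x) `^ s * (1 - y) `^ (1 - s) + x `^ s * y `^ (1 - s).

Lemma powR_geo_mean s x y : 0 < x -> 0 < y -> x `^ s * y `^ (1 - s) = geo_mean s x y.
Proof. by move=> x0 y0; rewrite /powR !gt_eqF // -expRD. Qed.

(** AM-GM bounds the non-edge term by its linear part, and [ln u <= u - 1] does the rest, without
    any smallness of [d]. The cases of edge probability 1 are separate because [geo_mean] needs
    positive arguments. *)
Lemma poisson_div_le_renyi d s x y : 0 < s < 1 -> 0 < d -> 0 < x -> 0 < y ->
  x * d <= 1 -> y * d <= 1 ->
  d * poisson_div s x y <= - ln (renyi_sum s (x * d) (y * d)).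
Proof.
move=> /andP[s0 s1] d0 x0 y0 xd yd.
have s01 : 0 <= s <= 1 by rewrite (ltW s0) (ltW s1).
have g0 : 0 < geo_mean s (x * d) (y * d) by exact: geo_mean_gt0.
have le1 : (1 - x * d) `^ s * (1 - y * d) `^ (1 - s) <= s * (1 - x * d) + (1 - s) * (1 - y * d).
  have t0 : 0 <= 1 - s by lra.
  have pos : 0 <= s * (1 - x * d) + (1 - s) * (1 - y * d).
    by rewrite addr_ge0 // mulr_ge0 ?subr_ge0 // ?(ltW s0) ?(ltW s1).
  case: (eqVneq (x * d) 1) => [xd1|xd1].
    by apply: le_trans pos; rewrite {1}xd1 subrr powR0 ?gt_eqF // mul0r.
  case: (eqVneq (y * d) 1) => [yd1|yd1].
    by apply: le_trans pos; rewrite {1}yd1 subrr powR0 ?subr_eq0 ?gt_eqF // mulr0.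
  have x1 : 0 < 1 - x * d by rewrite subr_gt0 lt_neqAle xd1.
  have y1 : 0 < 1 - y * d by rewrite subr_gt0 lt_neqAle yd1.
  by rewrite powR_geo_mean // geo_mean_le.
have ge0 : 0 <= (1 - x * d) `^ s * (1 - y * d) `^ (1 - s) by rewrite mulr_ge0 ?powR_ge0.
rewrite /renyi_sum (@powR_geo_mean s (x * d)) ?mulr_gt0 //.
have rs0 := ltr_wpDl ge0 g0; have := ln_le_sub1 rs0.
rewrite geo_meanZ // /poisson_div in g0 le1 *.
lra.
Qed.

Lemma renyi_le_poisson_div d s x y M : 0 < s < 1 -> 0 < d -> 0 < x <= M -> 0 < y <= M ->
  8 * M * d <= 1 ->
  - ln (renyi_sum s (x * d) (y * d)) <= d * poisson_div s x y + 22 * (M * d) ^+ 2.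
Proof.
move=> /andP[s0 s1] d0 /andP[x0 xM] /andP[y0 yM] Md1.
have s01 : 0 <= s <= 1 by rewrite (ltW s0) (ltW s1).
have M0 : 0 < M by exact: lt_le_trans xM.
set e := M * d; have e0 : 0 < e by rewrite mulr_gt0.
have e1 : e <= 8^-1 by rewrite /e; lra.
have xd0 : 0 < x * d by rewrite mulr_gt0.
have yd0 : 0 < y * d by rewrite mulr_gt0.
have xe : x * d <= e by rewrite ler_pM2r.
have ye : y * d <= e by rewrite ler_pM2r.
have x1 : 0 < 1 - x * d by lra.
have y1 : 0 < 1 - y * d by lra.
have lx : - (x * d) - 2 * e ^+ 2 <= ln (1 - x * d).
  apply: le_trans (ln1B_ge (x := x * d) _); last by apply/andP; lra.
  have : (x * d) ^+ 2 <= e ^+ 2 by rewrite lerXn2r ?nnegrE // ltW.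
  lra.
have ly : - (y * d) - 2 * e ^+ 2 <= ln (1 - y * d).
  apply: le_trans (ln1B_ge (x := y * d) _); last by apply/andP; lra.
  have : (y * d) ^+ 2 <= e ^+ 2 by rewrite lerXn2r ?nnegrE // ltW.
  lra.
have s1' : 0 <= 1 - s by lra.
have G1 : 1 - (s * (x * d) + (1 - s) * (y * d)) - 2 * e ^+ 2 <= geo_mean s (1 - x * d) (1 - y * d).
  apply: le_trans (expR_ge1Dx _).
  have := ler_wpM2l (ltW s0) lx; have := ler_wpM2l s1' ly; lra.
rewrite /renyi_sum !powR_geo_mean //.
set f := d * poisson_div s x y.
have fE : f = s * (x * d) + (1 - s) * (y * d) - geo_mean s (x * d) (y * d).
  by rewrite /f /poisson_div geo_meanZ //; ring.
have f0 : 0 <= f by rewrite mulr_ge0 ?poisson_div_ge0 // ltW.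
have f2 : f <= 2 * e.
  have := poisson_div_le s01 x0 y0 => /(ler_wpM2l (ltW d0)); rewrite -/f; lra.
(* Here [1 - w] bounds the sum from below. The losses are [2 * e ^+ 2] from the non-edge factors and
   [2 * w ^+ 2 <= 18 * e ^+ 2] from the outer logarithm, together below [22 * e ^+ 2]. *)
set w := f + 2 * e ^+ 2; have wE : w = f + 2 * e ^+ 2 by [].
have e2 : e ^+ 2 <= 8^-1 * e by rewrite expr2 ler_pM2r.
have w0 : 0 <= w by rewrite addr_ge0 // mulr_ge0 // sqr_ge0.
have w2 : w <= 3 * e by lra.
have w1 : w <= 1 / 2 by lra.
have := ln1B_ge (x := w) _; rewrite w0 w1 => /(_ isT) H.
have ww : w ^+ 2 <= 9 * e ^+ 2.
  by rewrite (_ : 9 * e ^+ 2 = (3 * e) ^+ 2); [rewrite lerXn2r ?nnegrE //; lra|ring].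
have : ln (1 - w) <= ln (geo_mean s (1 - x * d) (1 - y * d) + geo_mean s (x * d) (y * d)).
  have G2 : 1 - w <= geo_mean s (1 - x * d) (1 - y * d) + geo_mean s (x * d) (y * d) by lra.
  have G3 : 0 < 1 - w by lra.
  by rewrite ler_ln ?posrE // (lt_le_trans G3).
have := sqr_ge0 e.
lra.
Qed.

End Divergence.

(** * The Chernoff-Hellinger divergence for Poisson rates, its slope and its tilted rates *)

Section Chernoff_Hellinger.
Variables (R : realType) (L : finType) (pi : L -> R) (A : L -> L -> R).
Hypothesis pi_gt0 : forall c, 0 < pi c.
Hypothesis A_gt0 : forall a b, 0 < A a b.
Implicit Types (a b c : L) (s : R).

Definition poisson_CH_at s a b : R := \sum_c pi c * poisson_div s (A a c) (A b c).

Definition poisson_CH a b : R := sup [set poisson_CH_at s a b | s in [set s : R | 0 < s < 1]]%classic.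

Lemma poisson_CH_has_sup a b :
  has_sup [set poisson_CH_at s a b | s in [set s : R | 0 < s < 1]]%classic.
Proof.
split; first by exists (poisson_CH_at 2^-1 a b); exists 2^-1 => //=; apply/andP; lra.
exists (\sum_c pi c * (A a c + A b c)) => _ [s /= /andP[s0 s1] <-].
apply: ler_sum => c _; rewrite ler_wpM2l ?(ltW (pi_gt0 _)) //.
by apply: poisson_div_le => //; rewrite (ltW s0) (ltW s1).
Qed.

Lemma poisson_CH_at_le s a b : 0 < s < 1 -> poisson_CH_at s a b <= poisson_CH a b.
Proof. by move=> s01; apply: (sup_upper_bound (poisson_CH_has_sup a b)); exists s. Qed.

Lemma poisson_CH_approx a b e : 0 < e ->
  exists2 s, 0 < s < 1 & poisson_CH a b - e < poisson_CH_at s a b.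
Proof. by move=> /sup_adherent /(_ (poisson_CH_has_sup a b)) [_ [s s01 <-] lt]; exists s. Qed.

Lemma poisson_CH_gt0 a b c : A a c != A b c -> 0 < poisson_CH a b.
Proof.
move=> ne; have s01 : 0 < (2^-1 : R) < 1 by apply/andP; lra.
apply: lt_le_trans (poisson_CH_at_le a b s01).
have s01' : 0 <= (2^-1 : R) <= 1 by apply/andP; lra.
rewrite /poisson_CH_at (bigD1 c) //= ltr_wpDr //.
  by apply: sumr_ge0 => c' _; rewrite mulr_ge0 ?(ltW (pi_gt0 _)) ?poisson_div_ge0.
by rewrite mulr_gt0 ?poisson_div_half_gt0.
Qed.

Definition tilt s a b c : R := geo_mean s (A a c) (A b c).

(* The derivative in s of poisson_CH_at. *)
Definition poisson_CH_slope s a b : R :=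
  \sum_c pi c * (tilt s a b c * (ln (A b c) - ln (A a c)) - (A b c - A a c)).

(** At [s = 0] and [s = 1] the slope is, up to sign, a Poisson relative entropy between the two
    rows: positive at 0, negative at 1. The intermediate value theorem gives every small positive
    value strictly inside. *)
Lemma poisson_CH_slope_attained a b c : A a c != A b c ->
  exists2 e0, 0 < e0 & forall e, 0 < e <= e0 ->
    exists2 s, 0 < s < 1 & poisson_CH_slope s a b = e.
Proof.
move=> ne.
have key (x y : R) : 0 < x -> 0 < y -> 0 <= y * (ln y - ln x) - (y - x) /\
    (x != y -> 0 < y * (ln y - ln x) - (y - x)).
  move=> x0 y0; have E : x = y * expR (ln x - ln y).
    by rewrite expRB !lnK ?posrE // mulrCA divff ?mulr1 ?gt_eqF.
  have -> : y * (ln y - ln x) - (y - x) = y * (expR (ln x - ln y) - (1 + (ln x - ln y))).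
    by rewrite {2}E; ring.
  split; first by rewrite mulr_ge0 ?(ltW y0) // subr_ge0 expR_ge1Dx.
  move=> xy; rewrite mulr_gt0 // subr_gt0 expR_gt1Dx // subr_eq0.
  by apply: contra xy => /eqP /ln_inj -> //; rewrite posrE.
have tilt0 a' : tilt 0 a b a' = A b a' by rewrite /tilt /geo_mean mul0r add0r subr0 mul1r lnK ?posrE.
have tilt1 a' : tilt 1 a b a' = A a a' by rewrite /tilt /geo_mean subrr mul0r addr0 mul1r lnK ?posrE.
have S0 : 0 < poisson_CH_slope 0 a b.
  rewrite /poisson_CH_slope (bigD1 c) //= tilt0 ltr_wpDr //.
    by apply: sumr_ge0 => c' _; rewrite tilt0 mulr_ge0 ?(ltW (pi_gt0 _)) ?(key _ _ (A_gt0 a c') (A_gt0 b c')).1.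
  by rewrite mulr_gt0 ?(key _ _ _ _).2.
have S1 : poisson_CH_slope 1 a b < 0.
  rewrite -oppr_gt0 /poisson_CH_slope -sumrN (bigD1 c) //= tilt1 ltr_wpDr //.
    apply: sumr_ge0 => c' _; rewrite tilt1 -mulrN mulr_ge0 ?(ltW (pi_gt0 _)) //.
    have := (key _ _ (A_gt0 b c') (A_gt0 a c')).1; lra.
  rewrite -mulrN mulr_gt0 //; have := (key _ _ (A_gt0 b c) (A_gt0 a c)).2.
  rewrite eq_sym => /(_ ne); lra.
exists (poisson_CH_slope 0 a b / 2); first by rewrite divr_gt0.
move=> e /andP[e0 e1].
have cont : {within `[0, 1], continuous (fun s => poisson_CH_slope s a b)}%classic.
  apply: continuous_subspaceT => s; apply: cvg_big => [|c' _]; first exact: add_continuous.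
  apply: cvgM; first exact: cvg_cst.
  apply: cvgB; last exact: cvg_cst.
  apply: cvgM; last exact: cvg_cst.
  apply: continuous_comp; last exact: continuous_expR.
  apply: cvgD; first by apply: cvgM; [exact: cvg_id|exact: cvg_cst].
  by apply: cvgM; [apply: cvgB; [exact: cvg_cst|exact: cvg_id]|exact: cvg_cst].
have := @IVT R (fun s => poisson_CH_slope s a b) 0 1 e ler01 cont.
case=> [|s s01 sE]; first by rewrite ge_min le_max; apply/andP; split; apply/orP; [right|left]; lra.
exists s => //; move: s01; rewrite in_itv /= => /andP[s0 s1].
rewrite !lt_neqAle s0 s1 !andbT; apply/andP; split; apply/eqP => E.
  by move: sE; rewrite -E => H; lra.
by move: sE; rewrite E => H; lra.
Qed.

(** The left side is the Poisson relative entropy of the tilted rates with respect to row [a], that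
    is the price of the change of measure. With a small positive slope it exceeds [poisson_CH] by at
    most that slope, whether or not [s] is optimal. *)
Lemma tilt_divergence s a b :
  \sum_c pi c * (tilt s a b c * (ln (tilt s a b c) - ln (A a c)) - (tilt s a b c - A a c)) =
  poisson_CH_at s a b + (1 - s) * poisson_CH_slope s a b.
Proof.
rewrite /poisson_CH_at /poisson_CH_slope big_distrr -big_split /=; apply: eq_bigr => c _.
by rewrite /poisson_div -/(tilt s a b c) ln_geo_mean; ring.
Qed.

End Chernoff_Hellinger.

(** * Law of the graph *)

Section GraphLaw.
Variables (R : realType) (N : nat).
Implicit Types (i j : 'I_N) (e : 'I_N * 'I_N) (x : {ffun 'I_N * 'I_N -> bool}).

Definition edge i j : 'I_N * 'I_N := if (i < j)%N then (i, j) else (j, i).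

Lemma edgeC i j : edge i j = edge j i.
Proof. by rewrite /edge; case: ltngtP => // /val_inj ->. Qed.

Lemma edge_inj i : injective (edge i).
Proof.
move=> j k; rewrite /edge.
case: ltngtP => [ij|ji|/val_inj <-]; case: ltngtP => [ik|ki|/val_inj <-] // [] //.
- by move=> ->.
- by move=> -> ->.
Qed.

Lemma edge_lt i j : (i < j)%N -> edge i j = (i, j).
Proof. by rewrite /edge => ->. Qed.

Lemma edge_ordered i j : i != j -> ((edge i j).1 < (edge i j).2)%N.
Proof. by rewrite /edge -(inj_eq val_inj) neq_ltn; case: ifP => //= _. Qed.

(* The values at the pairs (i, j) with j <= i are not used. *)
Definition graph_fun x : {ffun 'I_N * 'I_N -> bool} :=
  [ffun e => (e.1 != e.2) && x (edge e.1 e.2)].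

Lemma graph_fun_subproof x :
  [forall i, ~~ graph_fun x (i, i)] &&
  [forall i, forall j, graph_fun x (i, j) == graph_fun x (j, i)].
Proof.
apply/andP; split; first by apply/forallP => i; rewrite ffunE eqxx.
by apply/'forall_'forall_eqP => i j; rewrite !ffunE /= eq_sym edgeC.
Qed.

Definition mkgraph x : graph N := exist _ (graph_fun x) (graph_fun_subproof x).

Lemma adj_mkgraph x i j : adj (mkgraph x) i j = (i != j) && x (edge i j).
Proof. by rewrite /adj ffunE. Qed.

Lemma adjC (g : graph N) i j : adj g i j = adj g j i.
Proof. by have /andP[_ /forallP/(_ i)/forallP/(_ j)/eqP] := valP g. Qed.

Lemma adj_irr (g : graph N) i : adj g i i = false.
Proof. by have /andP[/forallP/(_ i)/negbTE] := valP g. Qed.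

Lemma mkgraph_eqE x (g : graph N) :
  (mkgraph x == g) = [forall e : 'I_N * 'I_N, (e.1 < e.2)%N ==> (x e == adj g e.1 e.2)].
Proof.
apply/eqP/forallP => [<- -[i j]|H].
  apply/implyP => /= ij; rewrite adj_mkgraph edge_lt //.
  by rewrite (_ : i != j) // -val_eqE /= ltn_eqF.
apply: val_inj; apply/ffunP => -[i j]; rewrite ffunE /=.
have [->|ij] /= := eqVneq i j; first by have := adj_irr g j; rewrite /adj => ->.
have := H (edge i j); rewrite edge_ordered //= => /eqP ->.
by rewrite /edge; case: ifP => //= _; rewrite adjC.
Qed.

Definition bernoulli_weight (q : 'I_N -> 'I_N -> R) e (b : bool) : R :=
  if b then q e.1 e.2 else 1 - q e.1 e.2.

Lemma bernoulli_weight_sum1 q e : \sum_b bernoulli_weight q e b = 1.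
Proof. by rewrite big_bool /= addrC subrK. Qed.

Lemma bernoulli_weight_ge0 q e b : (forall i j, 0 <= q i j <= 1) -> 0 <= bernoulli_weight q e b.
Proof. by move=> /(_ e.1 e.2) /andP[q0 q1]; case: b => //=; rewrite subr_ge0. Qed.

Lemma bernoulli_weight_edge q i j b : (forall i j, q i j = q j i) ->
  bernoulli_weight q (edge i j) b = if b then q i j else 1 - q i j.
Proof. by move=> qC; rewrite /edge /bernoulli_weight; case: (_ < _)%N => //=; case: b; rewrite qC. Qed.

Lemma sum_bernoulli_weight_edge q i j (f : bool -> R) : (forall i j, q i j = q j i) ->
  \sum_b bernoulli_weight q (edge i j) b * f b = q i j * f true + (1 - q i j) * f false.
Proof. by move=> qC; rewrite big_bool !bernoulli_weight_edge. Qed.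

(** A graph fixes only the coordinates above the diagonal; the remaining ones are summed out with
    total weight 1. Events on graphs thus become events under a product law. *)
Lemma sum_graph q (F : graph N -> R) :
  \sum_g (\prod_(i < N) \prod_(j < N | (i < j)%N)
     (if adj g i j then q i j else 1 - q i j)) * F g =
  expect (bernoulli_weight q) (F \o mkgraph).
Proof.
rewrite /expect (partition_big mkgraph predT) //=; apply: eq_bigr => g _.
transitivity (F g * \sum_(x | mkgraph x == g) mass (bernoulli_weight q) x); last first.
  by rewrite big_distrr /=; apply: eq_bigr => x /eqP ->; rewrite mulrC.
rewrite mulrC; congr (_ * _).
transitivity (expect (bernoulli_weight q) (fun x =>
    \prod_(e : 'I_N * 'I_N) ((e.1 < e.2)%N ==> (x e == adj g e.1 e.2))%:R)); last first.
  rewrite [RHS]big_mkcond; apply: eq_bigr => x _; rewrite mkgraph_eqE.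
  case: forallP => [H|H]; first by rewrite big1 ?mulr1 // => e _; rewrite H.
  have /existsP[e He] : [exists e : 'I_N * 'I_N, ~~ ((e.1 < e.2)%N ==> (x e == adj g e.1 e.2))].
    by rewrite -negb_forall; apply/forallP.
  by rewrite (bigD1 e) //= (negbTE He) mul0r mulr0.
rewrite (expect_prod _ (fun e b => ((e.1 < e.2)%N ==> (b == adj g e.1 e.2))%:R)).
rewrite pair_big_dep /= big_mkcond; apply: eq_bigr => -[i j] _ /=.
case: ifP => ij; last by under [RHS]eq_bigr do rewrite mulr1; rewrite bernoulli_weight_sum1.
by rewrite big_bool /=; case: (adj g i j); rewrite !(mulr0, mulr1, addr0, add0r).
Qed.

End GraphLaw.

(** * Joint law of the assignment and the graph *)

Section Joint.
Variables (R : realType) (t : btree) (pi : leaf t -> R) (p : node t -> R) (N : nat).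

Definition edge_prob (s : assignment t N) (i j : 'I_N) : R := p (lca (s i) (s j)).

Lemma edge_probC s i j : edge_prob s i j = edge_prob s j i.
Proof. by rewrite /edge_prob lcaC. Qed.

Definition graph_weight (s : assignment t N) := bernoulli_weight (edge_prob s).

Definition joint_prob (E : assignment t N -> graph N -> bool) : R :=
  \sum_s \sum_g hsbm_pmf pi p s g * (E s g)%:R.

Lemma joint_probE E :
  joint_prob E = expect (fun=> pi) (fun s => prob (graph_weight s) (fun x => E s (mkgraph x))).
Proof.
rewrite /joint_prob /expect; apply: eq_bigr => s _; rewrite /mass /prob.
rewrite -(sum_graph (edge_prob s) (fun g => (E s g)%:R)) big_distrr /=.
by apply: eq_bigr => g _; rewrite /hsbm_pmf mulrA.
Qed.

Hypothesis pi_ge0 : forall c, 0 <= pi c.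
Hypothesis pi_sum1 : \sum_c pi c = 1.
Hypothesis p01 : (0 < N)%N -> forall u, 0 <= p u <= 1.

Lemma edge_prob01 s i j : 0 <= edge_prob s i j <= 1.
Proof. by apply: p01; apply: leq_ltn_trans (ltn_ord i). Qed.

Lemma graph_weight_ge0 s e b : 0 <= graph_weight s e b.
Proof. by apply: bernoulli_weight_ge0 => i j; exact: edge_prob01. Qed.

Lemma graph_weight_sum1 s e : \sum_b graph_weight s e b = 1.
Proof. exact: bernoulli_weight_sum1. Qed.

Lemma hsbm_pmf_ge0 (s : assignment t N) (g : graph N) : 0 <= hsbm_pmf pi p s g.
Proof.
rewrite mulr_ge0 ?prodr_ge0 // => i _; apply: prodr_ge0 => j _.
by case: ifP => _; rewrite ?subr_ge0; have /andP[] := edge_prob01 s i j.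
Qed.

Lemma joint_prob_total : joint_prob (fun _ _ => true) = 1.
Proof.
rewrite joint_probE -[RHS](expect_cst (I := 'I_N) (fun=> pi_sum1)).
by apply: eq_expect => s; exact: expect_cst (graph_weight_sum1 s) 1.
Qed.

Lemma joint_prob_cond (typ : pred (assignment t N)) E b :
  0 <= b -> (forall s, typ s -> prob (graph_weight s) (fun x => E s (mkgraph x)) <= b) ->
  joint_prob E <= prob (fun=> pi) (predC typ) + b.
Proof.
move=> b0 H; rewrite joint_probE -[b in X in _ <= X](expect_cst (I := 'I_N) (fun=> pi_sum1) b).
rewrite /prob -expectD; apply: ler_expect => // s /=.
case: (boolP (typ s)) => [ts|_] /=; first by rewrite add0r H.
by apply: le_trans (prob_le1 (graph_weight_ge0 s) (graph_weight_sum1 s) _) _; rewrite lerDl.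
Qed.

End Joint.

Section Loss.
Variables (t : btree) (q N : nat).
Implicit Types (s : assignment t N) (C : super t q -> {set 'I_N}).

Lemma loss_eq0P s C :
  reflect (exists tau : {perm super t q}, forall u, super_community s u = C (tau u))
          (loss s C == 0%N).
Proof.
have mis0 tau : (mismatch s C tau == 0)%N = [forall u, super_community s u == C (tau u)].
  rewrite /mismatch sum_nat_eq0; apply: eq_forallb => u /=.
  by rewrite cards_eq0 finset.setU_eq0 !finset.setD_eq0 -finset.eqEsubset.
apply: (iffP eqP) => [|[tau tauP]].
  have : exists tau, loss s C = mismatch s C tau.
    rewrite /loss; elim/big_ind: _ => [|x y [tx ->] [ty ->]|tau _]; first by exists 1%g.
      by rewrite /minn; case: ifP => _; [exists tx|exists ty].
    by exists tau.
  by move=> [tau ->] /eqP; rewrite mis0 => /forallP H; exists tau => u; apply/eqP.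
have m0 : mismatch s C tau = 0%N by apply/eqP; rewrite mis0; apply/forallP => u; apply/eqP.
apply/eqP; rewrite -leqn0 -m0 /loss -leEnat -minEnat.
exact: bigmin_le_cond.
Qed.

Lemma mem_super_community s (u : super t q) i :
  (i \in super_community s u) = (u == super_of q (s i)).
Proof. by rewrite inE ancestor_super. Qed.

(** Since [h] respects [same_super], it acts on super-communities; this action is the permutation
    that annihilates the loss. *)
Lemma loss_super_community (s s' : assignment t N) (h : {perm leaf t}) :
  (forall x y, same_super q (h x) (h y) = same_super q x y) ->
  (forall i, same_super q (s' i) (h (s i))) ->
  loss s (super_community (q := q) s') = 0%N.
Proof.
move=> hs sh.
have inv (u : super t q) : {x : leaf t | super_of q x = u} by apply: cid; exact: super_of_surj.
pose f u := super_of q (h (projT1 (inv u))).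
have fE x : f (super_of q x) = super_of q (h x).
  rewrite /f; apply/eqP; rewrite super_of_eq hs -super_of_eq.
  by rewrite (projT2 (inv (super_of q x))).
have finj : injective f.
  move=> u v; have [x <-] := super_of_surj u; have [y <-] := super_of_surj v.
  by rewrite !fE => /eqP; rewrite super_of_eq hs -super_of_eq => /eqP.
apply/eqP/loss_eq0P; exists (perm finj) => u; apply/setP => i.
rewrite !mem_super_community permE.
have /eqP -> : super_of q (s' i) == super_of q (h (s i)) by rewrite super_of_eq.
by rewrite -fE (inj_eq finj).
Qed.

(** The permutation has disappeared: the blocks alone decide which vertices belong together. This is
    what lets two assignments be compared through the same estimate. *)
Lemma loss0_same_super s C : loss s C = 0%N ->
  (forall i j, same_super q (s i) (s j) = [exists u, (i \in C u) && (j \in C u)]).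
Proof.
move=> /eqP/loss_eq0P[tau H] i j; rewrite -super_of_eq; apply/eqP/existsP.
  move=> E; exists (tau (super_of q (s i))); rewrite -H !mem_super_community eqxx.
  by rewrite E eqxx.
move=> [u]; rewrite -[u](permKV tau) -H !mem_super_community.
by move=> /andP[/eqP <- /eqP <-].
Qed.

End Loss.

Section LabelEstimator.
Variables (t : btree) (q : nat) (f : forall N, graph N -> assignment t N).

Lemma label_disjoint N (g : graph N) (u v : super t q) :
  u != v -> [disjoint super_community (f g) u & super_community (f g) v].
Proof.
move=> uv; apply/pred0P => i /=; rewrite !mem_super_community.
by apply: contraNF uv => /andP[/eqP -> /eqP ->].
Qed.

Lemma label_cover N (g : graph N) :
  (\bigcup_(u : super t q) super_community (f g) u)%SET = [set: 'I_N]%SET.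
Proof.
apply/setP => i; rewrite inE; apply/bigcupP; exists (super_of q (f g i)) => //.
by rewrite mem_super_community.
Qed.

Definition label_estimator : estimator t q := Estimator label_disjoint label_cover.

End LabelEstimator.

Lemma card_set_le_add (T : finType) (P Q S : pred T) : (forall x, P x -> Q x || S x) ->
  (#|[set x | P x]| <= #|[set x | Q x]| + #|[set x | S x]|)%N.
Proof.
move=> PQS; rewrite -cardsUI; apply: leq_trans (leq_addr _ _).
by apply: subset_leq_card; apply/fintype.subsetP => x; rewrite !inE; apply: PQS.
Qed.

(** * Labellings up to automorphism *)

Section Automorphism.
Variables (R : realType) (t : btree) (a : node t -> R).
Hypothesis a_child : forall u v, child u v -> a u < a v.
Implicit Types (g h : {perm leaf t}).

Definition rate (x y : leaf t) : R := a (lca x y).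

Lemma rateC x y : rate x y = rate y x.
Proof. by rewrite /rate lcaC. Qed.

(** A community is denser inside than towards any other one. This separates the rows of the rate
    matrix, and makes missing edges inside [x] favour a move out of [x]. *)
Lemma rate_lt x y : x != y -> rate x y < rate x x.
Proof.
move=> xy; rewrite /rate lcaa.
have anc : ancestor (lca x y) (val x) by rewrite /ancestor val_lca lcp_prefixl.
have [le lf] := increasing_ancestor a_child anc.
rewrite lt_neqAle le lf andbT; apply: contra xy => /eqP E.
by apply/eqP/lca_leaf_inj; rewrite E; exact: (valP x).
Qed.

Definition rate_aut h : bool := [forall x, forall y, rate (h x) (h y) == rate x y].

Lemma rate_autP h : reflect (forall x y, rate (h x) (h y) = rate x y) (rate_aut h).
Proof. by apply: (iffP 'forall_'forall_eqP). Qed.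

Lemma rate_aut_same_super h q x y : rate_aut h ->
  same_super q (h x) (h y) = same_super q x y.
Proof. by move=> /rate_autP H; apply: (automorphism_same_super a_child) (@perm_inj _ h) H _ _ _. Qed.

Lemma rate_autM g h : rate_aut g -> rate_aut h -> rate_aut (g * h)%g.
Proof. by move=> /rate_autP G /rate_autP H; apply/rate_autP => x y; rewrite !permM H G. Qed.

Lemma rate_autV h : rate_aut h -> rate_aut h^-1%g.
Proof. by move=> /rate_autP H; apply/rate_autP => x y; rewrite -H !permKV. Qed.

Section Alignment.
Variables (q N : nat) (th : R) (tau : 'I_N -> assignment t N) (b : 'I_N -> leaf t).

Definition close (r s : assignment t N) h : bool :=
  #|[set j | r j != h (s j)]%SET|%:R <= th * N%:R.

Lemma close_inv r s h : close r s h = close s r h^-1%g.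
Proof.
rewrite /close; congr (_%:R <= _); apply: eq_card => j; rewrite !inE.
by congr negb; apply/eqP/eqP => ->; rewrite ?permK ?permKV.
Qed.

(* The i-th leave-one-out labelling tau i is only determined up to an
   automorphism; a common reference assignment r aligns all of them. *)
Definition aligned (s : assignment t N) : bool :=
  [exists r : assignment t N, [forall i, [exists h, [&& rate_aut h,
     close r (tau i) h & s i == h (b i)]]]].

(** The true assignment is a suitable reference. The estimator does not know it, but by
    [aligned_sound] any reference that it finds serves as well. *)
Lemma aligned_exists (s : assignment t N) :
  (forall i, exists h, rate_aut h && close (tau i) s h) -> exists s', aligned s'.
Proof.
move=> /fin_all_exists[h hP].
exists [ffun i => (h i)^-1%g (b i)]; apply/existsP; exists s; apply/forallP => i.
have /andP[hi ci] := hP i.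
by apply/existsP; exists (h i)^-1%g; rewrite rate_autV // -close_inv ci ffunE eqxx.
Qed.

(** The reference [r] differs from [k i \o g i \o s] on at most [2 * th * N] vertices, for each [i].
    If the permutations for [i] and [j] disagreed at [x], every vertex of community [x] would be an
    error for one of them, against its size exceeding [4 * th * N]. Hence one automorphism serves
    all vertices. *)
Lemma aligned_sound (s s' : assignment t N) :
  (forall c, 4 * th * N%:R < #|[set j | s j == c]%SET|%:R) ->
  (forall i, exists h, [&& rate_aut h, close (tau i) s h & same_super q (b i) (h (s i))]) ->
  aligned s' ->
  exists2 h, rate_aut h & forall i, same_super q (s' i) (h (s i)).
Proof.
move=> big /fin_all_exists[g gP] /existsP[r /forallP Hr].
have Hr' i : exists h, [&& rate_aut h, close r (tau i) h & s' i == h (b i)] by apply/existsP.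
have [k kP] := fin_all_exists Hr'.
have far i : #|[set j | r j != (k i) ((g i) (s j))]%SET|%:R <= 2 * th * N%:R.
  have /and3P[_ c1 _] := gP i; have /and3P[_ c2 _] := kP i.
  apply: le_trans (_ : #|[set j | r j != k i (tau i j)]%SET|%:R +
     #|[set j | tau i j != g i (s j)]%SET|%:R <= _); last first.
    by rewrite -mulrA mulr2n mulrDl mul1r lerD.
  rewrite -natrD ler_nat; apply: card_set_le_add => j.
  by apply: contraR; rewrite negb_or !negbK => /andP[/eqP -> /eqP ->].
have same i j x : k i (g i x) = k j (g j x).
  have := big x; rewrite ltNge; apply: contraNeq => ne.
  apply: le_trans (_ : #|[set l | r l != k i (g i (s l))]%SET|%:R +
     #|[set l | r l != k j (g j (s l))]%SET|%:R <= _); last first.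
    by apply: le_trans (lerD (far i) (far j)) _; rewrite -mulrDl -mulrDl -natrD.
  rewrite -natrD ler_nat; apply: card_set_le_add => l /eqP ->.
  by case: (r l =P _) => // ->; rewrite ne.
case: (pickP 'I_N) => [i0 _|none]; last first.
  by exists 1%g; [apply/rate_autP => x y; rewrite !perm1|move=> i; have := none i].
have /and3P[ag _ _] := gP i0; have /and3P[ak _ _] := kP i0.
exists (g i0 * k i0)%g; first exact: rate_autM.
move=> i; have /and3P[_ _ sb] := gP i; have /and3P[ak' _ /eqP ->] := kP i.
by rewrite permM (same i0 i) rate_aut_same_super.
Qed.

End Alignment.
End Automorphism.

Section Confusion.
Variables (R : realType) (t : btree) (a : node t -> R).
Hypothesis a_child : forall u v, child u v -> a u < a v.
Variable N : nat.
Implicit Types s r : assignment t N.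

Let K := #|{: leaf t}|.

Definition cell s r (x y : leaf t) : {set 'I_N} := [set j | (s j == x) && (r j == y)]%SET.

(* If two communities x, x' of s meet y, y' in r on large sets only when
   rate x x' = rate y y', then r is s up to an automorphism and few errors. *)
Lemma confusion_close s r (al : R) :
  0 <= al ->
  (forall x, K%:R * al * N%:R <= #|[set j | s j == x]%SET|%:R) ->
  (forall x y x' y', al * N%:R <= #|cell s r x y|%:R -> al * N%:R <= #|cell s r x' y'|%:R ->
     rate a x x' = rate a y y') ->
  exists h, rate_aut a h && close (K%:R ^+ 2 * al) r s h.
Proof.
move=> al0 size H.
have cells x : #|[set j | s j == x]%SET| = (\sum_y #|cell s r x y|)%N.
  rewrite -sum1_card (partition_big r predT) //=; apply: eq_bigr => y _.
  by rewrite -sum1_card; apply: eq_bigl => j; rewrite !inE.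
(* Pigeonhole: [K] cells share a community of size at least [K * al * N]. *)
have ex x : exists y, al * N%:R <= #|cell s r x y|%:R.
  case: (pickP [pred y | al * N%:R <= #|cell s r x y|%:R]) => [y Hy|none]; first by exists y.
  have K0 : (0 < K)%N by apply/card_gt0P; exists x.
  have := size x; rewrite cells natr_sum leNgt => /negP[].
  apply: lt_le_trans (_ : \sum_(y : leaf t) (al * N%:R) <= _); last first.
    by rewrite sumr_const -/K -mulrA mulr_natl.
  apply: ltr_sum; last by move=> y _; have /= := none y; rewrite real_leNgt ?num_real // => /negbFE.
  by apply/hasP; exists x => //; rewrite mem_index_enum.
have [g gP] := fin_all_exists ex.
(* If two communities had large cells at the same [y], then [rate x x'] and [rate x x] would both
   equal [rate y y], contrary to [rate_lt]. So the choice of a large cell is injective. *)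
have uniq x y x' : al * N%:R <= #|cell s r x y|%:R -> al * N%:R <= #|cell s r x' y|%:R -> x = x'.
  move=> c1 c2; apply/eqP; apply: contraT => xx'.
  have := rate_lt a_child xx'; rewrite (H _ _ _ _ c1 c2) -(H _ _ _ _ c1 c1).
  by rewrite ltxx.
have ginj : injective g by move=> x x' E; apply: (uniq x (g x) x') => //; rewrite E.
have [g' gK g'K] := injF_bij ginj.
exists (perm ginj); apply/andP; split.
  by apply/rate_autP => x y; rewrite !permE (H x (g x) y (g y)).
have small x y : y != g x -> #|cell s r x y|%:R <= al * N%:R.
  move=> ne; rewrite leNgt; apply: contra ne => /ltW c1.
  by apply/eqP; rewrite (uniq x y (g' y)) // ?g'K // -{2}(g'K y).
apply: le_trans (_ : \sum_(xy : leaf t * leaf t) (al * N%:R) <= _); last first.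
  by rewrite sumr_const card_prod -[X in X <= _]mulr_natl natrM expr2 !mulrA.
have -> : #|[set j | r j != (perm ginj) (s j)]%SET| =
   (\sum_(xy : leaf t * leaf t) #|[set j in cell s r xy.1 xy.2 | xy.2 != g xy.1]%SET|)%N.
  rewrite -sum1_card (partition_big (fun j => (s j, r j)) predT) //=; apply: eq_bigr => -[x y] _.
  rewrite -sum1_card; apply: eq_bigl => j; rewrite !inE /= permE xpair_eqE.
  by rewrite andbC; case: (s j =P x) => //= ->; case: (r j =P y) => //= ->.
rewrite natr_sum; apply: ler_sum => -[x y] _ /=.
case: (eqVneq y (g x)) => [->|ne].
  rewrite (_ : [set j in _ | _]%SET = finset.set0) ?cards0 ?mulr_ge0 //.
  by apply/setP => j; rewrite !inE andbF.
apply: le_trans (small x y ne); rewrite ler_nat; apply: subset_leq_card.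
by apply/fintype.subsetP => j; rewrite !inE => /andP[].
Qed.

(* Otherwise the two assignments disagree on the rates of quadratically many
   pairs avoiding any given vertex. *)
Lemma confusion_gap s r (al h0 : R) (f : 'I_N -> 'I_N -> R) (i : 'I_N) :
  (forall j k, f j k = f k j) -> (forall j k, 0 <= f j k) -> 0 <= h0 ->
  (forall j k, rate a (s j) (s k) != rate a (r j) (r k) -> h0 <= f j k) ->
  4 <= al * N%:R ->
  (forall x, K%:R * al * N%:R <= #|[set j | s j == x]%SET|%:R) ->
  ~~ [exists h, rate_aut a h && close (K%:R ^+ 2 * al) r s h] ->
  h0 * al ^+ 2 / 8 * N%:R ^+ 2 <=
  \sum_(e : 'I_N * 'I_N | [&& (e.1 < e.2)%N, e.1 != i & e.2 != i]) f e.1 e.2.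
Proof.
move=> fC f0 h00 fh al4 size nclose.
have al0 : 0 <= al.
  by rewrite leNgt; apply/negP => al0; move: al4; rewrite leNgt (le_lt_trans _ (ltr0n _ 4)) // nmulr_rle0.
have [[x x'] [[y y'] /= [c1 c2 ne]]] : exists xx yy : leaf t * leaf t,
   [/\ al * N%:R <= #|cell s r xx.1 yy.1|%:R, al * N%:R <= #|cell s r xx.2 yy.2|%:R &
      rate a xx.1 xx.2 != rate a yy.1 yy.2].
  apply: contrapT => no; move/negP: nclose; apply; apply/existsP.
  apply: confusion_close => // x y x' y' c1 c2; apply/eqP; apply: contraT => ne.
  by case: no; exists (x, x'), (y, y').
pose D := \sum_(e : 'I_N * 'I_N | [&& e.1 != e.2, e.1 != i & e.2 != i]) f e.1 e.2.
have DE : D = 2 * \sum_(e : 'I_N * 'I_N | [&& (e.1 < e.2)%N, e.1 != i & e.2 != i]) f e.1 e.2.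
  rewrite mulr2n mulrDl mul1r /D (bigID (fun e : 'I_N * 'I_N => (e.1 < e.2)%N)) /=; congr (_ + _).
    by apply: eq_bigl => -[j k] /=; rewrite -(inj_eq val_inj) /=; case: ltngtP; rewrite ?andbT ?andbF.
  rewrite (reindex_inj (h := fun e => (e.2, e.1))) /=; last by move=> [? ?] [? ?] [-> ->].
  apply: eq_big => [[j k] /=|[j k] _ /=]; last exact: fC.
  by rewrite -(inj_eq val_inj) /= andbC; case: ltngtP => //= _; rewrite andbC.
(* Avoiding [i] and the diagonal removes at most two elements from each set, at most half of it
   because [al * N >= 4]. The resulting [(al * N / 2) ^+ 2] ordered pairs, halved for unordered
   ones, give the factor 1/8. *)
have cnt (X Y : {set 'I_N}) : al * N%:R <= #|X|%:R -> al * N%:R <= #|Y|%:R ->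
    (forall j k, j \in X -> k \in Y -> h0 <= f j k) ->
    h0 * (al * N%:R / 2) ^+ 2 <= D.
  move=> Xb Yb XY;
  have -> : D = \sum_(j | j != i) \sum_(k | (j != k) && (k != i)) f j k.
    by rewrite pair_big_dep; apply: eq_bigl => -[j k] /=; rewrite andbCA.
  apply: le_trans (_ : \sum_(j in X | j != i) \sum_(k in Y | (k != j) && (k != i)) h0 <= _).
    have card1 (Z : {set 'I_N}) (v : 'I_N) : #|Z|%:R - 1 <= #|[set k in Z | k != v]%SET|%:R :> R.
      rewrite lerBlDr -[1]/(1%:R) -natrD ler_nat addn1 (cardsD1 v).
      by apply: leq_trans (leq_add (leq_b1 _) (leqnn _)) _; rewrite add1n ltnS; apply: subset_leq_card; apply/fintype.subsetP => k; rewrite !inE andbC.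
    have inner j : h0 * (#|Y|%:R - 2) <= \sum_(k in Y | (k != j) && (k != i)) h0.
      rewrite big_mkcondr -big_mkcondr /= (eq_bigl (fun k => k \in [set k in [set k in Y | k != j] | k != i]%SET)); last by move=> k; rewrite !inE andbA.
      rewrite sumr_const -[X in _ <= X]mulr_natr ler_wpM2l //.
      by have := card1 [set k in Y | k != j]%SET i; have := card1 Y j; lra.
    apply: le_trans (_ : \sum_(j in X | j != i) (h0 * (#|Y|%:R - 2)) <= _); last by apply: ler_sum.
    rewrite (eq_bigl (fun j => j \in [set j in X | j != i]%SET)); last by move=> k; rewrite !inE.
    rewrite sumr_const -[X in _ <= X]mulr_natr -[X in _ <= X]mulrA ler_wpM2l //.
    have xz := card1 X i.
    apply: le_trans (_ : (#|Y|%:R - 2) * (#|X|%:R - 1) <= _); last by rewrite ler_wpM2l //; lra.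
    by rewrite expr2; apply: ler_pM; lra.
  rewrite big_mkcond [X in _ <= X]big_mkcond; apply: ler_sum => j _ /=.
  case: (boolP (j != i)) => ji; rewrite ?andbF //; last first.
  rewrite andbT; case: (boolP (j \in X)) => jX; last by apply: sumr_ge0.
  rewrite big_mkcond [X in _ <= X]big_mkcond; apply: ler_sum => k _ /=.
  rewrite [k == j]eq_sym; case: (boolP ((j != k) && (k != i))) => jk; rewrite ?andbF // andbT.
  by case: ifP => kY; [apply: XY|apply: f0].
have : h0 * (al * N%:R / 2) ^+ 2 <= D.
  apply: (cnt _ _ c1 c2) => j k; rewrite !inE => /andP[/eqP sj /eqP rj] /andP[/eqP sk /eqP rk].
  by apply: fh; rewrite sj sk rj rk.
have -> : h0 * (al * N%:R / 2) ^+ 2 = 2 * (h0 * al ^+ 2 / 8 * N%:R ^+ 2) by field.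
by rewrite DE ler_pM2l.
Qed.

End Confusion.

(** * The estimator *)

Lemma tree_leaf (t : btree) : exists a : leaf t, true.
Proof. by have [a _] := leaf_below (valP (tree_root t)); exists a. Qed.

Definition leaf0 (t : btree) : leaf t := xchoose (tree_leaf t).

Section Estimator.
Variables (R : realType) (t : btree) (a : node t -> R) (d : R) (N : nat).
Implicit Types (r s : assignment t N) (g : graph N) (i : 'I_N).

Local Notation rate := (rate a).

(* Leave-one-out log-likelihood, for Poisson edges, up to a term that does not
   depend on r. *)
Definition loo_score i r g : R :=
  \sum_(e : 'I_N * 'I_N | [&& (e.1 < e.2)%N, e.1 != i & e.2 != i])
     ((adj g e.1 e.2)%:R * ln (rate (r e.1) (r e.2)) - d * rate (r e.1) (r e.2)).

Definition loo_labels i g : assignment t N :=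
  Order.arg_max [ffun=> leaf0 t] predT (fun r => loo_score i r g).

Definition star_score i r g (b : leaf t) : R :=
  \sum_(j | j != i) ((adj g i j)%:R * ln (rate b (r j)) - d * rate b (r j)).

Definition star_label i r g : leaf t :=
  Order.arg_max (leaf0 t) predT (star_score i r g).

(** Any aligned labelling is accepted; the default is reached only if the search finds none. *)
Definition final_labels (th : R) g : assignment t N :=
  odflt [ffun=> leaf0 t] [pick s | aligned a th (fun i => loo_labels i g)
     (fun i => star_label i (loo_labels i g) g) s].

Lemma loo_labels_max i r g : loo_score i r g <= loo_score i (loo_labels i g) g.
Proof. by rewrite /loo_labels; case: arg_maxP => // r' _ /(_ r isT). Qed.

Lemma star_label_max i r g b : star_score i r g b <= star_score i r g (star_label i r g).
Proof. by rewrite /star_label; case: arg_maxP => // r' _ /(_ b isT). Qed.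

(** Common form of both stages: the scores for rates [x] and [y] are compared while the edges have
    rates [z]. In the second stage the neighbours' labels are partly wrong, so [z] need not coincide
    with [x]. *)
Lemma chernoff_score (w : 'I_N * 'I_N -> bool -> R) (J : finType) (P : pred J)
    (idx : J -> 'I_N * 'I_N) (x y z u : J -> R) (s : R) :
  (forall e (c : bool), 0 <= w e c) -> (forall e, \sum_b w e b = 1) ->
  {in P &, injective idx} -> s < 1 ->
  (forall j f, P j -> \sum_b w (idx j) b * f b = z j * d * f true + (1 - z j * d) * f false) ->
  (forall j, P j -> 0 <= z j * d <= 1) ->
  (forall j, P j -> d * (z j * expR ((1 - s) * (ln (y j) - ln (x j))) - z j - (1 - s) * (y j - x j)) <= u j) ->
  prob w (fun X => \sum_(j | P j) ((X (idx j))%:R * ln (x j) - d * x j) <=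
                   \sum_(j | P j) ((X (idx j))%:R * ln (y j) - d * y j))
  <= expR (\sum_(j | P j) u j).
Proof.
move=> w0 w1 idxI s1 wz z01 uP.
pose f j (b : bool) := (1 - s) * (b%:R * (ln (y j) - ln (x j)) - d * (y j - x j)).
apply: le_trans (chernoff_sum (w := w) (f := f) w0 w1 idxI _); last first.
  move=> j Pj; rewrite (wz j (fun b => expR (f j b))) //.
  have := poisson_score_mgf s (x j) (y j) (z01 j Pj).
  by rewrite /f mul1r mul0r sub0r -mulNr => H; apply: le_trans H _; rewrite ler_expR uP.
apply: le_prob => // X; rewrite -subr_ge0 -sumrB -(pmulr_rge0 _ (_ : 0 < 1 - s)) ?subr_gt0 // big_distrr /=.
by rewrite (eq_bigr (fun j => f j (X (idx j)))) // => j _; rewrite /f; ring.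
Qed.

End Estimator.

Section Achievability.
Variables (R : realType) (t : btree) (pi : leaf t -> R) (a : node t -> R) (d : R) (N q : nat).
Hypothesis pi_gt0 : forall c, 0 < pi c.
Hypothesis a_gt0 : forall u, 0 < a u.
Hypothesis a_child : forall u v, child u v -> a u < a v.
Hypothesis d_gt0 : 0 < d.
Hypothesis p01 : forall u, 0 <= a u * d <= 1.
Implicit Types (r s : assignment t N) (g : graph N) (i : 'I_N).

Local Notation rate := (rate a).
Local Notation p := (fun u => a u * d).
Let K := #|{: leaf t}|.

Let rate_gt0 x y : 0 < rate x y. Proof. exact: a_gt0. Qed.

Let wt s := graph_weight p s.

Let wt_ge0 s e b : 0 <= wt s e b.
Proof. by apply: graph_weight_ge0 => _; exact: p01. Qed.

Let wt_sum1 s e : \sum_b wt s e b = 1.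
Proof. exact: graph_weight_sum1. Qed.

Lemma adj_mkgraph_lt x (e : 'I_N * 'I_N) : (e.1 < e.2)%N -> adj (mkgraph x) e.1 e.2 = x e.
Proof.
by case: e => j k /= jk; rewrite adj_mkgraph edge_lt // -(inj_eq val_inj) /= ltn_eqF.
Qed.

(** The parameter 1/2 suffices: a mistaken labelling disagrees on quadratically many pairs, so the
    exact exponent does not matter here. *)
Lemma loo_score_bound s r i :
  prob (wt s) (fun x => loo_score a d i s (mkgraph x) <= loo_score a d i r (mkgraph x)) <=
  expR (- d * \sum_(e : 'I_N * 'I_N | [&& (e.1 < e.2)%N, e.1 != i & e.2 != i])
     poisson_div 2^-1 (rate (s e.1) (s e.2)) (rate (r e.1) (r e.2))).
Proof.
rewrite big_distrr /=.
pose P (e : 'I_N * 'I_N) := [&& (e.1 < e.2)%N, e.1 != i & e.2 != i].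
have wz (e : 'I_N * 'I_N) f : P e -> \sum_b wt s e b * f b =
    rate (s e.1) (s e.2) * d * f true + (1 - rate (s e.1) (s e.2) * d) * f false.
  case: e => j k /andP[/= jk _].
  by have := sum_bernoulli_weight_edge j k f (edge_probC p s); rewrite edge_lt.
have half1 : (2^-1 : R) < 1 by lra.
have idI : {in P &, injective id} by [].
have uP (e : 'I_N * 'I_N) : P e -> d * (rate (s e.1) (s e.2) * expR ((1 - 2^-1) *
      (ln (rate (r e.1) (r e.2)) - ln (rate (s e.1) (s e.2)))) - rate (s e.1) (s e.2)
      - (1 - 2^-1) * (rate (r e.1) (r e.2) - rate (s e.1) (s e.2))) <=
    - d * poisson_div 2^-1 (rate (s e.1) (s e.2)) (rate (r e.1) (r e.2)).
  move=> _; rewrite geo_meanE // /poisson_div le_eqVlt; apply/orP; left; apply/eqP.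
  by ring.
apply: le_trans (chernoff_score (wt_ge0 s) (wt_sum1 s) idI half1 wz (fun e _ => p01 _) uP).
apply: le_prob => // x; rewrite /loo_score.
rewrite (eq_bigr (fun e : 'I_N * 'I_N => (x e)%:R * ln (rate (s e.1) (s e.2)) - d * rate (s e.1) (s e.2))).
  rewrite [X in _ <= X -> _](eq_bigr (fun e : 'I_N * 'I_N => (x e)%:R * ln (rate (r e.1) (r e.2)) - d * rate (r e.1) (r e.2))) //.
  by move=> e /andP[e12 _]; rewrite adj_mkgraph_lt.
by move=> e /andP[e12 _]; rewrite adj_mkgraph_lt.
Qed.

Definition mistaken (th : R) s r := ~~ [exists h, rate_aut a h && close th r s h].

(** A mistaken maximiser beats the truth. The union bound over all [K ^ N] labellings is affordable
    because each exponent is of order [d * N ^ 2]. *)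
Lemma loo_labels_bound s i (al h0 : R) :
  0 <= h0 -> 4 <= al * N%:R ->
  (forall x y x' y', rate x y != rate x' y' -> h0 <= poisson_div 2^-1 (rate x y) (rate x' y')) ->
  (forall x, K%:R * al * N%:R <= #|[set j | s j == x]%SET|%:R) ->
  prob (wt s) (fun x => mistaken (K%:R ^+ 2 * al) s (loo_labels a d i (mkgraph x))) <=
  K%:R ^+ N * expR (- d * (h0 * al ^+ 2 / 8 * N%:R ^+ 2)).
Proof.
move=> h00 al4 hP size.
pose E r (x : {ffun 'I_N * 'I_N -> bool}) := mistaken (K%:R ^+ 2 * al) s r &&
    (loo_score a d i s (mkgraph x) <= loo_score a d i r (mkgraph x)).
apply: le_trans (_ : prob (wt s) (fun x => [exists r, E r x]) <= _).
  apply: le_prob => // x mis; apply/existsP; exists (loo_labels a d i (mkgraph x)).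
  by rewrite /E mis loo_labels_max.
apply: le_trans (prob_exists (wt_ge0 s) E) _.
have -> : K%:R ^+ N = (#|{: assignment t N}|)%:R :> R by rewrite card_ffun card_ord natrX.
rewrite mulr_natl -sumr_const; apply: ler_sum => r _.
case: (boolP (mistaken (K%:R ^+ 2 * al) s r)) => mis; last first.
  rewrite (eq_prob _ (B := pred0)); last by move=> x; rewrite /E (negbTE mis).
  by rewrite /prob (expect_cst (wt_sum1 s)) expR_ge0.
apply: le_trans (_ : prob (wt s) (fun x => loo_score a d i s (mkgraph x) <= loo_score a d i r (mkgraph x)) <= _).
  by apply: le_prob => // x /andP[].
apply: le_trans (loo_score_bound s r i) _; rewrite ler_expR !mulNr lerN2 ler_pM2l //.
pose f (j k : 'I_N) := poisson_div 2^-1 (rate (s j) (s k)) (rate (r j) (r k)).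
have fC j k : f j k = f k j by rewrite /f (rateC _ (s j)) (rateC _ (r j)).
have f0 j k : 0 <= f j k by apply: poisson_div_ge0 => //; apply/andP; lra.
have hf j k : rate (s j) (s k) != rate (r j) (r k) -> h0 <= f j k by exact: hP.
exact: (confusion_gap a_child i fC f0 h00 hf al4 size mis).
Qed.

Section Star.
Variables (th eta eps Jq M Ml : R).
Hypothesis rate_leM : forall x y, rate x y <= M.
Hypothesis ln_rate_le : forall x y, `|ln (rate x y)| <= Ml.
Hypothesis Jq_le : forall x y, ~~ same_super q x y -> Jq <= poisson_CH pi rate x y.
Hypothesis eps_gt0 : 0 < eps.
Hypothesis eta_ge0 : 0 <= eta.

(** Bounds the damage of one wrongly labelled neighbour: [M * expR (2 * Ml)] for its exponential
    term, [M] for its linear term, and [2 * M] for the divergence that it fails to contribute. It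
    also covers the absent term of [i] itself. *)
Definition star_const : R := M * expR (2 * Ml) + 3 * M.

(** Pulling [b] back by the automorphism turns each correctly labelled neighbour into a term of the
    divergence between [s i] and [b'], with parameter near-optimal for that pair. The losses are
    [eps] for the parameter, the [eta] term for community sizes, and [star_const] for wrong labels
    and for vertex [i]. *)
Lemma star_score_bound s r i h b :
  (forall c, (pi c - eta) * N%:R <= #|[set j | s j == c]%SET|%:R) ->
  rate_aut a h -> close th r s h -> ~~ same_super q b (h (s i)) ->
  prob (wt s) (fun x => star_score a d i r (mkgraph x) (h (s i)) <= star_score a d i r (mkgraph x) b) <=
  expR (- d * (N%:R * (Jq - eps - 2 * M * K%:R * eta - star_const * th) - star_const)).
Proof.
move=> size hA cl ns.
have Mgt0 : 0 < M by apply: lt_le_trans (rate_leM b b).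
pose b' := (h^-1)%g b.
have hb' : h b' = b by rewrite permKV.
have ns' : ~~ same_super q (s i) b'.
  by rewrite -(rate_aut_same_super a_child q _ _ hA) hb' /same_super eq_sym.
have [sp sp01 spJ] := poisson_CH_approx pi_gt0 rate_gt0 (s i) b' eps_gt0.
have /andP[sp0 sp1] := sp01.
have sp01' : 0 <= sp <= 1 by rewrite (ltW sp0) (ltW sp1).
pose D c := poisson_div sp (rate (s i) c) (rate b' c).
have D0 c : 0 <= D c by apply: poisson_div_ge0.
have D2 c : D c <= 2 * M.
  apply: le_trans (poisson_div_le _ _ _) _ => //.
  by have := rate_leM (s i) c; have := rate_leM b' c; lra.
pose u j := - d * D (s j) + d * star_const * (r j != h (s j))%:R.
have C0 : 0 <= star_const by rewrite addr_ge0 ?mulr_ge0 ?expR_ge0 ?(ltW Mgt0).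
have rab x y : rate (h x) (h y) = rate x y by have /rate_autP := hA.
have starI : {in [pred j | j != i] &, injective (edge i)} by move=> j k _ _ /edge_inj.
have wz (j : 'I_N) f : j != i -> \sum_c wt s (edge i j) c * f c =
    rate (s i) (s j) * d * f true + (1 - rate (s i) (s j) * d) * f false.
  by move=> _; exact: sum_bernoulli_weight_edge i j f (edge_probC p s).
have uP (j : 'I_N) : j != i -> d * (rate (s i) (s j) * expR ((1 - sp) *
      (ln (rate b (r j)) - ln (rate (h (s i)) (r j)))) - rate (s i) (s j)
      - (1 - sp) * (rate b (r j) - rate (h (s i)) (r j))) <= u j.
  move=> _; rewrite /u mulNr -mulrA -mulrN -mulrDr ler_pM2l //.
  case: (eqVneq (r j) (h (s j))) => [->|ne] /=.
    rewrite mulr0 addr0 rab geo_meanE // -[in rate b _]hb' rab /D /poisson_div.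
    by rewrite le_eqVlt; apply/orP; left; apply/eqP; ring.
  rewrite mulr1.
  have z0 := rate_gt0 (s i) (s j); have zM := rate_leM (s i) (s j).
  have x0 := rate_gt0 (h (s i)) (r j); have xM := rate_leM (h (s i)) (r j).
  have y0 := rate_gt0 b (r j).
  set z := rate (s i) (s j) in z0 zM *; set x := rate (h (s i)) (r j) in x0 xM *; set y := rate b (r j) in y0 *.
  have e1 : z * expR ((1 - sp) * (ln y - ln x)) <= M * expR (2 * Ml).
    apply: ler_pM => //; rewrite ?expR_ge0 ?(ltW z0) // ler_expR.
    have /ler_normlP[_ ly] := ln_rate_le b (r j); have /ler_normlP[lx _] := ln_rate_le (h (s i)) (r j).
    rewrite -/x -/y in lx ly.
    have Ml0 : 0 <= Ml by apply: le_trans (ln_rate_le b b).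
    apply: le_trans (_ : (1 - sp) * (2 * Ml) <= _); first by rewrite ler_wpM2l //; lra.
    by rewrite ler_piMl //; lra.
  have e2 : - ((1 - sp) * (y - x)) <= M.
    have : (1 - sp) * x <= x by rewrite ler_piMl ?(ltW x0) //; lra.
    have : 0 <= (1 - sp) * y by rewrite mulr_ge0 ?(ltW y0) //; lra.
    lra.
  by have := D2 (s j); rewrite /star_const; lra.
apply: le_trans (le_trans _ (chernoff_score (wt_ge0 s) (wt_sum1 s) starI sp1 wz (fun j _ => p01 _) uP)) _.
  apply: le_prob => // x; rewrite /star_score.
  rewrite (eq_bigr (fun j => (x (edge i j))%:R * ln (rate (h (s i)) (r j)) - d * rate (h (s i)) (r j))).
    rewrite [X in _ <= X -> _](eq_bigr (fun j => (x (edge i j))%:R * ln (rate b (r j)) - d * rate b (r j))) //.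
    by move=> j ji; rewrite adj_mkgraph eq_sym ji.
  by move=> j ji; rewrite adj_mkgraph eq_sym ji.
rewrite ler_expR /u big_split /= -!big_distrr /= -mulrA !mulNr -mulrN -mulrDr -mulrN ler_pM2l //.
have cntb : \sum_(j | j != i) (r j != h (s j))%:R <= th * N%:R :> R.
  apply: le_trans cl; rewrite -sum1_card natr_sum big_mkcond [X in _ <= X]big_mkcond.
  by apply: ler_sum => j _; rewrite inE; case: (r j != _); case: (j != i).
have sumD : N%:R * (Jq - eps - 2 * M * K%:R * eta) <= \sum_j D (s j).
  rewrite (partition_big s predT) //=.
  apply: le_trans (_ : \sum_c (pi c - eta) * N%:R * D c <= _); last first.
    apply: ler_sum => c _; apply: le_trans (_ : #|[set j | s j == c]%SET|%:R * D c <= _).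
      by rewrite ler_wpM2r.
    rewrite mulr_natl -sumr_const big_mkcond [X in _ <= X]big_mkcond; apply: ler_sum => j _.
    by rewrite inE; case: eqP => // ->.
  have -> : \sum_c (pi c - eta) * N%:R * D c = N%:R * (poisson_CH_at pi rate sp (s i) b' - eta * \sum_c D c).
    rewrite /poisson_CH_at mulrBr [eta * _]big_distrr !big_distrr /= -sumrB; apply: eq_bigr => c _.
    by rewrite -/(D c); ring.
  rewrite ler_wpM2l //.
  have sD : eta * \sum_c D c <= 2 * M * K%:R * eta.
    rewrite mulrC ler_wpM2r //; apply: le_trans (ler_sum _ (fun c _ => D2 c)) _.
    by rewrite sumr_const -/K mulr_natr.
  by have := Jq_le ns'; lra.
have Di : \sum_j D (s j) = D (s i) + \sum_(j | j != i) D (s j) by rewrite (bigD1 i).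
have D2i := D2 (s i).
have : star_const * \sum_(j | j != i) (r j != h (s j))%:R <= star_const * (th * N%:R) by rewrite ler_wpM2l.
have CM : 2 * M <= star_const.
  have : 0 <= M * expR (2 * Ml) by rewrite mulr_ge0 ?expR_ge0 ?(ltW Mgt0).
  by rewrite /star_const; lra.
lra.
Qed.

End Star.
End Achievability.

Section FailureBound.
Variables (R : realType) (t : btree) (pi : leaf t -> R) (a : node t -> R) (d : R) (N q : nat).
Hypothesis pi_gt0 : forall c, 0 < pi c.
Hypothesis a_gt0 : forall u, 0 < a u.
Hypothesis a_child : forall u v, child u v -> a u < a v.
Hypothesis d_gt0 : 0 < d.
Hypothesis p01 : forall u, 0 <= a u * d <= 1.
Implicit Types (r s : assignment t N) (g : graph N) (i : 'I_N).

Local Notation rate := (rate a).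
Local Notation p := (fun u => a u * d).
Local Notation wt s := (graph_weight p s).
Let K := #|{: leaf t}|.

Let wt_ge0 s e c : 0 <= wt s e c.
Proof. by apply: graph_weight_ge0 => _; exact: p01. Qed.

Let wt_sum1 s e : \sum_c wt s e c = 1.
Proof. exact: graph_weight_sum1. Qed.

Variables (al h0 eta eps Jq M Ml : R).
Hypothesis rate_leM : forall x y, rate x y <= M.
Hypothesis ln_rate_le : forall x y, `|ln (rate x y)| <= Ml.
Hypothesis Jq_le : forall x y, ~~ same_super q x y -> Jq <= poisson_CH pi rate x y.
Hypothesis h0_le : forall x y x' y', rate x y != rate x' y' ->
  h0 <= poisson_div 2^-1 (rate x y) (rate x' y').
Hypothesis eps_gt0 : 0 < eps.
Hypothesis h0_ge0 : 0 <= h0.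
Hypothesis eta_ge0 : 0 <= eta.
Hypothesis al_N : 4 <= al * N%:R.

Let th := K%:R ^+ 2 * al.

Definition star_bound : R :=
  expR (- d * (N%:R * (Jq - eps - 2 * M * K%:R * eta - star_const M Ml * th) - star_const M Ml)).

Definition star_error s i (x : {ffun 'I_N * 'I_N -> bool}) : bool :=
  let r := loo_labels a d i (mkgraph x) in
  [exists h, [&& rate_aut a h, close th r s h &
     ~~ same_super q (star_label a d i r (mkgraph x)) (h (s i))]].

Lemma loo_labels_local i (x y : {ffun 'I_N * 'I_N -> bool}) :
  (forall e, (e.1 != i) && (e.2 != i) -> x e = y e) ->
  loo_labels a d i (mkgraph x) = loo_labels a d i (mkgraph y) :> assignment t N.
Proof.
move=> xy; rewrite /loo_labels; congr Order.arg_max; apply/funext => r.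
apply: eq_bigr => -[j k] /= /and3P[jk ji ki].
by rewrite (@adj_mkgraph_lt _ x (j, k) jk) (@adj_mkgraph_lt _ y (j, k) jk) xy //= ji.
Qed.

Lemma star_score_local i r b (x y : {ffun 'I_N * 'I_N -> bool}) :
  (forall e, ~~ ((e.1 != i) && (e.2 != i)) -> x e = y e) ->
  star_score a d i r (mkgraph x) b = star_score a d i r (mkgraph y) b.
Proof.
move=> xy; apply: eq_bigr => j ji; rewrite !adj_mkgraph xy // /edge.
by case: ifP => _ /=; rewrite eqxx ?andbF.
Qed.

(** The labelling depends on the edges avoiding [i], the scores on the edges at [i]. By independence
    the bound for a fixed labelling can be averaged over its law, so that no factor [K ^ N] appears;
    the union is only over [h] and [b]. *)
Lemma star_error_bound s i :
  (forall c, (pi c - eta) * N%:R <= #|[set j | s j == c]%SET|%:R) ->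
  prob (wt s) (star_error s i) <= #|{: {perm leaf t} * leaf t}|%:R * star_bound.
Proof.
move=> size.
pose F r (x : {ffun 'I_N * 'I_N -> bool}) := [exists hb : {perm leaf t} * leaf t,
  [&& rate_aut a hb.1, close th r s hb.1, ~~ same_super q hb.2 (hb.1 (s i)) &
    star_score a d i r (mkgraph x) (hb.1 (s i)) <= star_score a d i r (mkgraph x) hb.2]].
pose L r (x : {ffun 'I_N * 'I_N -> bool}) := loo_labels a d i (mkgraph x) == r.
have FB r : prob (wt s) (F r) <= #|{: {perm leaf t} * leaf t}|%:R * star_bound.
  apply: le_trans (prob_exists (wt_ge0 s) _) _.
  rewrite mulr_natl -sumr_const; apply: ler_sum => -[h b] _ /=.
  case: (boolP [&& rate_aut a h, close th r s h & ~~ same_super q b (h (s i))]) => [/and3P[hA cl ns]|no].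
    apply: le_trans (_ : prob (wt s) (fun x => star_score a d i r (mkgraph x) (h (s i)) <=
        star_score a d i r (mkgraph x) b) <= _).
      by apply: le_prob => // x /and4P[].
    by apply: (star_score_bound (pi := pi) (q := q)).
  rewrite (eq_prob _ (B := pred0)) => [|x /=].
    by rewrite /prob (expect_cst (wt_sum1 s)) expR_ge0.
  by apply: contraNF no => /and4P[-> -> -> _].
apply: le_trans (_ : \sum_r prob (wt s) (fun x => L r x && F r x) <= _).
  apply: le_trans (prob_exists (wt_ge0 s) _); apply: le_prob => // x.
  move=> /existsP[h /and3P[hA cl ns]]; apply/existsP; exists (loo_labels a d i (mkgraph x)).
  rewrite /L eqxx /=; apply/existsP; exists (h, star_label a d i (loo_labels a d i (mkgraph x)) (mkgraph x)).
  by rewrite /= hA cl ns star_label_max.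
have indep r : prob (wt s) (fun x => L r x && F r x) = prob (wt s) (L r) * prob (wt s) (F r).
  rewrite /prob -(expect_indep (wt_sum1 s) (S := fun e : 'I_N * 'I_N => (e.1 != i) && (e.2 != i))).
  - by apply: eq_expect => x; rewrite -natrM mulnb.
  - by move=> x y xy; rewrite /L (loo_labels_local xy).
  - move=> x y xy; congr (_%:R); apply: congr1; apply: eq_existsb => -[h b] /=.
    by rewrite !(star_score_local _ _ xy).
apply: le_trans (_ : \sum_r prob (wt s) (L r) * (#|{: {perm leaf t} * leaf t}|%:R * star_bound) <= _).
  by apply: ler_sum => r _; rewrite indep ler_wpM2l ?prob_ge0.
rewrite -big_distrl /= -[X in _ <= X]mul1r ler_wpM2r ?mulr_ge0 ?expR_ge0 //.
rewrite /prob -expect_sum -[X in _ <= X](expect_cst (wt_sum1 s)); apply: ler_expect => // x.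
rewrite (bigD1 (loo_labels a d i (mkgraph x))) //= /L eqxx big1 ?addr0 // => r ne.
by rewrite eq_sym (negbTE ne).
Qed.

(** If no vertex has a mistaken labelling or a star error, an aligned labelling exists and every
    aligned one is right. The two conditions on [al] feed [confusion_gap] and [aligned_sound]
    respectively. *)
Lemma failure_bound s :
  (forall c, (pi c - eta) * N%:R <= #|[set j | s j == c]%SET|%:R) ->
  (forall c, K%:R * al <= pi c - eta) ->
  (forall c, 4 * th < pi c - eta) ->
  prob (wt s) (fun x => loss s (super_community (q := q) (final_labels a d th (mkgraph x))) != 0%N) <=
  N%:R * (K%:R ^+ N * expR (- d * (h0 * al ^+ 2 / 8 * N%:R ^+ 2)) +
          #|{: {perm leaf t} * leaf t}|%:R * star_bound).
Proof.
move=> size size1 size2.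
have N0 : 0 < N%:R :> R.
  rewrite ltr0n lt0n; apply: contraTneq al_N => ->.
  by rewrite mulr0 -ltNge.
have size1' c : K%:R * al * N%:R <= #|[set j | s j == c]%SET|%:R.
  by apply: le_trans (size c); rewrite ler_pM2r.
have size2' c : 4 * th * N%:R < #|[set j | s j == c]%SET|%:R.
  by apply: lt_le_trans (size c); rewrite ltr_pM2r.
pose E i x := mistaken a th s (loo_labels a d i (mkgraph x)) || star_error s i x.
apply: le_trans (_ : prob (wt s) (fun x => [exists i, E i x]) <= _).
  apply: le_prob => // x; apply: contraR; rewrite negb_exists => /forallP H.
  have good i : exists h, [&& rate_aut a h, close th (loo_labels a d i (mkgraph x)) s h &
      same_super q (star_label a d i (loo_labels a d i (mkgraph x)) (mkgraph x)) (h (s i))].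
    have := H i; rewrite /E negb_or negbK => /andP[/existsP[h /andP[hA cl]] /existsPn /(_ h)].
    by rewrite hA cl negbK => ss; exists h; rewrite hA cl ss.
  have close' i : exists h, rate_aut a h && close th (loo_labels a d i (mkgraph x)) s h.
    by have [h /and3P[hA cl _]] := good i; exists h; rewrite hA cl.
  have [s0 s0P] := aligned_exists (fun i => star_label a d i (loo_labels a d i (mkgraph x)) (mkgraph x)) close'.
  rewrite /final_labels; case: pickP => [s1 /= s1P|/(_ s0)]; last by rewrite s0P.
  have [h hA hs] := aligned_sound a_child size2' good s1P.
  apply/eqP; apply: loss_super_community hs => y z.
  exact: (rate_aut_same_super a_child).
apply: le_trans (prob_exists (wt_ge0 s) _) _.
rewrite mulr_natl -[in X in _ *+ X](card_ord N) -sumr_const; apply: ler_sum => i _.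
apply: le_trans (probU (wt_ge0 s) _ _) _; apply: lerD; last exact: star_error_bound.
exact: loo_labels_bound.
Qed.

End FailureBound.

Local Open Scope classical_set_scope.
Local Open Scope ring_scope.

(** * Typical assignments and asymptotic estimates for recovery *)

Section Finite.
Variables (R : realType) (T : finType).

Lemma fin_pos_lb (P : pred T) (f : T -> R) : (forall x, P x -> 0 < f x) ->
  exists2 m, 0 < m & forall x, P x -> m <= f x.
Proof.
move=> f0; exists (\big[Order.min/1]_(x | P x) f x).
  by apply/bigmin_gtP; split.
by move=> x Px; exact: bigmin_le_cond.
Qed.

Lemma fin_ub (f : T -> R) : exists2 m, 0 < m & forall x, f x <= m.
Proof.
exists (\big[Order.max/1]_x f x); last by move=> x; exact: le_bigmax.
by apply: lt_le_trans (ltr01) (bigmax_ge_id _ _ _ _).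
Qed.

End Finite.

Section Typical.
Variables (R : realType) (L : finType) (pi : L -> R) (N : nat).
Hypothesis pi_ge0 : forall c, 0 <= pi c.
Hypothesis pi_sum1 : \sum_c pi c = 1.

Definition typical (eta : R) (s : {ffun 'I_N -> L}) : bool :=
  [forall c, `|#|[set j | s j == c]%SET|%:R - pi c * N%:R| < eta * N%:R].

Lemma typical_prob eta : 0 < eta -> (0 < N)%N ->
  prob (fun=> pi) (predC (typical eta)) <= #|L|%:R / (eta ^+ 2 * N%:R).
Proof.
move=> eta0 N0; have N0' : 0 < N%:R :> R by rewrite ltr0n.
apply: le_trans (_ : prob (fun=> pi) (fun s : {ffun 'I_N -> L} => [exists c, eta * N%:R <= `|#|[set j | s j == c]%SET|%:R - pi c * N%:R|]) <= _).
  by apply: le_prob => // s; rewrite /= negb_forall => /existsP[c]; rewrite -leNgt => H; apply/existsP; exists c.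
apply: le_trans (prob_exists (fun=> pi_ge0) _) _.
rewrite mulr_natl -sumr_const; apply: ler_sum => c _.
have sum1 : \sum_(j < N) \sum_c' pi c' * (c' == c)%:R = pi c * N%:R.
  rewrite (eq_bigr (fun=> pi c)); first by rewrite sumr_const card_ord mulr_natr.
  by move=> j _; rewrite (bigD1 c) //= eqxx mulr1 big1 ?addr0 // => c' /negbTE ->; rewrite mulr0.
have pi1 : pi c <= 1 by rewrite -pi_sum1 (bigD1 c) //= lerDl sumr_ge0.
have idI : {in predT &, injective (@id 'I_N)} by [].
have sq : \sum_(j < N) \sum_c' pi c' * (c' == c)%:R ^+ 2 <= N%:R.
  rewrite (eq_bigr (fun=> \sum_c' pi c' * (c' == c)%:R)); first by rewrite sum1 ler_piMl.
  by move=> j _; apply: eq_bigr => c' _; case: (c' == c); rewrite ?expr1n ?expr0n.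
have c0 : 0 < eta * N%:R by rewrite mulr_gt0.
have := chebyshev_sum (w := fun=> pi) (P := predT) (f := fun _ c' => (c' == c)%:R) (fun=> pi_ge0) (fun=> pi_sum1) idI c0 sq.
rewrite sum1; have -> : N%:R / (eta * N%:R) ^+ 2 = (eta ^+ 2 * N%:R)^-1.
  by rewrite exprMn; field; rewrite !gt_eqF.
apply: le_trans; apply: le_prob => // s.
rewrite (_ : \sum_(j < N) (s j == c)%:R = #|[set j | s j == c]%SET|%:R) //.
by rewrite -natr_sum; congr _%:R; rewrite -sum1_card [RHS]big_mkcond /=; apply: eq_bigr => j _; rewrite inE; case: eqP.
Qed.

End Typical.

Section NearInfinity.
Variable R : realType.

Lemma near_le_nat (C : R) : \forall N \near \oo, C <= N%:R.
Proof. exact: nbhs_infty_ger. Qed.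

Lemma near_le_ln (C : R) : \forall N \near \oo, C <= ln N%:R :> R.
Proof.
near=> N; have eN : expR C <= N%:R by near: N; exact: near_le_nat.
by rewrite -[C]expRK ler_ln ?posrE ?expR_gt0 // (lt_le_trans (expR_gt0 C)).
Unshelve. all: by end_near. Qed.

Lemma near_typical (L : finType) (pi : L -> R) eta e :
  (forall c, 0 <= pi c) -> \sum_c pi c = 1 -> 0 < eta -> 0 < e ->
  \forall N \near \oo, prob (fun=> pi) (predC (@typical R L pi N eta)) <= e.
Proof.
move=> pi0 pi1 eta0 e0; near=> N.
have NC : #|L|%:R / (eta ^+ 2 * e) + 1 <= N%:R by near: N; exact: near_le_nat.
have d0 : 0 < eta ^+ 2 * e by rewrite mulr_gt0 ?exprn_gt0.
have N0 : 0 < N%:R :> R.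
  by apply: lt_le_trans NC; rewrite ltr_wpDl // divr_ge0 // ltW.
have N0' : (0 < N)%N by move: N0; rewrite ltr0n.
apply: le_trans (typical_prob pi0 pi1 eta0 N0') _.
rewrite ler_pdivrMr ?mulr_gt0 ?exprn_gt0 //.
have : #|L|%:R / (eta ^+ 2 * e) <= N%:R by lra.
by rewrite ler_pdivrMr //; lra.
Unshelve. all: by end_near. Qed.

End NearInfinity.

Section Decay.
Variable R : realType.
Implicit Types (n d e J cc k rho C B Q Y : R).

(** The hypothesis on [n * d * J] forces [n * d * cc >= ln k + 2] for large [n], so the exponent is
    at most [-2 * n]; one [n] absorbs the factor [n], the other reaches [e]. *)
Lemma union_bound_decay n d e J (e1 : R) cc k : 0 < n -> 0 < e -> 0 < J -> 0 < e1 -> 0 < cc ->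
  (1 + e1) * ln n <= n * d * J -> (ln k + 2) * J / (cc * (1 + e1)) <= ln n -> - ln e <= n ->
  n * expR (n * ln k + - d * (cc * n ^+ 2)) <= e.
Proof.
move=> n0 e0 J0 e10 cc0 dJ kn en.
have e1' : 0 < 1 + e1 by lra.
have H1 : ln k + 2 <= n * d * cc.
  move: kn; rewrite ler_pdivrMr ?mulr_gt0 // => kn.
  rewrite -(ler_pM2r J0); apply: le_trans kn _.
  by have := ler_wpM2l (ltW cc0) dJ; lra.
have H4 := ln_le_sub1 n0.
have H5 : (ln k + 2) * n <= n * d * cc * n by rewrite ler_pM2r.
rewrite -[X in X * expR _](lnK n0) -expRD -[X in _ <= X](lnK e0) ler_expR.
have -> : - d * (cc * n ^+ 2) = - (n * d * cc * n) by ring.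
lra.
Qed.

(** Of the margin [e1], the losses collected in [rho] consume half. The remaining power
    [n ^ (- e1 / 2)] absorbs the constants. *)
Lemma star_decay n d e J (e1 : R) rho Y C B Q : 0 < n -> 0 < d -> 0 < e -> 0 < e1 -> 0 < Q ->
  (1 + e1) * (1 - rho) = 1 + e1 / 2 -> (1 + e1) * ln n <= n * d * J ->
  J * (1 - rho) <= Y -> d * C <= B -> (ln Q + B - ln e) / (e1 / 2) <= ln n ->
  n * (Q * expR (- d * (n * Y - C))) <= e.
Proof.
move=> n0 d0 e0 e10 Q0 r1 dJ JY dC Qn.
have r2 : 0 <= 1 - rho by rewrite -(pmulr_rge0 _ (_ : 0 < 1 + e1)) ?r1; lra.
have X2 := ler_wpM2l (ltW (mulr_gt0 n0 d0)) JY.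
have X3 : (1 + e1 / 2) * ln n <= n * d * (J * (1 - rho)).
  have := ler_wpM2r r2 dJ; rewrite mulrAC r1 => X4; apply: le_trans X4 _.
  by rewrite le_eqVlt; apply/orP; left; apply/eqP; ring.
move: Qn; rewrite ler_pdivrMr ?divr_gt0 // => Qn.
rewrite -[X in X * (_ * _)](lnK n0) -[X in _ * (X * _)](lnK Q0) -!expRD -[X in _ <= X](lnK e0) ler_expR.
lra.
Qed.

End Decay.

Section AchievabilityLimit.
Variables (R : realType) (t : btree) (pi : leaf t -> R) (a : node t -> R) (delta : nat -> R) (q : nat).
Hypothesis pi_gt0 : forall c, 0 < pi c.
Hypothesis pi_sum1 : \sum_c pi c = 1.
Hypothesis a_gt0 : forall u, 0 < a u.
Hypothesis a_child : forall u v, child u v -> a u < a v.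
Hypothesis delta_gt0 : forall N, (0 < N)%N -> 0 < delta N.
Hypothesis p01 : forall N, (0 < N)%N -> forall u, 0 <= a u * delta N <= 1.

Local Notation rate := (rate a).
Local Notation p N := (fun u => a u * delta N).

Lemma achievability (J e1 : R) : 0 < J -> 0 < e1 ->
  (forall x y, ~~ same_super q x y -> J <= poisson_CH pi rate x y) ->
  (\forall N \near \oo, (1 + e1) * ln N%:R <= N%:R * delta N * J) ->
  exists est : estimator t q, forall e, 0 < e -> \forall N \near \oo,
    joint_prob pi (p N) (fun s g => loss s (est N g) != 0%N) <= e.
Proof.
move=> J0 e10 Jle HJ.
have [pm pm0 pmP] := @fin_pos_lb R (leaf t) predT pi (fun c _ => pi_gt0 c).
have [M M0 MP] := @fin_ub R _ (fun xy : leaf t * leaf t => rate xy.1 xy.2).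
have [Ml Ml0 MlP] := @fin_ub R _ (fun xy : leaf t * leaf t => `|ln (rate xy.1 xy.2)|).
have rate_gt0 x y : 0 < rate x y by exact: a_gt0.
have [h0 h00 h0P] := @fin_pos_lb R _ (fun z : (leaf t * leaf t) * (leaf t * leaf t) =>
    rate z.1.1 z.1.2 != rate z.2.1 z.2.2)
  (fun z => poisson_div 2^-1 (rate z.1.1 z.1.2) (rate z.2.1 z.2.2))
  (fun z ne => poisson_div_half_gt0 (rate_gt0 _ _) (rate_gt0 _ _) ne).
set K := #|{: leaf t}|.
have K1 : 1 <= K%:R :> R by rewrite ler1n; apply/card_gt0P; exists (leaf0 t).
have K0 : 0 < K%:R :> R by lra.
set C := star_const M Ml.
have C0 : 0 < C by rewrite /C /star_const addr_gt0 ?mulr_gt0 ?expR_gt0.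
(* The fraction of [J] that may be lost, shared equally between [eps], the community sizes and the
   wrong labels: hence the three terms [J * rho / 3]. *)
pose rho := e1 / (2 * (1 + e1)).
have e1' : 0 < 2 * (1 + e1) by lra.
have rho0 : 0 < rho by rewrite divr_gt0.
have r1 : (1 + e1) * (1 - rho) = 1 + e1 / 2 by rewrite /rho; field; lra.
have Jr0 : 0 < J * rho by rewrite mulr_gt0.
(* The first bound leaves at least half of each community proportion; the second controls the effect
   of sizes on the exponent. *)
pose eta := Order.min (pm / 2) (J * rho / (6 * M * K%:R)).
have MK0 : 0 < 6 * M * K%:R by rewrite !mulr_gt0.
have eta0 : 0 < eta by rewrite lt_min !divr_gt0.
have eta1 : eta <= pm / 2 by rewrite ge_min lexx.
have eta2 : 2 * M * K%:R * eta <= J * rho / 3.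
  have : eta <= J * rho / (6 * M * K%:R) by rewrite ge_min lexx orbT.
  by rewrite ler_pdivlMr //; lra.
(* With the first bound, four times the error fraction is at most [pm / 4], below the remaining
   proportion [pm / 2]. *)
pose al := Order.min (pm / (16 * K%:R ^+ 2)) (J * rho / (3 * C * K%:R ^+ 2)).
have K20 : 0 < K%:R ^+ 2 :> R by rewrite exprn_gt0.
have q1 : 0 < 16 * K%:R ^+ 2 :> R by rewrite mulr_gt0.
have q2 : 0 < 3 * C * K%:R ^+ 2 by apply: mulr_gt0 => //; exact: mulr_gt0.
have al0 : 0 < al by rewrite lt_min !divr_gt0.
have al1 : K%:R ^+ 2 * al <= pm / 16.
  have : al <= pm / (16 * K%:R ^+ 2) by rewrite ge_min lexx.
  by rewrite ler_pdivlMr //; lra.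
have al2 : C * (K%:R ^+ 2 * al) <= J * rho / 3.
  have : al <= J * rho / (3 * C * K%:R ^+ 2) by rewrite ge_min lexx orbT.
  by rewrite ler_pdivlMr //; lra.
have al3 : K%:R * al <= pm / 16.
  apply: le_trans al1; rewrite ler_pM2r // expr2 ler_peMl //; lra.
have Y_ge : J * (1 - rho) <= J - J * rho / 3 - 2 * M * K%:R * eta - C * (K%:R ^+ 2 * al) by lra.
exists (label_estimator q (fun N g => final_labels a (delta N) (K%:R ^+ 2 * al) g)) => e e0.
pose a0 := a (tree_root t); have a00 : 0 < a0 by exact: a_gt0.
pose cc := h0 * al ^+ 2 / 8; have cc0 : 0 < cc by rewrite !mulr_gt0 ?exprn_gt0.
pose Q := #|{: {perm leaf t} * leaf t}|%:R : R.
have Q0 : 0 < Q by rewrite ltr0n; apply/card_gt0P; exists (1%g, leaf0 t).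
near=> N.
have N1 : 1 <= N%:R :> R by near: N; exact: near_le_nat.
have N0 : (0 < N)%N by move: N1; rewrite ler1n.
have N0' : 0 < N%:R :> R by lra.
have e3 : 0 < e / 3 by rewrite divr_gt0.
have en : - ln (e / 3) <= N%:R by near: N; exact: near_le_nat.
have Kn : (ln (K%:R : R) + 2) * J / (cc * (1 + e1)) <= ln N%:R by near: N; exact: near_le_ln.
have Qn : (ln Q + C / a0 - ln (e / 3)) / (e1 / 2) <= ln N%:R by near: N; exact: near_le_ln.
have alN : 4 <= al * N%:R.
  have : 4 / al <= N%:R by near: N; exact: near_le_nat.
  by rewrite ler_pdivrMr // mulrC.
have dJ : (1 + e1) * ln N%:R <= N%:R * delta N * J by near: N.
have d0 := delta_gt0 N0; set d := delta N in d0 dJ *.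
have typ : prob (fun=> pi) (predC (@typical R (leaf t) pi N eta)) <= e / 3.
  by near: N; apply: near_typical => // [c|]; [exact: ltW|rewrite divr_gt0].
(* Validity of [p] at the root bounds [d] by [1 / a0], so the constant term stays bounded even if
   [d] does not tend to 0. *)
have da : d * C <= C / a0.
  rewrite mulrC ler_pM2l // -[a0^-1]mul1r ler_pdivlMr // mulrC.
  by have /andP[] := p01 N0 (tree_root t).
have T1 : N%:R * (K%:R ^+ N * expR (- d * (cc * N%:R ^+ 2))) <= e / 3.
  have -> : (K%:R : R) ^+ N = expR (N%:R * ln (K%:R : R)) by rewrite expRM_natl lnK.
  rewrite -expRD; apply: union_bound_decay dJ Kn en => //.
have T2 : N%:R * (Q * star_bound t d N al eta (J * rho / 3) J M Ml) <= e / 3.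
  by apply: star_decay r1 dJ Y_ge da Qn.
have b0 : 0 <= N%:R * (K%:R ^+ N * expR (- d * (cc * N%:R ^+ 2)) + Q * star_bound t d N al eta (J * rho / 3) J M Ml).
  by rewrite mulr_ge0 ?addr_ge0 ?mulr_ge0 ?exprn_ge0 ?expR_ge0 ?(ltW Q0) ?(ltW N0').
apply: le_trans (joint_prob_cond (fun c => ltW (pi_gt0 c)) pi_sum1 (fun _ => p01 N0) (typ := @typical R (leaf t) pi N eta) b0 _) _; last first.
  by rewrite mulrDr; lra.
move=> s /forallP styp.
apply: (failure_bound (pi := pi)) => //.
- exact: p01.
- by move=> x y; exact: MP (x, y).
- by move=> x y; exact: MlP (x, y).
- by move=> x y x' y' ne; exact: (h0P ((x, y), (x', y')) ne).
- by rewrite divr_gt0.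
- exact: ltW.
- exact: ltW.
- by move=> c; have := styp c; rewrite ltr_norml => /andP[/ltW H _]; rewrite mulrBl; lra.
- by move=> c; have H := pmP c isT; lra.
- by move=> c; have H := pmP c isT; lra.
Unshelve. all: by end_near. Qed.

End AchievabilityLimit.

(** * Impossibility *)

Section Flip.
Variables (R : realType) (t : btree) (pi : leaf t -> R) (p : node t -> R) (N q : nat).
Hypothesis pi_gt0 : forall c, 0 < pi c.
Hypothesis p01 : (0 < N)%N -> forall u, 0 <= p u <= 1.
Variables (C : graph N -> super t q -> {set 'I_N}) (x y : leaf t).
Hypothesis xy : ~~ same_super q x y.
Implicit Types (s : assignment t N) (g : graph N) (i j k : 'I_N).

Definition flip s i : assignment t N := [ffun j => if j == i then y else s j].

Definition confusable (kap : R) s g : bool :=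
  [exists i, (s i == x) && (kap * hsbm_pmf pi p s g <= hsbm_pmf pi p (flip s i) g)].

(** A second member of [y] stays put when a vertex moves there, and serves as the witness against
    which the blocks of the estimate are tested. *)
Definition two_in_y s : bool := (2 <= #|[set j | s j == y]%SET|)%N.

Lemma other_in_y s i : two_in_y s -> exists2 k, k != i & s k = y.
Proof.
rewrite /two_in_y (cardsD1 i) => H.
have /card_gt0P[k] : (0 < #|[set j | s j == y] :\ i|)%N%SET.
  by move: H; case: (i \in _); rewrite // add0n => /ltnW.
by rewrite !inE => /andP[ki /eqP sk]; exists k.
Qed.

Lemma x_neq_y : x != y.
Proof. by apply: contraNneq xy => ->; exact: same_super_refl. Qed.

Lemma joint_prob_pair (E : assignment t N -> graph N -> bool) :
  joint_prob pi p E = \sum_(z : assignment t N * graph N | E z.1 z.2) hsbm_pmf pi p z.1 z.2.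
Proof.
rewrite /joint_prob pair_big /= [RHS]big_mkcond; apply: eq_bigr => -[s g] _ /=.
by case: (E s g); rewrite ?mulr1 ?mulr0.
Qed.

(* Relabelling a confusable vertex turns a success into a failure, injectively
   and at bounded cost, because the blocks of the estimate determine the vertex. *)
Lemma flip_bound kap :
  kap * joint_prob pi p (fun s g => [&& loss s (C g) == 0%N, confusable kap s g & two_in_y s])
  <= joint_prob pi p (fun s g => loss s (C g) != 0%N).
Proof.
rewrite !joint_prob_pair.
pose D := [set z : assignment t N * graph N |
  [&& loss z.1 (C z.2) == 0%N, confusable kap z.1 z.2 & two_in_y z.1]]%SET.
have DE z : z \in D -> exists w, exists i, [/\ w = (flip z.1 i, z.2), z.1 i = x &
     kap * hsbm_pmf pi p z.1 z.2 <= hsbm_pmf pi p (flip z.1 i) z.2].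
  rewrite inE => /and3P[_ /existsP[i /andP[/eqP si H]] _].
  by exists (flip z.1 i, z.2), i.
have [phi phiP] : exists phi : assignment t N * graph N -> assignment t N * graph N,
    forall z, z \in D -> exists i, [/\ phi z = (flip z.1 i, z.2), z.1 i = x &
     kap * hsbm_pmf pi p z.1 z.2 <= hsbm_pmf pi p (flip z.1 i) z.2].
  have H z : exists w, z \in D -> exists i, [/\ w = (flip z.1 i, z.2), z.1 i = x &
     kap * hsbm_pmf pi p z.1 z.2 <= hsbm_pmf pi p (flip z.1 i) z.2].
    by case: (boolP (z \in D)) => [/DE[w wP]|]; [exists w|exists z].
  by have [f fP] := fin_all_exists H; exists f.
have loss0 z : z \in D -> loss z.1 (C z.2) = 0%N by rewrite inE => /and3P[/eqP].
have two z : z \in D -> two_in_y z.1 by rewrite inE => /and3P[].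
have inj : {in D &, injective phi}.
  move=> [s1 g1] [s2 g2] z1 z2 E.
  have [i1 /= [E1 s1x _]] := phiP _ z1; have [i2 /= [E2 s2x _]] := phiP _ z2.
  move: E; rewrite E1 E2 => -[/ffunP fl gE]; subst g2.
  have same i j := etrans (loss0_same_super (loss0 _ z1) i j) (esym (loss0_same_super (loss0 _ z2) i j)).
  case: (eqVneq i1 i2) => [i12|i12].
    congr pair; apply/ffunP => j; have := fl j; rewrite !ffunE -i12.
    by case: eqP => [->|//]; rewrite s1x i12 s2x.
  (* For distinct moved vertices, [i2] is in [y] under [s1] but in [x] under [s2], while [k] is in
     [y] under both. One estimate cannot fit both assignments. *)
  have s1y : s1 i2 = y by have := fl i2; rewrite !ffunE eqxx eq_sym (negbTE i12).
  have [k ki2 sk] := other_in_y i2 (two _ z1).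
  have ki1 : k != i1 by apply: contraNneq x_neq_y => ki1; rewrite -s1x -ki1 sk.
  have s2k : s2 k = y by have := fl k; rewrite !ffunE (negbTE ki1) (negbTE ki2) sk => ->.
  by have := same i2 k; rewrite /= s1y sk s2x s2k same_super_refl (negbTE xy).
have imF : {in D, forall z, loss (phi z).1 (C (phi z).2) != 0%N}.
  move=> [s g] zD; have [i /= [-> sx _]] := phiP _ zD; apply/negP => /eqP /= l0.
  have same := etrans (loss0_same_super (loss0 _ zD) i _) (esym (loss0_same_super l0 i _)).
  have [k ki sk] := other_in_y i (two _ zD).
  by have := same k; rewrite /= !ffunE eqxx (negbTE ki) sx sk same_super_refl (negbTE xy).
rewrite big_distrr /=.
apply: le_trans (_ : \sum_(z in D) hsbm_pmf pi p (phi z).1 (phi z).2 <= _).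
  rewrite (eq_bigl (fun z => z \in D)); last by move=> z; rewrite inE.
  by apply: ler_sum => z zD; have [i [-> _]] := phiP _ zD.
rewrite -(big_imset (fun w => hsbm_pmf pi p w.1 w.2) inj) /=.
rewrite big_mkcond [X in _ <= X]big_mkcond; apply: ler_sum => w _ /=.
case: ifP => [/imsetP[z zD ->]|_]; first by rewrite imF.
by case: ifP => _ //; apply: hsbm_pmf_ge0 => // c; exact: ltW.
Qed.

(** The total mass 1 splits into failures, confusable successes, which are at most [kap^-1] times
    the failures, and the rest, at most [b]. *)
Lemma impossible_of_confusable kap b : 0 < kap -> \sum_c pi c = 1 ->
  joint_prob pi p (fun s g => ~~ (confusable kap s g && two_in_y s)) <= b ->
  1 - b <= (1 + kap^-1) * joint_prob pi p (fun s g => loss s (C g) != 0%N).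
Proof.
move=> k0 pi1 Hb.
have := joint_prob_total p N pi1.
set F := joint_prob pi p (fun s g => loss s (C g) != 0%N).
set D := joint_prob pi p (fun s g => [&& loss s (C g) == 0%N, confusable kap s g & two_in_y s]).
have FD : D <= kap^-1 * F by rewrite mulrC ler_pdivlMr // mulrC flip_bound.
suff : joint_prob pi p (fun (s : assignment t N) (g : graph N) => true) <= F + D + b by lra.
apply: le_trans (lerD (lexx _) Hb).
rewrite /F /D /joint_prob -!big_split; apply: ler_sum => s _ /=.
rewrite -!big_split; apply: ler_sum => g _ /=.
rewrite -!mulrDr ler_wpM2l ?hsbm_pmf_ge0 //; first by move=> c; exact: ltW.
rewrite -!natrD ler_nat; case: (loss _ _ == _) => //=.
by case: (confusable _ _ _ && _).
Qed.

End Flip.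

Section Star.
Variables (N : nat).
Implicit Types (i j : 'I_N) (e : 'I_N * 'I_N).

Definition star_of i e : bool := (e.1 < e.2)%N && ((e.1 == i) || (e.2 == i)).
Definition other_end i e : 'I_N := if e.1 == i then e.2 else e.1.

Lemma other_end_edge i j : other_end i (edge i j) = j.
Proof. by rewrite /other_end /edge; case: (i < j)%N; rewrite /= ?eqxx //; case: (j =P i). Qed.

Lemma star_of_edge i j : j != i -> star_of i (edge i j).
Proof.
move=> ji; rewrite /star_of edge_ordered 1?eq_sym //= /edge.
by case: ifP => _ /=; rewrite eqxx ?orbT.
Qed.

Lemma edge_other_end i e : star_of i e -> edge i (other_end i e) = e /\ other_end i e != i.
Proof.
case: e => j k /andP[/= jk]; rewrite /other_end /=; case: (eqVneq j i) => [<- _|ji /= /eqP ki].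
  by rewrite edge_lt // -(inj_eq val_inj) /= gtn_eqF.
by subst k; rewrite edgeC edge_lt.
Qed.

Lemma prod_star (R : realType) i (P : pred 'I_N) (F : 'I_N * 'I_N -> R) :
  \prod_(e | star_of i e && P (other_end i e)) F e = \prod_(j | (j != i) && P j) F (edge i j).
Proof.
rewrite (reindex_onto (edge i) (other_end i)); last by move=> e /andP[/edge_other_end[]].
apply: eq_bigl => j; rewrite other_end_edge eqxx andbT.
case: (eqVneq j i) => [->|ji] /=; last by rewrite star_of_edge.
by rewrite /star_of /edge; case: ifP; rewrite ltnn.
Qed.

End Star.

Section FlipRatio.
Variables (R : realType) (t : btree) (pi : leaf t -> R) (p : node t -> R) (N : nat).
Hypothesis pi_gt0 : forall c, 0 < pi c.
Implicit Types (s : assignment t N) (X : {ffun 'I_N * 'I_N -> bool}).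

Definition bern (r : R) (b : bool) : R := if b then r else 1 - r.

Lemma hsbm_pmf_mkgraph s X : hsbm_pmf pi p s (mkgraph X) =
  (\prod_i pi (s i)) * \prod_(e : 'I_N * 'I_N | (e.1 < e.2)%N) graph_weight p s e (X e).
Proof.
rewrite /hsbm_pmf pair_big_dep /=; congr (_ * _); apply: eq_bigr => -[i j] /= ij.
by have /= -> := @adj_mkgraph_lt _ X (i, j) ij.
Qed.

Lemma hsbm_pmf_star s X i : hsbm_pmf pi p s (mkgraph X) =
  (pi (s i) * \prod_(j | j != i) pi (s j)) *
  ((\prod_(j | j != i) bern (p (lca (s i) (s j))) (X (edge i j))) *
   \prod_(e : 'I_N * 'I_N | (e.1 < e.2)%N && ~~ ((e.1 == i) || (e.2 == i))) graph_weight p s e (X e)).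
Proof.
rewrite hsbm_pmf_mkgraph (bigD1 i) //=; congr (_ * _).
rewrite (bigID (fun e : 'I_N * 'I_N => (e.1 == i) || (e.2 == i))) /=; congr (_ * _).
have := prod_star i predT (fun e => graph_weight p s e (X e)).
under eq_bigl do rewrite andbT; rewrite /star_of => ->.
apply: eq_big => [j|j ji]; first by rewrite andbT.
by rewrite /graph_weight bernoulli_weight_edge //; exact: edge_probC.
Qed.

(** Only the prior factor and the edges at [i] change, so the likelihood ratio of the star decides;
    [pi (s i) <= 1] disposes of the prior of the old label. *)
Lemma flip_pmf s X i (y : leaf t) (B : R) : (forall c, pi c <= 1) ->
  (forall u, 0 <= p u <= 1) ->
  expR (- B) * \prod_(j | j != i) bern (p (lca (s i) (s j))) (X (edge i j)) <=
     \prod_(j | j != i) bern (p (lca y (s j))) (X (edge i j)) ->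
  pi y * expR (- B) * hsbm_pmf pi p s (mkgraph X) <= hsbm_pmf pi p (flip y s i) (mkgraph X).
Proof.
move=> pi1 p01 H; rewrite !(hsbm_pmf_star _ _ i).
have fi : flip y s i i = y by rewrite ffunE eqxx.
have fj j : j != i -> flip y s i j = s j by move=> ji; rewrite ffunE (negbTE ji).
set Q := \prod_(j | j != i) pi (s j).
have -> : \prod_(j | j != i) pi (flip y s i j) = Q by apply: eq_bigr => j /fj ->.
rewrite fi; have -> : \prod_(j | j != i) bern (p (lca y (flip y s i j))) (X (edge i j)) =
    \prod_(j | j != i) bern (p (lca y (s j))) (X (edge i j)).
  by apply: eq_bigr => j /fj ->.
have -> : \prod_(e : 'I_N * 'I_N | (e.1 < e.2)%N && ~~ ((e.1 == i) || (e.2 == i)))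
      graph_weight p (flip y s i) e (X e) =
    \prod_(e : 'I_N * 'I_N | (e.1 < e.2)%N && ~~ ((e.1 == i) || (e.2 == i))) graph_weight p s e (X e).
  apply: eq_bigr => -[j k] /andP[/= _]; rewrite negb_or => /andP[ji ki].
  by rewrite /graph_weight /bernoulli_weight /edge_prob !fj.
set Z := \prod_(e : 'I_N * 'I_N | (e.1 < e.2)%N && ~~ ((e.1 == i) || (e.2 == i))) _.
have Q0 : 0 <= Q by apply: prodr_ge0 => j _; exact: ltW.
have Z0 : 0 <= Z.
  by apply: prodr_ge0 => e _; exact: (graph_weight_ge0 (fun _ => p01)).
set P1 := \prod_(j | j != i) _ in H *; set P2 := \prod_(j | j != i) _ in H *.
have P10 : 0 <= P1.
  by apply: prodr_ge0 => j _; rewrite /bern; case: (X _); rewrite ?subr_ge0; have /andP[] := p01 (lca (s i) (s j)).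
apply: le_trans (_ : pi y * Q * Z * (expR (- B) * P1) <= _); last first.
  have := ler_wpM2l (mulr_ge0 (mulr_ge0 (ltW (pi_gt0 y)) Q0) Z0) H.
  by move=> H1; apply: le_trans H1 _; rewrite le_eqVlt; apply/orP; left; apply/eqP; ring.
have := ler_wpM2l (mulr_ge0 (mulr_ge0 (mulr_ge0 (ltW (pi_gt0 y)) Q0) Z0) (mulr_ge0 (expR_ge0 (- B)) P10)) (pi1 (s i)).
lra.
Qed.

End FlipRatio.

(** * Second moment method for vertices isolated inside a small set *)

Section SecondMoment.
Variables (R : realType) (N : nat) (w : 'I_N * 'I_N -> bool -> R).
Hypothesis w_ge0 : forall e c, 0 <= w e c.
Hypothesis w_sum1 : forall e, \sum_c w e c = 1.
Variables (W : {set 'I_N}) (p0 : R).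
Variable o : 'I_N -> {ffun 'I_N * 'I_N -> bool} -> bool.
Hypothesis p0_ge0 : 0 <= p0.
Hypothesis p0_lt1 : p0 < 1.
Hypothesis w_inside : forall i k, i \in W -> k \in W -> i != k -> w (edge i k) true = p0.
Hypothesis o_local : forall i (X Y : {ffun 'I_N * 'I_N -> bool}), i \in W ->
  (forall j, j \notin W -> X (edge i j) = Y (edge i j)) -> o i X = o i Y.
Implicit Types (i j k : 'I_N) (e : 'I_N * 'I_N) (X Y : {ffun 'I_N * 'I_N -> bool}).

Definition isolated (P : pred 'I_N) i X : bool := [forall j, (j \in W) && P j ==> ~~ X (edge i j)].

(** Isolation inside [W] fixes the edges through which candidates would interact; the other
    condition [o i] reads only edges leaving [W]. *)
Definition lone i X : bool := isolated (fun j => j != i) i X && o i X.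

Let in_edge i e : bool := (e.1 == i) || (e.2 == i).

Let in_edgeE i j k : in_edge i (edge j k) = (j == i) || (k == i).
Proof. by rewrite /in_edge /edge; case: (j < k)%N => //=; rewrite orbC. Qed.

Lemma isolated_local (P : pred 'I_N) i X Y :
  (forall j, j \in W -> P j -> X (edge i j) = Y (edge i j)) -> isolated P i X = isolated P i Y.
Proof.
move=> XY; apply: eq_forallb => j; case: (boolP (_ && _)) => //= /andP[jW Pj].
by rewrite XY.
Qed.

Let w_false i k : i \in W -> k \in W -> i != k -> w (edge i k) false = 1 - p0.
Proof. by move=> iW kW ik; rewrite -(w_sum1 (edge i k)) big_bool /= w_inside // addrC addrK. Qed.

(** The two events share only the edge between [i] and [k], required absent by both. The product of
    probabilities pays for it twice, hence the factor [1 - p0]. *)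
Lemma prob_lone_pair i k : i \in W -> k \in W -> i != k ->
  expect w (fun X => (lone i X)%:R * (lone k X)%:R) * (1 - p0) = prob w (lone i) * prob w (lone k).
Proof.
move=> iW kW ik.
pose l' X := isolated (fun j => (j != k) && (j != i)) k X && o k X.
have l'E X : lone k X = ~~ X (edge k i) && l' X.
  rewrite /lone /l' andbA; congr (_ && _).
  apply/forallP/andP => [H|[H1 /forallP H2] j].
    split; first by have := H i; rewrite iW ik.
    by apply/forallP => j; apply/implyP => /and3P[jW jk _]; have := H j; rewrite jW jk.
  apply/implyP => /andP[jW jk]; case: (eqVneq j i) => [->//|ji].
  by have := H2 j; rewrite jW jk ji.
have pk : prob w (lone k) = (1 - p0) * prob w l'.
  rewrite -(w_false kW iW) 1?eq_sym //.
  transitivity (expect w (fun X => (~~ X (edge k i))%:R) * expect w (fun X => (l' X)%:R)).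
    rewrite -(expect_indep w_sum1 (S := pred1 (edge k i))).
    - by apply: eq_expect => X; rewrite l'E -natrM mulnb.
    - by move=> X Y XY; rewrite XY //=.
    - move=> X Y XY; congr (_%:R); rewrite /l'; congr (nat_of_bool (_ && _)).
        apply: isolated_local => j jW /andP[jk ji]; apply: XY => /=.
        by apply: contra ji => /eqP /edge_inj ->.
      by apply: o_local => // j jW; apply: XY; apply: contra jW => /eqP /edge_inj ->.
  congr (_ * _); rewrite (expect_coord w_sum1 _ (fun c : bool => (~~ c)%:R)) big_bool /=.
  by rewrite mulr0 add0r mulr1.
have -> : expect w (fun X => (lone i X)%:R * (lone k X)%:R) = prob w (lone i) * prob w l'.
  rewrite /prob -(expect_indep w_sum1 (S := in_edge i)).
  - apply: eq_expect => X; rewrite -!natrM !mulnb l'E; congr (nat_of_bool _)%:R.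
    case: (boolP (lone i X)) => //= /andP[/forallP/(_ k)]; rewrite kW eq_sym ik /= => + _.
    by rewrite edgeC => ->.
  - move=> X Y XY; congr (_%:R); rewrite /lone; congr (nat_of_bool (_ && _)).
      by apply: isolated_local => j _ _; apply: XY; rewrite in_edgeE eqxx.
    by apply: o_local => // j _; apply: XY; rewrite in_edgeE eqxx.
  - move=> X Y XY; congr (_%:R); rewrite /l'; congr (nat_of_bool (_ && _)).
      apply: isolated_local => j _ /andP[_ ji]; apply: XY.
      by rewrite in_edgeE negb_or eq_sym ik ji.
    apply: o_local => // j jW; apply: XY; rewrite in_edgeE negb_or eq_sym ik /=.
    by apply: contraNneq jW => ->.
by rewrite pk; ring.
Qed.

(** Chebyshev for the number of lone vertices: by [prob_lone_pair] its second moment is at most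
    [S + S ^+ 2 / (1 - p0)]. *)
Lemma prob_none_lone : let S := \sum_(i in W) prob w (lone i) in 0 < S ->
  prob w (fun X => ~~ [exists i, (i \in W) && lone i X]) <= S^-1 + p0 / (1 - p0).
Proof.
move=> S S0; have p1 : 0 < 1 - p0 by rewrite subr_gt0.
pose f X := \sum_(i in W) (lone i X)%:R : R.
have Ef : expect w f = S by rewrite expect_sum.
have Ef2 : expect w (fun X => f X ^+ 2) <= S + S ^+ 2 / (1 - p0).
  have -> : expect w (fun X => f X ^+ 2) =
      \sum_(i in W) \sum_(k in W) expect w (fun X => (lone i X)%:R * (lone k X)%:R).
    transitivity (expect w (fun X => \sum_(i in W) \sum_(k in W) ((lone i X)%:R * (lone k X)%:R : R))).
      by apply: eq_expect => X; rewrite expr2 /f big_distrlr.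
    by rewrite expect_sum; apply: eq_bigr => i _; rewrite expect_sum.
  apply: le_trans (_ : \sum_(i in W) (prob w (lone i) + prob w (lone i) * (S / (1 - p0))) <= _); last first.
    by rewrite big_split /= -big_distrl /= -/S expr2 mulrA.
  apply: ler_sum => i iW; rewrite (bigD1 i) //=; apply: lerD.
    by rewrite le_eqVlt; apply/orP; left; apply/eqP/eq_expect => X; rewrite -natrM mulnb andbb.
  apply: le_trans (_ : \sum_(k in W) prob w (lone i) * (prob w (lone k) / (1 - p0)) <= _); last first.
    by rewrite -big_distrr /= -big_distrl.
  rewrite big_mkcond [X in _ <= X]big_mkcond; apply: ler_sum => k _ /=.
  case: (boolP (k \in W)) => kW //=; case: ifP => ki; last first.
    by rewrite mulr_ge0 ?divr_ge0 ?prob_ge0 ?(ltW p1).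
  by rewrite mulrA ler_pdivlMr // prob_lone_pair // eq_sym.
apply: le_trans (_ : expect w (fun X => (S ^+ 2)^-1 * (f X - S) ^+ 2) <= _).
  apply: markov_expect => // X; first by rewrite mulr_ge0 ?invr_ge0 ?sqr_ge0.
  move=> none; have -> : f X = 0.
    rewrite /f big1 // => i iW; move: none; rewrite negb_exists => /forallP/(_ i).
    by rewrite iW /= => /negbTE ->.
  by rewrite sub0r sqrrN mulVf // expf_neq0 // gt_eqF.
rewrite expectZ.
have -> : expect w (fun X => (f X - S) ^+ 2) = expect w (fun X => f X ^+ 2) - S ^+ 2.
  transitivity (expect w (fun X => f X ^+ 2 + ((- 2 * S) * f X + S ^+ 2))).
    by apply: eq_expect => X; ring.
  by rewrite !expectD expectZ Ef expect_cst //; ring.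
rewrite mulrC ler_pdivrMr ?exprn_gt0 // lerBlDr; apply: le_trans Ef2 _.
rewrite le_eqVlt; apply/orP; left; apply/eqP; field.
by rewrite !gt_eqF.
Qed.

Lemma prob_lone_ge i : i \in W -> (1 - p0) ^+ #|W| * prob w (o i) <= prob w (lone i).
Proof.
move=> iW; have p1 : 0 <= 1 - p0 by rewrite subr_ge0 ltW.
have -> : prob w (lone i) = prob w (isolated (fun j => j != i) i) * prob w (o i).
  rewrite /prob -(expect_indep w_sum1 (S := fun e => (e.1 \in W) && (e.2 \in W))).
  - by apply: eq_expect => X; rewrite -natrM mulnb.
  - move=> X Y XY; congr (nat_of_bool _)%:R; apply: isolated_local => j jW _.
    by apply: XY; rewrite /edge; case: ifP => _ /=; rewrite iW jW.
  - move=> X Y XY; congr (nat_of_bool _)%:R; apply: o_local => // j jW.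
    by apply: XY; rewrite /edge; case: ifP => _ /=; rewrite (negbTE jW) ?andbF.
rewrite ler_wpM2r ?prob_ge0 //.
have -> : prob w (isolated (fun j => j != i) i) =
    expect w (fun X => \prod_(j | (j \in W) && (j != i)) (~~ X (edge i j))%:R).
  apply: eq_expect => X; case: (boolP (isolated _ i X)) => [/forallP H|].
    by rewrite big1 // => j Pj; have := H j; rewrite Pj => /= ->.
  rewrite negb_forall => /existsP[j]; rewrite negb_imply negbK => /andP[Pj Xj].
  by rewrite (bigD1 j) //= Xj mul0r.
have inj : {in [pred j | (j \in W) && (j != i)] &, injective (edge i)} by move=> j k _ _ /edge_inj.
rewrite (expect_prod_inj w_sum1 (fun _ c => (~~ c)%:R) inj).
rewrite (eq_bigr (fun=> 1 - p0)); last first.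
  move=> j /andP[jW ji]; rewrite big_bool /= mulr0 add0r mulr1 w_false // eq_sym.
  by [].
rewrite prodr_const; apply: ler_wiXn2l => //; first by rewrite gerBl.
by apply: subset_leq_card; apply/fintype.subsetP => j /andP[].
Qed.

End SecondMoment.

(** * Bernoulli log-likelihood ratios and the change of measure at one vertex *)

Section BernoulliRatio.
Variables (R : realType) (d M Ml : R).
Hypothesis d_gt0 : 0 < d.
Hypothesis Md_le : M * d <= 2^-1.
Implicit Types (u v w : R).

Definition llr u v (b : bool) : R := ln (bern (u * d) b) - ln (bern (v * d) b).

Lemma bern_gt0 u b : 0 < u <= M -> 0 < bern (u * d) b.
Proof.
move=> /andP[u0 uM]; have ud : u * d <= M * d by rewrite ler_pM2r.
by have := Md_le; case: b; rewrite /bern; [rewrite mulr_gt0|rewrite subr_gt0; lra].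
Qed.

Lemma bern_llr u v b : 0 < u <= M -> 0 < v <= M ->
  bern (u * d) b = bern (v * d) b * expR (llr u v b).
Proof.
move=> uM vM; rewrite /llr expRB !lnK ?posrE ?bern_gt0 //.
by rewrite mulrCA divff ?mulr1 // gt_eqF ?bern_gt0.
Qed.

Lemma llr_true u v : 0 < u -> 0 < v -> llr u v true = ln u - ln v.
Proof. by move=> u0 v0; rewrite /llr /bern !lnM ?posrE //; ring. Qed.

Lemma ln_1B_bounds u : 0 < u <= M -> - (u * d) - 2 * (M * d) ^+ 2 <= ln (1 - u * d) <= - (u * d).
Proof.
move=> uM; have /andP[u0 uM'] := uM.
have ud0 : 0 < u * d by rewrite mulr_gt0.
have ud : u * d <= M * d by rewrite ler_pM2r.
have Md := Md_le; apply/andP; split.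
  apply: le_trans (ln1B_ge (x := u * d) _); last by apply/andP; lra.
  have : (u * d) ^+ 2 <= (M * d) ^+ 2 by rewrite lerXn2r ?nnegrE //; lra.
  lra.
have := @ln_le_sub1 R (1 - u * d); lra.
Qed.

(** To first order in [d] the mean is the Poisson one. Expanding the non-edge logarithms costs
    [2 * (M * d) ^+ 2], and dropping their product with [w * d] costs as much again. *)
Lemma bern_llr_mean_ge u v w : 0 < u <= M -> 0 < v <= M -> 0 < w <= M ->
  d * (w * (ln u - ln v) - (u - v)) - 4 * (M * d) ^+ 2 <=
  w * d * llr u v true + (1 - w * d) * llr u v false.
Proof.
move=> uM vM wM; have /andP[u0 uM'] := uM; have /andP[v0 vM'] := vM; have /andP[w0 wM'] := wM.
have /andP[lu1 lu2] := ln_1B_bounds uM; have /andP[lv1 lv2] := ln_1B_bounds vM.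
rewrite llr_true // /llr /bern.
set D0 := ln (1 - u * d) - ln (1 - v * d); have Md := Md_le; have d0 := d_gt0.
have wd0 : 0 <= w * d by rewrite mulr_ge0 ?ltW.
have wd : w * d <= M * d by rewrite ler_pM2r.
have vd : v * d <= M * d by rewrite ler_pM2r.
have ud0 : 0 <= u * d by rewrite mulr_ge0 ?ltW.
have M2 : (M * d) ^+ 2 <= 2^-1 * (M * d) by rewrite expr2 ler_wpM2r //; lra.
have D0le : D0 <= 2 * (M * d) by rewrite /D0; lra.
have D0ge : - ((u - v) * d) - 2 * (M * d) ^+ 2 <= D0 by rewrite /D0; lra.
have wD0 : w * d * D0 <= 2 * (M * d) ^+ 2.
  apply: le_trans (_ : w * d * (2 * (M * d)) <= _); first by rewrite ler_wpM2l.
  have Md0 : 0 <= M * d by lra.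
  have := ler_wpM2r Md0 wd; rewrite expr2; lra.
have -> : (1 - w * d) * D0 = D0 - w * d * D0 by ring.
lra.
Qed.

Lemma llrN u v b : llr v u b = - llr u v b.
Proof. by rewrite /llr opprB. Qed.

Lemma bern_llr_mean_le u v w : 0 < u <= M -> 0 < v <= M -> 0 < w <= M ->
  w * d * llr u v true + (1 - w * d) * llr u v false <=
  d * (w * (ln u - ln v) - (u - v)) + 4 * (M * d) ^+ 2.
Proof.
move=> uM vM wM; have := bern_llr_mean_ge vM uM wM.
rewrite (llrN u v) (llrN u v); lra.
Qed.

(** The first term comes from the edge, the second from the non-edge, where [M * d <= 1/2] reduces a
    quadratic bound to a linear one. *)
Definition llr_var : R := 4 * M * Ml ^+ 2 + 2 * M.

Lemma bern_llr_sqr u v w : 0 < u <= M -> 0 < v <= M -> 0 < w <= M ->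
  `|ln u| <= Ml -> `|ln v| <= Ml ->
  w * d * llr u v true ^+ 2 + (1 - w * d) * llr u v false ^+ 2 <= llr_var * d.
Proof.
move=> uM vM wM lu lv; have /andP[u0 uM'] := uM; have /andP[v0 vM'] := vM; have /andP[w0 wM'] := wM.
have /andP[lu1 lu2] := ln_1B_bounds uM; have /andP[lv1 lv2] := ln_1B_bounds vM.
rewrite llr_true // /llr /bern.
set D0 := ln (1 - u * d) - ln (1 - v * d); have Md := Md_le; have d0 := d_gt0.
have wd0 : 0 <= w * d by rewrite mulr_ge0 ?ltW.
have wd : w * d <= M * d by rewrite ler_pM2r.
have vd : v * d <= M * d by rewrite ler_pM2r.
have ud : u * d <= M * d by rewrite ler_pM2r.
have ud0 : 0 <= u * d by rewrite mulr_ge0 ?ltW.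
have vd0 : 0 <= v * d by rewrite mulr_ge0 ?ltW.
have Md0 : 0 <= M * d by lra.
have M2 : (M * d) ^+ 2 <= 2^-1 * (M * d) by rewrite expr2 ler_wpM2r //; lra.
have sq (z B : R) : `|z| <= B -> z ^+ 2 <= B ^+ 2.
  by move=> zB; rewrite -(real_normK (num_real z)) lerXn2r ?nnegrE ?normr_ge0 // (le_trans _ zB).
have D2 : D0 ^+ 2 <= (2 * (M * d)) ^+ 2.
  by apply: sq; rewrite ler_norml; apply/andP; rewrite /D0; split; lra.
have L2 : (ln u - ln v) ^+ 2 <= (2 * Ml) ^+ 2.
  by apply: sq; apply: le_trans (ler_normB _ _) _; lra.
have X1 : w * d * (ln u - ln v) ^+ 2 <= M * d * (2 * Ml) ^+ 2 by apply: ler_pM; rewrite ?sqr_ge0.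
have X2 : (1 - w * d) * D0 ^+ 2 <= D0 ^+ 2 by rewrite ler_piMl ?sqr_ge0 //; lra.
rewrite /llr_var; move: X1 D2; rewrite !exprMn; lra.
Qed.

End BernoulliRatio.

Section Tilt.
Variables (R : realType) (t : btree) (pi : leaf t -> R) (a : node t -> R) (d M Ml eta : R) (N : nat).
Hypothesis a_gt0 : forall u, 0 < a u.
Hypothesis d_gt0 : 0 < d.
Hypothesis Md_le : M * d <= 2^-1.

Local Notation rate := (rate a).
Local Notation p := (fun u => a u * d).
Let K := #|{: leaf t}|.

Hypothesis rate_leM : forall x y, rate x y <= M.
Hypothesis ln_rate_le : forall x y, `|ln (rate x y)| <= Ml.

Variables (s : assignment t N) (W : {set 'I_N}) (x y : leaf t) (r : leaf t -> R) (e2 J : R).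
Hypothesis s_typ : typical pi eta s.
Hypothesis W_le : #|W|%:R <= eta * N%:R.
Hypothesis sW : forall i, i \in W -> s i = x.
Hypothesis r_M : forall c, 0 < r c <= M.
Hypothesis ln_r_le : forall c, `|ln (r c)| <= Ml.
Hypothesis e2_gt0 : 0 < e2.
Hypothesis slope : \sum_c pi c * (r c * (ln (rate y c) - ln (rate x c)) - (rate y c - rate x c)) = e2.
Hypothesis div_le : \sum_c pi c * (r c * (ln (r c) - ln (rate x c)) - (r c - rate x c)) <= J + e2.

Definition tilt_range : R := 2 * M * Ml + M.

Hypothesis small : (K%:R + 1) * eta * tilt_range + 4 * M ^+ 2 * d <= e2 / 2.

Implicit Types (i j : 'I_N) (e : 'I_N * 'I_N) (X : {ffun 'I_N * 'I_N -> bool}) (c : leaf t).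

Local Notation wt := (graph_weight p s).

Let M_gt0 : 0 < M.
Proof. by have /andP[r0 rM] := r_M x; exact: lt_le_trans rM. Qed.

Let rateM c c' : 0 < rate c c' <= M.
Proof. by rewrite rate_leM andbT; exact: a_gt0. Qed.

(** Typicality gives an error [eta * N * F] for each of the [K] communities, and omitting [W] costs
    one more. *)
Lemma sum_outside (phi : leaf t -> R) (F : R) : (forall c, `|phi c| <= F) ->
  `|\sum_(j | j \notin W) phi (s j) - N%:R * \sum_c pi c * phi c| <= (K%:R + 1) * eta * F * N%:R.
Proof.
move=> phiF; have F0 : 0 <= F by apply: le_trans (phiF x).
have -> : \sum_(j | j \notin W) phi (s j) = \sum_j phi (s j) - \sum_(j in W) phi (s j).
  by rewrite [in RHS](bigID (fun j => j \in W)) /= addrAC subrr add0r.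
have -> : \sum_j phi (s j) = \sum_c #|[set j | s j == c]%SET|%:R * phi c.
  rewrite (partition_big s predT) //=; apply: eq_bigr => c _.
  rewrite mulr_natl -sumr_const; apply: eq_big => [j|j /eqP -> //].
  by rewrite inE.
rewrite addrAC big_distrr -sumrB /=.
apply: le_trans (ler_normB _ _) _.
have -> : (K%:R + 1) * eta * F * N%:R = K%:R * (eta * N%:R * F) + eta * N%:R * F by ring.
apply: lerD.
  apply: le_trans (ler_norm_sum _ _ _) _.
  rewrite mulr_natl -sumr_const; apply: ler_sum => c _.
  have -> : #|[set j | s j == c]%SET|%:R * phi c - N%:R * (pi c * phi c) =
    (#|[set j | s j == c]%SET|%:R - pi c * N%:R) * phi c by ring.
  by rewrite normrM ler_pM // ltW //; have /forallP := s_typ; apply.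
apply: le_trans (ler_norm_sum _ _ _) _.
apply: le_trans (_ : \sum_(j in W) F <= _); first by apply: ler_sum.
by rewrite sumr_const -[X in X <= _]mulr_natl ler_wpM2r.
Qed.

Lemma tilt_range_ge u v w : 0 < u <= M -> 0 < v <= M -> 0 < w <= M ->
  `|ln u| <= Ml -> `|ln v| <= Ml -> `|w * (ln u - ln v) - (u - v)| <= tilt_range.
Proof.
move=> /andP[u0 uM] /andP[v0 vM] /andP[w0 wM] lu lv.
apply: le_trans (ler_normB _ _) _; rewrite /tilt_range; apply: lerD.
  have lD : `|ln u - ln v| <= 2 * Ml by apply: le_trans (ler_normB _ _) _; lra.
  rewrite normrM (gtr0_norm w0); have -> : 2 * M * Ml = M * (2 * Ml) by ring.
  by apply: ler_pM => //; exact: ltW.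
by rewrite ler_norml; apply/andP; split; lra.
Qed.

Variable i : 'I_N.
Hypothesis iW : i \in W.

Definition swap_ok (B : R) X : bool :=
  expR (- B) * \prod_(j | j \notin W) bern (rate x (s j) * d) (X (edge i j)) <=
  \prod_(j | j \notin W) bern (rate y (s j) * d) (X (edge i j)).

Definition tilted e b : R :=
  if star_of i e && (other_end i e \notin W) then bern (r (s (other_end i e)) * d) b
  else wt e b.

Let notinW_neq j : j \notin W -> j != i.
Proof. by apply: contraNneq => ->. Qed.

Lemma tilted_edge j b : j \notin W -> tilted (edge i j) b = bern (r (s j) * d) b.
Proof. by move=> jW; rewrite /tilted star_of_edge ?notinW_neq //= other_end_edge jW. Qed.

Lemma wt_edge j b : wt (edge i j) b = bern (rate x (s j) * d) b.
Proof.
by rewrite /graph_weight bernoulli_weight_edge; [rewrite /edge_prob (sW iW)|exact: edge_probC].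
Qed.

Let p01 u v : 0 <= rate u v * d <= 1.
Proof.
have /andP[r0 rM] := rateM u v; rewrite mulr_ge0 ?(ltW r0) ?(ltW d_gt0) //=.
have : rate u v * d <= M * d by rewrite ler_pM2r.
by have := Md_le; lra.
Qed.

Let wt_ge0 e b : 0 <= wt e b.
Proof. by apply: bernoulli_weight_ge0 => j k; exact: p01. Qed.

Let wt_sum1 e : \sum_b wt e b = 1.
Proof. exact: graph_weight_sum1. Qed.

Lemma tilted_ge0 e b : 0 <= tilted e b.
Proof. by rewrite /tilted; case: ifP => _ //; exact/ltW/(bern_gt0 d_gt0 Md_le). Qed.

Lemma tilted_sum1 e : \sum_b tilted e b = 1.
Proof.
rewrite /tilted; case: (star_of i e && (other_end i e \notin W)) => //.
by rewrite big_bool /bern /= addrC subrK.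
Qed.

Lemma mass_tilted X : mass tilted X =
  mass wt X * expR (\sum_(j | j \notin W) llr d (r (s j)) (rate x (s j)) (X (edge i j))).
Proof.
rewrite /mass !(bigID (fun e => star_of i e && (other_end i e \notin W)) predT) /=.
rewrite !(prod_star i (fun j => j \notin W)).
have E F : \prod_(j | (j != i) && (j \notin W)) F j = \prod_(j | j \notin W) F j :> R.
  by apply: eq_bigl => j; case: (boolP (j \notin W)) => jW; rewrite ?andbF ?andbT // notinW_neq.
rewrite !E mulrAC; congr (_ * _); last first.
  by apply: eq_bigr => e /negbTE; rewrite /tilted => ->.
rewrite expR_sum -big_split; apply: eq_bigr => j jW /=.
by rewrite tilted_edge // wt_edge; apply: (@bern_llr R d M).
Qed.

Let inj : {in [pred j | j \notin W] &, injective (edge i)}.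
Proof. by move=> j k _ _ /edge_inj. Qed.

Let mean (u : leaf t -> R) j : j \notin W ->
  \sum_b tilted (edge i j) b * llr d (u (s j)) (rate x (s j)) b =
  r (s j) * d * llr d (u (s j)) (rate x (s j)) true +
  (1 - r (s j) * d) * llr d (u (s j)) (rate x (s j)) false.
Proof. by move=> jW; rewrite big_bool /= !tilted_edge. Qed.

(** Chosen so that AM-GM gives [(d * N * e2 / 2 + slack) ^+ 2 >= 4 * N * llr_var * d]. Chebyshev
    then yields 1/4 for every [N], even when [d * N] is small, with a constant independent of
    [N]. *)
Definition slack : R := 2 * llr_var M Ml / e2.

Lemma llr_var_gt0 : 0 < llr_var M Ml.
Proof.
have M0 := M_gt0; rewrite /llr_var ltr_wpDl ?mulr_gt0 //.
by rewrite mulr_ge0 ?sqr_ge0 // mulr_ge0 // ltW.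
Qed.

Lemma tilted_deviation (u : leaf t -> R) : (forall c, 0 < u c <= M) -> (forall c, `|ln (u c)| <= Ml) ->
  prob tilted (fun X => d * N%:R * e2 / 2 + slack <=
    `|\sum_(j | j \notin W) llr d (u (s j)) (rate x (s j)) (X (edge i j)) -
      \sum_(j | j \notin W) \sum_b tilted (edge i j) b * llr d (u (s j)) (rate x (s j)) b|) <= 4^-1.
Proof.
move=> uM lu; have V0 := llr_var_gt0.
have B0 : 0 < slack by rewrite divr_gt0 ?mulr_gt0.
have dN0 : 0 <= d * N%:R * e2 / 2 by rewrite !mulr_ge0 ?(ltW d_gt0) ?(ltW e2_gt0).
have c0 : 0 < d * N%:R * e2 / 2 + slack by rewrite ltr_wpDl.
have var : \sum_(j | j \notin W) \sum_b tilted (edge i j) b * llr d (u (s j)) (rate x (s j)) b ^+ 2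
    <= N%:R * (llr_var M Ml * d).
  apply: le_trans (_ : \sum_(j | j \notin W) (llr_var M Ml * d) <= _).
    apply: ler_sum => j jW; rewrite big_bool /= !tilted_edge //.
    exact: bern_llr_sqr.
  rewrite sumr_const -[X in X <= _]mulr_natl ler_wpM2r ?mulr_ge0 ?(ltW V0) ?(ltW d_gt0) //.
  by rewrite ler_nat -[X in (_ <= X)%N](card_ord N) max_card.
apply: le_trans (chebyshev_sum (w := tilted) tilted_ge0 tilted_sum1 inj c0 var) _.
rewrite ler_pdivrMr ?exprn_gt0 //.
have amgm : 4 * (d * N%:R * e2 / 2 * slack) <= (d * N%:R * e2 / 2 + slack) ^+ 2.
  have := sqr_ge0 (d * N%:R * e2 / 2 - slack).
  by rewrite sqrrB sqrrD; lra.
apply: le_trans (_ : 4^-1 * (4 * (d * N%:R * e2 / 2 * slack)) <= _); last by rewrite ler_pM2l.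
rewrite /slack le_eqVlt; apply/orP; left; apply/eqP; field.
by rewrite gt_eqF.
Qed.

(** Under the tilted law the ratio of [y] to [x] has mean at least [d * N * e2 / 2], and the
    log-density has mean at most [d * N * (J + 3/2 * e2)]. With probability at least 1/2 neither
    deviates, so the swap is acceptable and returning to the original law costs at most
    [expR (- T)]. *)
Lemma swap_ok_prob : 2^-1 * expR (- (d * N%:R * (J + 2 * e2) + slack)) <= prob wt (swap_ok slack).
Proof.
pose Z X := \sum_(j | j \notin W) llr d (rate y (s j)) (rate x (s j)) (X (edge i j)).
pose L X := \sum_(j | j \notin W) llr d (r (s j)) (rate x (s j)) (X (edge i j)).
pose T := d * N%:R * (J + 2 * e2) + slack.
have N0 : 0 <= N%:R :> R by [].
have dN0 : 0 <= d * N%:R by rewrite mulr_ge0 ?(ltW d_gt0).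
have cardW : \sum_(j | j \notin W) (4 * (M * d) ^+ 2) <= d * N%:R * (4 * M ^+ 2 * d).
  rewrite sumr_const -[X in X <= _]mulr_natl.
  have -> : d * N%:R * (4 * M ^+ 2 * d) = N%:R * (4 * (M * d) ^+ 2) by ring.
  apply: ler_wpM2r; first by rewrite mulr_ge0 ?sqr_ge0.
  by rewrite ler_nat -[X in (_ <= X)%N](card_ord N) max_card.
have small' := ler_wpM2l dN0 small.
have okZ X : - slack <= Z X -> swap_ok slack X.
  move=> H; rewrite /swap_ok.
  rewrite [X in _ <= X](eq_bigr (fun j => bern (rate x (s j) * d) (X (edge i j)) *
     expR (llr d (rate y (s j)) (rate x (s j)) (X (edge i j))))); last first.
    by move=> j _; apply: (@bern_llr R d M).
  rewrite big_split /= -expR_sum mulrC ler_wpM2l ?ler_expR //.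
  by apply: prodr_ge0 => j _; rewrite ltW // (bern_gt0 d_gt0 Md_le).
have devZ := tilted_deviation (rateM y) (ln_rate_le y).
have devL := tilted_deviation r_M ln_r_le.
have half : 2^-1 <= prob tilted (fun X => swap_ok slack X && (L X <= T)).
  have := probC tilted_sum1 (fun X => swap_ok slack X && (L X <= T)).
  suff : prob tilted (predC (fun X => swap_ok slack X && (L X <= T))) <= 4^-1 + 4^-1 by lra.
  apply: le_trans (lerD devZ devL); apply: le_trans (probU tilted_ge0 _ _).
  apply: le_prob; first exact: tilted_ge0.
  move=> X /=; rewrite negb_and => /orP[notok|notT]; apply/orP; [left|right].
    have ZX : Z X < - slack by rewrite ltNge; apply: contra notok; exact: okZ.
    rewrite ler_normr; apply/orP; right; rewrite opprB.
    have mZ : d * N%:R * e2 / 2 <= \sum_(j | j \notin W) \sum_b tilted (edge i j) b * llr d (rate y (s j)) (rate x (s j)) b.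
      have := sum_outside (phi := fun c => r c * (ln (rate y c) - ln (rate x c)) - (rate y c - rate x c))
        (fun c => tilt_range_ge (rateM y c) (rateM x c) (r_M c) (ln_rate_le y c) (ln_rate_le x c)).
      rewrite slope ler_norml => /andP[H _].
      apply: le_trans (_ : \sum_(j | j \notin W) (d * (r (s j) * (ln (rate y (s j)) - ln (rate x (s j))) - (rate y (s j) - rate x (s j))) - 4 * (M * d) ^+ 2) <= _); last first.
        by apply: ler_sum => j jW; rewrite (mean (rate y)) //; exact: bern_llr_mean_ge.
      rewrite sumrB -big_distrr /=.
      have := ler_wpM2l (ltW d_gt0) H; lra.
    by rewrite /Z in ZX; lra.
  have LX : T < L X by rewrite ltNge.
  rewrite ler_normr; apply/orP; left.
  have mL : \sum_(j | j \notin W) \sum_b tilted (edge i j) b * llr d (r (s j)) (rate x (s j)) b <= d * N%:R * (J + 3 / 2 * e2).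
    have := sum_outside (phi := fun c => r c * (ln (r c) - ln (rate x c)) - (r c - rate x c))
      (fun c => tilt_range_ge (r_M c) (rateM x c) (r_M c) (ln_r_le c) (ln_rate_le x c)).
    rewrite ler_norml => /andP[_ H].
    apply: le_trans (_ : \sum_(j | j \notin W) (d * (r (s j) * (ln (r (s j)) - ln (rate x (s j))) - (r (s j) - rate x (s j))) + 4 * (M * d) ^+ 2) <= _).
      by apply: ler_sum => j jW; rewrite (mean r) //; exact: bern_llr_mean_le.
    rewrite big_split /= -big_distrr /=.
    have := ler_wpM2l dN0 div_le; have := ler_wpM2l (ltW d_gt0) H; lra.
  by rewrite /L /T in LX; lra.
rewrite -/T; apply: le_trans (_ : expR (- T) * prob tilted (fun X => swap_ok slack X && (L X <= T)) <= _).
  by rewrite mulrC ler_pM2l ?expR_gt0.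
rewrite /prob -expectZ; apply: ler_sum => X _.
case: (boolP (swap_ok slack X)) => ok /=; last by rewrite !mulr0.
case: (boolP (L X <= T)) => LT; rewrite ?mulr1 ?mulr0; last exact: mass_ge0.
rewrite mass_tilted -/(L X) -mulrA -expRD -[X in _ <= X]mulr1 ler_wpM2l ?mass_ge0 //.
by rewrite -expR0 ler_expR; lra.
Qed.

End Tilt.

Lemma exists_subset_card (T : finType) (A : {set T}) (m : nat) :
  (m <= #|A|)%N -> exists2 B : {set T}, (B \subset A)%SET & #|B| = m.
Proof.
move=> mA; exists [set z in take m (enum A)]%SET.
  by apply/fintype.subsetP => z; rewrite inE => /mem_take; rewrite mem_enum.
rewrite cardsE; have /card_uniqP -> : uniq (take m (enum A)) by rewrite take_uniq ?enum_uniq.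
by rewrite size_takel // -cardE.
Qed.

Lemma near_ln_small (R : realType) (C : R) : \forall N \near \oo, C * ln N%:R <= N%:R :> R.
Proof.
near=> N.
have LC : 2 * C <= ln N%:R by near: N; exact: near_le_ln.
have L0 : 0 <= ln N%:R :> R by near: N; exact: near_le_ln.
have N1 : 1 <= N%:R :> R by near: N; exact: near_le_nat.
have := @expR_ge1Dxn R (ln N%:R) 1 L0; rewrite lnK ?posrE; last lra.
have -> : 2`!%:R = 2 :> R by [].
have : C * ln N%:R <= ln N%:R ^+ 2 / 2.
  have := ler_wpM2r L0 LC; rewrite expr2; lra.
lra.
Unshelve. all: by end_near. Qed.

Section ConfusableProb.
Variables (R : realType) (t : btree) (pi : leaf t -> R) (a : node t -> R) (d M Ml eta : R) (N : nat).
Hypothesis pi_gt0 : forall c, 0 < pi c.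
Hypothesis pi_le1 : forall c, pi c <= 1.
Hypothesis a_gt0 : forall u, 0 < a u.
Hypothesis a_child : forall u v, child u v -> a u < a v.
Hypothesis d_gt0 : 0 < d.
Hypothesis p01 : forall u, 0 <= a u * d <= 1.
Hypothesis Md_le : M * d <= 2^-1.

Local Notation rate := (rate a).
Local Notation p := (fun u => a u * d).
Let K := #|{: leaf t}|.

Hypothesis rate_leM : forall x y, rate x y <= M.
Hypothesis ln_rate_le : forall x y, `|ln (rate x y)| <= Ml.

Variables (s : assignment t N) (x y : leaf t) (r : leaf t -> R) (e2 J : R) (m : nat).
Hypothesis xy : x != y.
Hypothesis s_typ : typical pi eta s.
Hypothesis m_le : m%:R <= eta * N%:R.
Hypothesis m_gt0 : (0 < m)%N.
Hypothesis m_card : (m <= #|[set j | s j == x]%SET|)%N.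
Hypothesis two_y : two_in_y y s.
Hypothesis r_M : forall c, 0 < r c <= M.
Hypothesis ln_r_le : forall c, `|ln (r c)| <= Ml.
Hypothesis e2_gt0 : 0 < e2.
Hypothesis slope : \sum_c pi c * (r c * (ln (rate y c) - ln (rate x c)) - (rate y c - rate x c)) = e2.
Hypothesis div_le : \sum_c pi c * (r c * (ln (r c) - ln (rate x c)) - (r c - rate x c)) <= J + e2.
Hypothesis small : (K%:R + 1) * eta * tilt_range M Ml + 4 * M ^+ 2 * d <= e2 / 2.

Local Notation wt := (graph_weight p s).
Local Notation B := (slack M Ml e2).

(** Inside [W] every edge at [i] is absent, which is at least as likely under [y] as under [x] since
    [rate y x <= rate x x]. Only the edges leaving [W] can resist the move, and [swap_ok] bounds
    their effect. *)
Lemma lone_confusable (W : {set 'I_N}) i X : (forall j, j \in W -> s j = x) -> i \in W ->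
  lone W (swap_ok a d s W x y ^~ B) i X -> confusable pi p x y (pi y * expR (- B)) s (mkgraph X).
Proof.
move=> sW iW /andP[/forallP iso ok]; apply/existsP; exists i; rewrite (sW i iW) eqxx /=.
apply: flip_pmf => //.
have P0 c j : 0 <= bern (p (lca c (s j))) (X (edge i j)).
  by rewrite /bern; case: (X _); rewrite ?subr_ge0; have /andP[] := p01 (lca c (s j)).
rewrite (bigID (fun j => j \in W)) [X in _ <= X](bigID (fun j => j \in W)) /=.
have E c : \prod_(j | (j != i) && (j \notin W)) bern (p (lca c (s j))) (X (edge i j)) =
   \prod_(j | j \notin W) bern (rate c (s j) * d) (X (edge i j)).
  apply: eq_bigl => j; case: (boolP (j \in W)) => jW; rewrite ?andbF ?andbT //.
  by apply: contraNneq jW => ->.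
rewrite !E (sW i iW) mulrCA; apply: ler_pM => //; first by apply: prodr_ge0.
  by rewrite mulr_ge0 ?expR_ge0 // -E; apply: prodr_ge0.
apply: ler_prod => j /andP[ji jW]; rewrite P0 /=.
have := iso j; rewrite jW ji /= => /negbTE ->; rewrite /bern (sW j jW) lerD2l lerN2 ler_pM2r //.
by rewrite -/(rate y x) -/(rate x x) rateC ltW // (rate_lt a_child).
Qed.

Lemma confusable_prob :
  prob wt (fun X => ~~ (confusable pi p x y (pi y * expR (- B)) s (mkgraph X) && two_in_y y s)) <=
  (m%:R * ((1 - rate x x * d) ^+ m * (2^-1 * expR (- (d * N%:R * (J + 2 * e2) + B)))))^-1 +
    rate x x * d / (1 - rate x x * d).
Proof.
set p0 := rate x x * d.
have wt_ge0 e b : 0 <= wt e b by apply: graph_weight_ge0 => _.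
have wt_sum1 e : \sum_b wt e b = 1 by exact: graph_weight_sum1.
have [W /fintype.subsetP WA Wm] := exists_subset_card m_card.
have sW j : j \in W -> s j = x by move=> /WA; rewrite inE => /eqP.
have p00 : 0 <= p0 by exact: mulr_ge0 (ltW (a_gt0 _)) (ltW d_gt0).
have p0M : p0 <= M * d by rewrite ler_pM2r.
have p01' : p0 < 1 by have := Md_le; lra.
have inside i k : i \in W -> k \in W -> i != k -> wt (edge i k) true = p0.
  move=> iW kW _; rewrite /graph_weight bernoulli_weight_edge; last exact: edge_probC.
  by rewrite /edge_prob (sW i iW) (sW k kW).
have local i (X Y : {ffun 'I_N * 'I_N -> bool}) : i \in W ->
    (forall j, j \notin W -> X (edge i j) = Y (edge i j)) ->
    swap_ok a d s W x y i B X = swap_ok a d s W x y i B Y.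
  move=> _ XY; rewrite /swap_ok; congr (_ * _ <= _); apply: eq_bigr => j jW; rewrite XY //.
have W_le : #|W|%:R <= eta * N%:R by rewrite Wm.
pose l i := prob wt (lone W (swap_ok a d s W x y ^~ B) i).
pose bnd := (1 - p0) ^+ m * (2^-1 * expR (- (d * N%:R * (J + 2 * e2) + B))).
have bnd0 : 0 < bnd by rewrite mulr_gt0 ?exprn_gt0 ?subr_gt0 // mulr_gt0 ?expR_gt0 // invr_gt0.
have l_ge i : i \in W -> bnd <= l i.
  move=> iW; apply: le_trans (prob_lone_ge wt_ge0 wt_sum1 p00 p01' inside local iW).
  rewrite Wm /bnd ler_wpM2l ?exprn_ge0 ?subr_ge0 ?(ltW p01') //.
  exact: (swap_ok_prob a_gt0 d_gt0 Md_le rate_leM ln_rate_le s_typ W_le sW r_M ln_r_le e2_gt0 slope div_le small iW).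
have S_ge : m%:R * bnd <= \sum_(i in W) l i.
  by rewrite -Wm mulr_natl -sumr_const; apply: ler_sum.
have mb0 : 0 < m%:R * bnd by rewrite mulr_gt0 ?ltr0n.
have S0 := lt_le_trans mb0 S_ge.
apply: le_trans (_ : (\sum_(i in W) l i)^-1 + p0 / (1 - p0) <= _); last first.
  by rewrite lerD2r lef_pV2 ?posrE.
have none := prob_none_lone wt_ge0 wt_sum1 p01' inside local S0; apply: le_trans none.
apply: le_prob => // X; rewrite two_y andbT; apply: contra => /existsP[i /andP[iW li]].
exact: lone_confusable li.
Qed.

End ConfusableProb.

Section ImpossibilityEstimates.
Variable R : realType.
Implicit Types (n d J M eta B : R).

Lemma exponent_bound n d J (e1 e2 : R) M eta :
  0 < n -> 0 < J -> 0 < e1 -> 0 <= ln n -> 0 <= d ->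
  n * d * J <= (1 - e1) * ln n -> 2 * e2 + 2 * M * eta <= J * e1 / 2 ->
  d * n * (J + 2 * e2) + 2 * M * d * (eta * n) <= (1 - e1 / 2) * ln n.
Proof.
move=> n0 J0 e10 L0 d0 dJ small.
rewrite -(ler_pM2r J0).
have nd : 0 <= n * d by rewrite mulr_ge0 // ltW.
have H1 := ler_wpM2l nd small.
have H2 : (1 + e1 / 2) * (n * d * J) <= (1 + e1 / 2) * ((1 - e1) * ln n) by rewrite ler_wpM2l //; lra.
have H3 : (1 + e1 / 2) * (1 - e1) <= 1 - e1 / 2 by have := sqr_ge0 e1; rewrite expr2; lra.
have H4 := ler_wpM2r L0 H3.
have -> : (d * n * (J + 2 * e2) + 2 * M * d * (eta * n)) * J =
  (n * d * J + n * d * (2 * e2 + 2 * M * eta)) * J by ring.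
rewrite ler_pM2r //; lra.
Qed.

(** Below the threshold [d * n <= ln n / J], which makes the edge density small. *)
Lemma density_small n d J (e1 e2 : R) M : 0 < n -> 0 < d -> 0 < J -> 0 < e1 -> 0 < e2 -> 0 < M ->
  0 <= ln n -> n * d * J <= (1 - e1) * ln n ->
  (16 * M + 16 * M ^+ 2 / e2) / J * ln n <= n ->
  M * d <= 16^-1 /\ 4 * M ^+ 2 * d <= e2 / 4.
Proof.
move=> n0 d0 J0 e10 e20 M0 L0 dJ Ln.
have c1 : 0 < 16 * M by rewrite mulr_gt0.
have c2 : 0 < 16 * M ^+ 2 / e2 by rewrite divr_gt0 // mulr_gt0 // exprn_gt0.
have dn : d * n <= ln n / J.
  rewrite ler_pdivlMr //; have : 0 <= e1 * ln n by rewrite mulr_ge0 // ltW.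
  lra.
have H : (16 * M + 16 * M ^+ 2 / e2) * d <= 1.
  rewrite -(ler_pM2r n0) mul1r; apply: le_trans Ln.
  have := ler_wpM2l (ltW (addr_gt0 c1 c2)) dn; lra.
have X1 := mulr_gt0 c1 d0; have X2 := mulr_gt0 c2 d0.
rewrite mulrDl in H; split; first lra.
have : 16 * M ^+ 2 / e2 * d <= 1 by lra.
rewrite mulrAC ler_pdivrMr // mul1r; lra.
Qed.

(** The inverted quantity, a lower bound for the mean number of candidates, is at least a constant
    times [n ^ (e1 / 2)]: the factor [m] gives [n], and by [exponent_bound] isolation and tilting
    together cost at most [n ^ (1 - e1 / 2)]. Each summand is made at most 1/8. *)
Lemma second_moment_small n d J (e1 e2 : R) M eta B (p0 : R) m :
  0 < n -> 0 < d -> 0 < J -> 0 < e1 -> 0 < M -> 0 < eta -> 0 <= ln n ->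
  n * d * J <= (1 - e1) * ln n -> 2 * e2 + 2 * M * eta <= J * e1 / 2 ->
  (ln (32 / eta) + B) / (e1 / 2) <= ln n -> 2 / eta <= n -> M * d <= 16^-1 ->
  0 < p0 <= M * d -> m%:R <= eta * n < m.+1%:R ->
  (m%:R * ((1 - p0) ^+ m * (2^-1 * expR (- (d * n * (J + 2 * e2) + B)))))^-1 + p0 / (1 - p0) <= 1 / 4.
Proof.
move=> n0 d0 J0 e10 M0 eta0 L0 dJ small LS en Md /andP[p00 p0M] /andP[m_le m_gt].
have p1 : 0 < 1 - p0 by lra.
have T1 : p0 / (1 - p0) <= 1 / 8 by rewrite ler_pdivrMr //; lra.
suff T2 : (m%:R * ((1 - p0) ^+ m * (2^-1 * expR (- (d * n * (J + 2 * e2) + B)))))^-1 <= 1 / 8 by lra.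
have m_ge : eta * n / 2 <= m%:R.
  by move: en m_gt; rewrite ler_pdivrMr // -[m.+1%:R]natr1; lra.
have en0 : 0 < eta * n by rewrite mulr_gt0.
have m0 : 0 < m%:R :> R by apply: lt_le_trans m_ge; rewrite divr_gt0.
have -> : 1 / 8 = 8^-1 :> R by rewrite mul1r.
have pow : expR (- (2 * M * d * (eta * n))) <= (1 - p0) ^+ m.
  rewrite -[1 - p0](lnK p1) -expRM_natl ler_expR.
  have l1 : - (2 * (M * d)) <= ln (1 - p0).
    apply: le_trans (ln1B_ge (x := p0) _); last by apply/andP; lra.
    have : p0 ^+ 2 <= 2^-1 * p0 by rewrite expr2 ler_pM2r //; lra.
    lra.
  apply: le_trans (_ : m%:R * (- (2 * (M * d))) <= _); last by rewrite ler_pM2l.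
  rewrite mulrN lerN2.
  have : m%:R * (2 * (M * d)) <= eta * n * (2 * (M * d)).
    by rewrite ler_pM2r // !mulr_gt0.
  lra.
have expo := exponent_bound n0 J0 e10 L0 (ltW d0) dJ small.
rewrite lef_pV2 ?posrE //; last first.
  by rewrite mulr_gt0 // mulr_gt0 ?exprn_gt0 // mulr_gt0 ?expR_gt0.
apply: le_trans (_ : eta * n / 2 * (expR (- (2 * M * d * (eta * n))) *
   (2^-1 * expR (- (d * n * (J + 2 * e2) + B)))) <= _); last first.
  apply: ler_pM => //; first by rewrite divr_ge0 // ltW.
  by rewrite ler_wpM2r // mulr_ge0 ?expR_ge0.
have -> : eta * n / 2 * (expR (- (2 * M * d * (eta * n))) *
   (2^-1 * expR (- (d * n * (J + 2 * e2) + B)))) =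
   eta / 4 * (expR (ln n) * expR (- (2 * M * d * (eta * n))) * expR (- (d * n * (J + 2 * e2) + B))).
  by rewrite lnK ?posrE //; field.
rewrite -!expRD mulrC -ler_pdivrMr ?divr_gt0 //.
have -> : 8 / (eta / 4) = expR (ln (32 / eta)).
  by rewrite lnK ?posrE ?divr_gt0 //; field; rewrite gt_eqF.
rewrite ler_expR; move: LS; rewrite ler_pdivrMr ?divr_gt0 //; lra.
Qed.

Lemma count_ge (k c n pm eta : R) : 0 <= n -> `|k - c * n| < eta * n -> pm <= c -> eta <= pm / 2 ->
  pm / 2 * n <= k.
Proof.
move=> n0; rewrite ltr_norml => /andP[H _] pc ep.
have e : pm / 2 <= c - eta by lra.
have := ler_wpM2r n0 e; lra.
Qed.

Lemma tilt_attained (L : finType) (pi : L -> R) (A : L -> L -> R) (x y c0 : L) (M Ml : R) :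
  (forall c, 0 < pi c) -> (forall u v, 0 < A u v) -> A x c0 != A y c0 ->
  (forall u v, A u v <= M) -> (forall u v, `|ln (A u v)| <= Ml) ->
  exists2 e0, 0 < e0 & forall e, 0 < e <= e0 -> exists r : L -> R,
    [/\ forall c, 0 < r c <= M, forall c, `|ln (r c)| <= Ml,
        \sum_c pi c * (r c * (ln (A y c) - ln (A x c)) - (A y c - A x c)) = e &
        \sum_c pi c * (r c * (ln (r c) - ln (A x c)) - (r c - A x c)) <= poisson_CH pi A x y + e].
Proof.
move=> pi0 A0 ne AM lA; have [e0 e00 slopeP] := poisson_CH_slope_attained pi0 A0 ne.
exists e0 => // e e0e; have [sp sp01 spE] := slopeP e e0e.
have /andP[sp0 sp1] := sp01; have /andP[ep _] := e0e.
have s1' : 0 <= 1 - sp by rewrite subr_ge0 ltW.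
exists (fun c => tilt A sp x y c); split => // [c|c|].
- rewrite /tilt geo_mean_gt0 /=; apply: le_trans (geo_mean_le _ _ _) _ => //.
    by rewrite (ltW sp0) (ltW sp1).
  have := ler_wpM2l (ltW sp0) (AM x c); have := ler_wpM2l s1' (AM y c); lra.
- rewrite /tilt ln_geo_mean; apply: le_trans (ler_normD _ _) _.
  rewrite !normrM (ger0_norm (ltW sp0)) (ger0_norm s1').
  have := ler_wpM2l (ltW sp0) (lA x c); have := ler_wpM2l s1' (lA y c); lra.
- rewrite (tilt_divergence pi A sp x y) spE lerD ?poisson_CH_at_le //.
  by rewrite ler_piMl ?(ltW ep) // gerBl ltW.
Qed.

End ImpossibilityEstimates.

Section ImpossibilityLimit.
Variables (R : realType) (t : btree) (pi : leaf t -> R) (a : node t -> R) (delta : nat -> R) (q : nat).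
Hypothesis pi_gt0 : forall c, 0 < pi c.
Hypothesis pi_sum1 : \sum_c pi c = 1.
Hypothesis a_gt0 : forall u, 0 < a u.
Hypothesis a_child : forall u v, child u v -> a u < a v.
Hypothesis delta_gt0 : forall N, (0 < N)%N -> 0 < delta N.
Hypothesis p01 : forall N, (0 < N)%N -> forall u, 0 <= a u * delta N <= 1.

Local Notation rate := (rate a).
Local Notation p N := (fun u => a u * delta N).

Lemma impossibility (x y : leaf t) (e1 : R) : ~~ same_super q x y -> 0 < e1 ->
  (\forall N \near \oo, N%:R * delta N * poisson_CH pi rate x y <= (1 - e1) * ln N%:R) ->
  exists2 c : R, 0 < c & forall est : estimator t q, \forall N \near \oo,
    c <= joint_prob pi (p N) (fun s g => loss s (est N g) != 0%N).
Proof.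
move=> nxy e10 HJ.
have xy : x != y by apply: contraNneq nxy => ->; exact: same_super_refl.
have rate_gt0 u v : 0 < rate u v by exact: a_gt0.
have ne : rate x x != rate y x.
  by rewrite gt_eqF // (rateC a y x) (rate_lt a_child).
set J := poisson_CH pi rate x y in HJ.
have J0 : 0 < J by exact: poisson_CH_gt0 ne.
have [pm pm0 pmP] := @fin_pos_lb R (leaf t) predT pi (fun c _ => pi_gt0 c).
have [M M0 MP] := @fin_ub R _ (fun xy : leaf t * leaf t => rate xy.1 xy.2).
have [Ml Ml0 MlP] := @fin_ub R _ (fun xy : leaf t * leaf t => `|ln (rate xy.1 xy.2)|).
have rate_leM u v : rate u v <= M by exact: (MP (u, v)).
have ln_rate_le u v : `|ln (rate u v)| <= Ml by exact: (MlP (u, v)).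
have [e0 e00 tiltP] := tilt_attained pi_gt0 rate_gt0 ne rate_leM ln_rate_le.
set K := #|{: leaf t}|.
(* The slope must be attainable, and [2 * e2] may use at most half of the allowance [J * e1 / 2];
   the other half goes to isolation inside [W]. *)
pose e2 := Order.min e0 (J * e1 / 8).
have Je1 : 0 < J * e1 by rewrite mulr_gt0.
have e20 : 0 < e2 by rewrite lt_min e00 divr_gt0.
have e2e0 : e2 <= e0 by rewrite ge_min lexx.
have e2J : e2 <= J * e1 / 8 by rewrite ge_min lexx orbT.
have [r [r_M ln_r_le slope div_le]] : exists r : leaf t -> R,
    [/\ forall c, 0 < r c <= M, forall c, `|ln (r c)| <= Ml,
        \sum_c pi c * (r c * (ln (rate y c) - ln (rate x c)) - (rate y c - rate x c)) = e2 &
        \sum_c pi c * (r c * (ln (r c) - ln (rate x c)) - (r c - rate x c)) <= J + e2].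
  by apply: tiltP; rewrite e20.
set rg := tilt_range M Ml.
have rg0 : 0 < rg by rewrite /rg /tilt_range addr_gt0 ?mulr_gt0.
have K0 : 0 < K%:R + 1 :> R by rewrite ltr_wpDl.
(* The three bounds keep every community of linear size, pay for isolation inside [W], and keep the
   sampling error of the tilted means below [e2 / 4]. *)
pose eta := Order.min (pm / 2) (Order.min (J * e1 / (8 * M)) (e2 / (4 * ((K%:R + 1) * rg)))).
have q1 : 0 < 8 * M by rewrite mulr_gt0.
have q2 : 0 < 4 * ((K%:R + 1) * rg) by rewrite mulr_gt0 // mulr_gt0.
have eta0 : 0 < eta by rewrite !lt_min !divr_gt0.
have eta1 : eta <= pm / 2 by rewrite ge_min lexx.
have eta2 : 2 * e2 + 2 * M * eta <= J * e1 / 2.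
  have : eta <= J * e1 / (8 * M) by rewrite !ge_min lexx ?orbT.
  by rewrite ler_pdivlMr //; lra.
have eta3 : (K%:R + 1) * eta * rg <= e2 / 4.
  have : eta <= e2 / (4 * ((K%:R + 1) * rg)) by rewrite !ge_min lexx ?orbT.
  by rewrite ler_pdivlMr //; lra.
set B := slack M Ml e2.
pose kap := pi y * expR (- B).
have kap0 : 0 < kap by rewrite mulr_gt0 ?expR_gt0.
have c0 : 0 < 1 + kap^-1 by rewrite addr_gt0 ?invr_gt0.
(* One quarter is for atypical assignments, one for the absence of a confusable vertex. *)
exists ((1 - (1 / 4 + 1 / 4)) / (1 + kap^-1)); first by rewrite divr_gt0 //; lra.
have pi_le1 c : pi c <= 1.
  by rewrite -pi_sum1 (bigD1 c) //= lerDl sumr_ge0 // => c' _; exact: ltW.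
move=> est; near=> N.
have N0 : (0 < N)%N by near: N; exact: nbhs_infty_gt.
have N0' : 0 < N%:R :> R by rewrite ltr0n.
have L0 : 0 <= ln N%:R :> R by near: N; exact: near_le_ln.
have dJ : N%:R * delta N * J <= (1 - e1) * ln N%:R by near: N.
have LN : (16 * M + 16 * M ^+ 2 / e2) / J * ln N%:R <= N%:R by near: N; exact: near_ln_small.
have eN : 2 / eta <= N%:R by near: N; exact: near_le_nat.
have pN : 2 / (pm / 2) <= N%:R by near: N; exact: near_le_nat.
have LS : (ln (32 / eta) + B) / (e1 / 2) <= ln N%:R by near: N; exact: near_le_ln.
have typ : prob (fun=> pi) (predC (@typical R (leaf t) pi N eta)) <= 1 / 4.
  by near: N; apply: near_typical => // c; exact: ltW.
have d0 := delta_gt0 N0; set d := delta N in d0 dJ *.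
have [Md Md2] := density_small N0' d0 J0 e10 e20 M0 L0 dJ LN.
have Md3 : M * d <= 2^-1 by apply: le_trans Md _; rewrite lef_pV2 ?posrE // ler_nat.
have small : (K%:R + 1) * eta * rg + 4 * M ^+ 2 * d <= e2 / 2.
  by rewrite (_ : e2 / 2 = e2 / 4 + e2 / 4); [exact: lerD|field].
rewrite ler_pdivrMr // [X in _ <= X]mulrC.
apply: (impossible_of_confusable pi_gt0 (fun _ => p01 N0) (est N) nxy kap0 pi_sum1).
have q14 : 0 <= 1 / 4 :> R by rewrite divr_ge0.
apply: le_trans (joint_prob_cond (fun c => ltW (pi_gt0 c)) pi_sum1 (fun _ => p01 N0)
   (typ := @typical R (leaf t) pi N eta) q14 _) _; last by rewrite lerD2r.
move=> s styp; have /forallP styp' := styp.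
have cnt c : pm / 2 * N%:R <= #|[set j | s j == c]%SET|%:R.
  exact: count_ge (ltW N0') (styp' c) (pmP c isT) eta1.
pose m := Num.truncn (eta * N%:R).
have etaN : 0 <= eta * N%:R by rewrite mulr_ge0 // ltW.
have m_le : m%:R <= eta * N%:R by rewrite truncn_le.
have m_gt : eta * N%:R < m.+1%:R by exact: truncnS_gt.
have m0 : (0 < m)%N.
  rewrite truncn_gt0; move: eN; rewrite ler_pdivrMr // mulrC; apply: le_trans.
  by rewrite ler1n.
have m_card : (m <= #|[set j | s j == x]%SET|)%N.
  rewrite -(ler_nat R); apply: le_trans m_le _; apply: le_trans (cnt x).
  by rewrite ler_pM2r.
have two_y : two_in_y y s.
  rewrite /two_in_y -(ler_nat R); apply: le_trans (cnt y).
  by move: pN; rewrite ler_pdivrMr ?divr_gt0 // mulrC.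
apply: le_trans (confusable_prob pi_gt0 pi_le1 a_gt0 a_child d0 (p01 N0) Md3 rate_leM ln_rate_le xy
   styp m_le m0 m_card two_y r_M ln_r_le e20 slope div_le small) _.
apply: second_moment_small dJ eta2 LS eN Md _ _ => //.
  by rewrite mulr_gt0 ?rate_gt0 //= ler_pM2r ?rate_leM.
by rewrite m_le.
Unshelve. all: by end_near. Qed.

End ImpossibilityLimit.

(** * Almost sure recovery *)

Lemma uniform_prob_itv (R : realType) (b c : bool) (u v : R) : 0 <= u -> u <= v -> v <= 1 ->
  uniform_prob (@ltr01 R) [set` Interval (BSide b u) (BSide c v)] = (v - u)%:E.
Proof.
move=> u0 uv v1; rewrite /uniform_prob integral_uniform_pdf.
have sub w : w \in Interval (BSide b u) (BSide c v) -> 0 <= w <= 1.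
  rewrite in_itv /= => /andP[/lteifW uw /lteifW wv].
  by rewrite (le_trans u0 uw) (le_trans wv v1).
rewrite setIidl; last by move=> w /= /sub; rewrite in_itv.
rewrite (eq_integral (fun=> 1%:E)); last first.
  by move=> w; rewrite inE /= => /sub w01; rewrite /uniform_pdf w01 subr0 invr1.
rewrite integral_cst //= mul1e lebesgue_measure_itv /= lte_fin.
by case: ltgtP uv => // -> _; rewrite subrr.
Qed.

Section FiniteValued.
Variables (R : realType) (Z : finType) (f : Z -> R).

Section Event.
Variables (d : measure_display) (T : measurableType d) (P : probability T R) (X : T -> Z).
Hypothesis XP : forall z, measurable [set w | X w = z] /\ P [set w | X w = z] = (f z)%:E.

Lemma law_event (Q : pred Z) :
  measurable [set w | Q (X w)] /\ P [set w | Q (X w)] = (\sum_(z | Q z) f z)%:E.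
Proof.
pose E z := [set w | X w = z].
have -> : [set w | Q (X w)] = \big[setU/set0]_(z <- index_enum Z | Q z) E z.
  rewrite -bigcup_seq_cond; apply/seteqP; split => [w Qw|w [z /= /andP[_ Qz] Ew]]; last by rewrite /= Ew.
  by exists (X w) => //=; rewrite mem_index_enum.
have : uniq (index_enum Z) by exact: index_enum_uniq.
elim: (index_enum Z) => [|z r IH /= /andP[zr /IH[mE PE]]].
  by rewrite !big_nil measure0.
rewrite !big_cons; case: ifP => Qz //; split; first by apply: measurableU => //; exact: (XP z).1.
rewrite measureU //; last 2 first.
- exact: (XP z).1.
- apply/seteqP; split => // w [/= Xz]; rewrite -bigcup_seq_cond => -[z' /= /andP[z'r _] Xz'].
  by move: zr; rewrite -Xz Xz' z'r.
by rewrite EFinD; congr (_ + _)%E; [exact: (XP z).2|exact: PE].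
Qed.

End Event.

Hypothesis f_ge0 : forall z, 0 <= f z.
Hypothesis f_sum1 : \sum_z f z = 1.
Variable bad : pred Z.

(* The outcomes z are laid out on [0, 1[ as consecutive intervals of length f z,
   the bad ones first. *)
Let zs := [seq z <- index_enum Z | bad z] ++ [seq z <- index_enum Z | ~~ bad z].

Let mem_zs z : z \in zs.
Proof. by rewrite /zs mem_cat !mem_filter !mem_index_enum !andbT orbN. Qed.

Let uniq_zs : uniq zs.
Proof.
rewrite /zs cat_uniq !filter_uniq ?index_enum_uniq //= andbT; apply/hasPn => z.
by rewrite !mem_filter => /andP[/negbTE ->].
Qed.

Let cum k := \sum_(z <- take k zs) f z.

Let cum_mono k l : (k <= l)%N -> cum k <= cum l.
Proof.
move=> kl; rewrite /cum -(take_takel zs kl).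
by rewrite -[in leRHS](cat_take_drop k (take l zs)) big_cat lerDl sumr_ge0.
Qed.

Let cum_size : cum (size zs) = 1.
Proof.
rewrite /cum take_size -f_sum1; have pe : perm_eq zs (index_enum Z).
  apply: uniq_perm; [exact: uniq_zs|exact: index_enum_uniq|].
  by move=> z; rewrite mem_zs mem_index_enum.
by rewrite (perm_big _ pe).
Qed.

Let cumS z : cum (index z zs).+1 = cum (index z zs) + f z.
Proof.
by rewrite /cum (take_nth z) ?index_mem ?mem_zs // -cats1 big_cat big_seq1 nth_index ?mem_zs.
Qed.

Let slot z := `[cum (index z zs), cum (index z zs).+1[%classic.

Let slot_uniq z z' w : slot z w -> slot z' w -> z = z'.
Proof.
rewrite /slot /= !in_itv /= => /andP[a1 b1] /andP[a2 b2].
case: (ltngtP (index z zs) (index z' zs)) => [lt|lt|eq].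
- by have := lt_le_trans b1 (le_trans (cum_mono lt) a2); rewrite ltxx.
- by have := lt_le_trans b2 (le_trans (cum_mono lt) a1); rewrite ltxx.
- by rewrite -(nth_index z (mem_zs z)) eq nth_index ?mem_zs.
Qed.

Let slot_cover w : 0 <= w < 1 -> exists z, slot z w.
Proof.
move=> /andP[w0 w1].
have ex : exists k, w < cum k by exists (size zs); rewrite cum_size.
have [k wk kmin] := ex_minnP ex.
case: k => [|k] in wk kmin; first by move: wk; rewrite /cum take0 big_nil ltNge w0.
have ck : cum k <= w by rewrite leNgt; apply/negP => /kmin; rewrite ltnn.
have ks : (k < size zs)%N.
  rewrite ltnNge; apply/negP => sk; move: wk.
  by rewrite /cum take_oversize ?leqW // -(take_oversize sk) ltNge ck.
have [z0 _] : exists z0, z0 \in zs by move: ks; case: zs => // z0 r _; exists z0; rewrite mem_head.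
exists (nth z0 zs k); rewrite /slot /= index_uniq ?uniq_zs //= in_itv /= ck.
exact: wk.
Qed.

Lemma coupling_exists : exists X : R -> Z,
  (forall z, measurable [set w | X w = z] /\
     uniform_prob (@ltr01 R) [set w | X w = z] = (f z)%:E) /\
  forall w, \sum_(z | bad z) f z <= w < 1 -> ~~ bad (X w).
Proof.
pose U := uniform_prob (@ltr01 R).
have [z0 _] : exists z0 : Z, true.
  case: (pickP (@predT Z)) => [z _|none]; first by exists z.
  by move: f_sum1; rewrite big_pred0 // => /esym/eqP; rewrite oner_eq0.
pose X w := odflt z0 [pick z | `[< slot z w >]].
have XE z w : slot z w -> X w = z.
  move=> zw; rewrite /X; case: pickP => [z' /asboolP z'w|/(_ z)]; first exact: slot_uniq z'w zw.
  by move=> /asboolP.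
have m_slot z : measurable (slot z) by exact: measurable_itv.
(* No slot meets the complement of [[0, 1[]; there [X] defaults to [z0], whose preimage acquires
   this null set. *)
have XE' z : [set w | X w = z] = slot z `|` (if z == z0 then ~` (\bigcup_(z' in [set: Z]) slot z') else set0).
  apply/seteqP; split => [w /= Xw|w [/XE //|]].
    case: (pickP (fun z' => `[< slot z' w >])) => [z' /asboolP z'w|none].
      by left; rewrite -Xw (XE _ _ z'w).
    right; move: Xw; rewrite /X; case: pickP => [z' Hz'|_ /= <-]; first by rewrite none in Hz'.
    by rewrite eqxx => -[z' _ /asboolP]; rewrite none.
  case: eqP => [->|_ []] // no; rewrite /= /X; case: pickP => // z' /asboolP z'w.
  by case: no; exists z'.
have mX z : measurable [set w | X w = z].
  rewrite XE'; apply: measurableU => //; case: ifP => _ //; apply: measurableC.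
  by apply: fin_bigcup_measurable.
have cum0 : cum 0 = 0 by rewrite /cum take0 big_nil.
have U_slot z : U (slot z) = (f z)%:E.
  rewrite /U /slot uniform_prob_itv ?cum_mono //; first by rewrite cumS addrC addKr.
    by rewrite -cum0 cum_mono.
  by rewrite -cum_size cum_mono // index_mem mem_zs.
have U01 : U (~` `[0, 1[%classic) = 0%E.
  have := @probability_setC _ _ _ U `[0, 1[%classic (measurable_itv _).
  by rewrite [X in (1 - X)%E](uniform_prob_itv _ _ (lexx 0) ler01 (lexx 1)) // subr0 subee.
exists X; split=> [z|w /andP[ew w1]]; last first.
  have e0 : 0 <= \sum_(z | bad z) f z by apply: sumr_ge0.
  have [z zw] := slot_cover (introT andP (conj (le_trans e0 ew) w1)).
  rewrite (XE _ _ zw); apply/negP => bz.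
  have : w < cum (index z zs).+1 by move: zw; rewrite /slot /= in_itv /= => /andP[].
  apply/negP; rewrite -leNgt; apply: le_trans ew.
  have iz : (index z zs < size [seq z <- index_enum Z | bad z])%N.
    by rewrite /zs index_cat mem_filter bz mem_index_enum index_mem mem_filter bz mem_index_enum.
  by apply: le_trans (cum_mono iz) _; rewrite /cum take_size_cat // big_filter.
split => //; apply/eqP; rewrite eq_le; apply/andP; split; last first.
  rewrite -(U_slot z); apply: le_measure; [apply: mem_set; exact: m_slot|apply: mem_set; exact: mX|].
  by move=> w zw; exact: XE.
rewrite -(U_slot z) -[X in (_ <= X)%E]adde0 -U01.
have mC : measurable (~` `[0, 1[%classic : set R) by apply: measurableC; exact: measurable_itv.
apply: (@le_trans _ _ (U (slot z `|` ~` `[0, 1[%classic))).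
  apply: le_measure.
  - apply: mem_set; exact: mX.
  - apply: mem_set; exact: (measurableU _ _ (m_slot z) mC).
  move=> w /= Xw; case: (boolP (0 <= w < 1)) => [/slot_cover[z' z'w]|w01].
    by left; rewrite -Xw (XE _ _ z'w).
  by right => /=; rewrite in_itv /=; apply/negP.
exact: (@measureU2 _ _ _ (uniform_prob (@ltr01 R)) _ _ (m_slot z) mC).
Qed.

End FiniteValued.

Section Recovery.
Variables (R : realType) (t : btree) (pi : leaf t -> R) (p : nat -> node t -> R) (q : nat).
Hypothesis pi_ge0 : forall c, 0 <= pi c.
Hypothesis pi_sum1 : \sum_c pi c = 1.
Hypothesis p01 : forall N, (0 < N)%N -> forall u, 0 <= p N u <= 1.
Variable est : estimator t q.

Definition failure_prob N : R := joint_prob pi (p N) (fun s g => loss s (est N g) != 0%N).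

Let Z N : finType := (assignment t N * graph N)%type.
Let f N (z : Z N) := hsbm_pmf pi (p N) z.1 z.2.
Let bad N (z : Z N) := loss z.1 (est N z.2) != 0%N.

Let failure_probE N : failure_prob N = \sum_(z : Z N | bad z) f z.
Proof. by rewrite /failure_prob joint_prob_pair. Qed.

Lemma exact_recovery_of_failure_prob :
  (forall e, 0 < e -> \forall N \near \oo, failure_prob N <= e) ->
  exact_recovery pi p est.
Proof.
move=> H.
have f0 N (z : Z N) : 0 <= f z by apply: hsbm_pmf_ge0 => //; exact: p01.
have f1 N : \sum_(z : Z N) f z = 1.
  have := joint_prob_total (p N) N pi_sum1; rewrite joint_prob_pair => <-.
  by apply: eq_bigl.
have H' N := cid (coupling_exists (f0 N) (f1 N) (@bad N)).
pose X N := projT1 (H' N).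
exists _, _, (uniform_prob (@ltr01 R)), (fun N w => (X N w).1), (fun N w => (X N w).2); split.
  move=> N s g; have [/(_ (s, g)) [mX PX] _] := projT2 (H' N).
  have -> : [set w | (X N w).1 = s /\ (X N w).2 = g] = [set w | X N w = (s, g)].
    by apply/seteqP; split => w /=; case: (X N w) => s' g' /= [] -> ->.
  by [].
have E01 : uniform_prob (@ltr01 R) (~` `]0, 1[) = 0%E.
  have := @probability_setC _ _ _ (uniform_prob (@ltr01 R)) `]0, 1[ (measurable_itv _).
  by rewrite [X in (1 - X)%E](uniform_prob_itv _ _ (lexx 0) ler01 (lexx 1)) subr0 subee.
exists (~` `]0, 1[); split=> //; first by apply: measurableC; exact: measurable_itv.
apply: subsetC => w /=; rewrite in_itv /= => /andP[w0 w1].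
(* The tolerance is the point itself: once the failure probability is at most [w], the initial
   interval of failures ends before reaching [w]. *)
apply: cvg_near_cst; apply: filterS (H _ w0) => N; rewrite failure_probE => Nw.
have [_ /(_ w)] := projT2 (H' N).
by rewrite Nw w1 => /(_ isT); rewrite negbK => /eqP ->.
Qed.

Lemma failure_prob_of_exact_recovery : exact_recovery pi p est ->
  forall c, 0 < c -> ~ \forall N \near \oo, c <= failure_prob N.
Proof.
move=> [d [T [P [S [G [law ae]]]]]] c c0 Hc.
pose X N w : Z N := (S N w, G N w).
have XP N (z : Z N) : measurable [set w | X N w = z] /\ P [set w | X N w = z] = (f z)%:E.
  have -> : [set w | X N w = z] = [set w | S N w = z.1 /\ G N w = z.2].
    by apply/seteqP; split => w /=; case: z => s g /=; rewrite /X; [case=> -> ->|case=> -> ->].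
  exact: law.
pose A N := [set w | bad (X N w)].
have mA N : measurable (A N) by exact: (law_event (XP N) _).1.
have PA N : P (A N) = (failure_prob N)%:E by rewrite failure_probE; exact: (law_event (XP N) _).2.
have lim : P (\bigcup_(k >= n) A k) @[n --> \oo] --> P (lim_sup_set A).
  apply: lim_sup_set_cvg => //; apply: le_lt_trans (probability_le1 _ _) (ltry _).
  exact: bigcup_measurable.
have lim0 : P (lim_sup_set A) = 0%E.
  apply: measure_negligible.
    by apply: bigcapT_measurable => n; exact: bigcup_measurable.
  apply: negligibleS ae => w io /= /cvgrPdist_lt /(_ _ ltr01) [n _ small].
  have [k /= nk] := io n I.
  (* The loss is a natural number, so being less than 1 means being 0, against the infinitely many
     failures at [w]. *)
  have := small _ nk; rewrite /= sub0r normrN normr_nat -[1]/(1%:R) ltr_nat /A /= /bad.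
  by rewrite ltnS leqn0 => /eqP ->.
have : (c%:E <= P (lim_sup_set A))%E.
  apply: (cvge_to_ge lim); apply: filterS Hc => N cN.
  apply: le_trans (_ : P (A N) <= _)%E; first by rewrite PA lee_fin.
  apply: le_measure.
  - apply: mem_set; exact: mA.
  - by apply: mem_set; exact: bigcup_measurable.
  - by move=> w Aw; exists N => /=.
by rewrite lim0 lee_fin leNgt c0.
Qed.

End Recovery.

(** * The thresholds *)

Section LimitSuperior.
Variable R : realType.
Implicit Types (u : (\bar R)^nat).

Lemma limn_esup_lt_near u (c : R) : (limn_esup u < c%:E)%E ->
  exists2 e, 0 < e & \forall N \near \oo, (u N <= (c - e)%:E)%E.
Proof.
rewrite /limn_esup /limf_esup => /ereal_inf_lt[_ [V Voo <-]] sup_lt.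
have [e e0 le] : exists2 e, 0 < e & (ereal_sup (u @` V) <= (c - e)%:E)%E.
  move: sup_lt; case: (ereal_sup _) => [r|//|_]; last by exists 1 => //; rewrite leNye.
  by rewrite lte_fin => rc; exists (c - r); rewrite ?subr_gt0 // subKr.
exists e => //; apply: filterS Voo => N VN; apply: le_trans le.
by apply: ereal_sup_ubound; exists N.
Qed.

Lemma limn_einf_gt_near u (c : R) : (c%:E < limn_einf u)%E ->
  exists2 e, 0 < e & \forall N \near \oo, ((c + e)%:E <= u N)%E.
Proof.
rewrite /limn_einf lteNr -EFinN => /limn_esup_lt_near[e e0 H]; exists e => //.
by apply: filterS H => N; rewrite leeNl -EFinN opprD !opprK.
Qed.

End LimitSuperior.

Section MinCH.
Variables (R : realType) (t : btree) (pi : leaf t -> R) (a : node t -> R) (q : nat).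
Hypothesis pi_gt0 : forall c, 0 < pi c.
Hypothesis a_gt0 : forall u, 0 < a u.
Hypothesis q_range : (1 <= q <= tree_depth t)%N.
Variable d : R.
Hypothesis d_gt0 : 0 < d.
Hypothesis ad_le1 : forall u, a u * d <= 1.
Implicit Types x y : leaf t.

Let r_gt0 x y : 0 < rate a x y. Proof. exact: a_gt0. Qed.

Let CH_at s x y := \sum_c pi c * - ln (renyi_sum s (rate a x c * d) (rate a y c * d)).

Let CH_E x y :
  CH pi (fun u => a u * d) x y = sup [set CH_at s x y | s in [set s | 0 < s < 1]].
Proof.
rewrite /CH; congr sup; apply: eq_imagel => s /= /andP[s0 s1].
rewrite /CH_at big_distrr; apply: eq_bigr => c _ /=.
rewrite mulrCA; congr (_ * _); rewrite /renyi_bernoulli mulrA.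
have s1' : s - 1 != 0 by rewrite subr_eq0 lt_eqF.
have -> : (1 - s) / (s - 1) = -1 by rewrite -(opprB s 1) mulNr divff.
exact: mulN1r.
Qed.

(** Discarding the non-edge term gives a bound uniform in [s], so the supremum in [CH] is finite
    even when an edge probability equals 1. *)
Lemma renyi_sum_ge (s x y : R) : 0 < s < 1 -> 0 < x <= 1 -> 0 < y <= 1 ->
  - ln (renyi_sum s x y) <= - ln x - ln y.
Proof.
move=> /andP[s0 s1] /andP[x0 x1] /andP[y0 y1].
have lx : ln x <= 0 by apply: ln_le0.
have ly : ln y <= 0 by apply: ln_le0.
have g : 0 < x `^ s * y `^ (1 - s) by rewrite mulr_gt0 ?powR_gt0.
have ge : x `^ s * y `^ (1 - s) <= renyi_sum s x y by rewrite lerDr mulr_ge0 ?powR_ge0.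
have : ln (x `^ s * y `^ (1 - s)) <= ln (renyi_sum s x y).
  by rewrite ler_ln ?posrE //; exact: lt_le_trans ge.
rewrite lnM ?posrE ?powR_gt0 // !ln_powR => H.
have h1 : ln x <= s * ln x by rewrite -subr_ge0 -{2}[ln x]mul1r -mulrBl mulr_le0 // subr_le0 ltW.
have h2 : ln y <= (1 - s) * ln y.
  by rewrite -subr_ge0 -{2}[ln y]mul1r -mulrBl mulr_le0 // subr_le0; lra.
lra.
Qed.

Let CH_has_sup x y : has_sup [set CH_at s x y | s in [set s | 0 < s < 1]].
Proof.
split; first by exists (CH_at 2^-1 x y); exists 2^-1 => //=; apply/andP; lra.
exists (\sum_c pi c * (- ln (rate a x c * d) - ln (rate a y c * d))) => _ [s /= s01 <-].
apply: ler_sum => c _; rewrite ler_wpM2l ?(ltW (pi_gt0 _)) //.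
by apply: renyi_sum_ge => //; rewrite mulr_gt0 ?a_gt0 ?ad_le1.
Qed.

Lemma poisson_CH_le_CH x y : d * poisson_CH pi (rate a) x y <= CH pi (fun u => a u * d) x y.
Proof.
rewrite CH_E -ler_pdivlMl //; apply: ge_sup; first exact: (poisson_CH_has_sup pi_gt0 r_gt0 _ _).1.
move=> _ [s /= s01 <-]; rewrite ler_pdivlMl //.
apply: le_trans (_ : CH_at s x y <= _); last first.
  by apply: (sup_upper_bound (CH_has_sup x y)); exists s.
rewrite /poisson_CH_at big_distrr; apply: ler_sum => c _ /=.
by rewrite mulrCA ler_wpM2l ?(ltW (pi_gt0 _)) // poisson_div_le_renyi ?a_gt0 ?ad_le1.
Qed.

Lemma CH_le_poisson_CH x y (M : R) : (forall u, a u <= M) -> 8 * M * d <= 1 -> \sum_c pi c = 1 ->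
  CH pi (fun u => a u * d) x y <= d * poisson_CH pi (rate a) x y + 22 * (M * d) ^+ 2.
Proof.
move=> aM Md sum1; rewrite CH_E; apply: ge_sup; first exact: (CH_has_sup _ _).1.
move=> _ [s /= s01 <-].
apply: le_trans (_ : d * poisson_CH_at pi (rate a) s x y + 22 * (M * d) ^+ 2 <= _); last first.
  by rewrite lerD2r ler_pM2l // (poisson_CH_at_le pi_gt0 r_gt0).
have -> : 22 * (M * d) ^+ 2 = \sum_c pi c * (22 * (M * d) ^+ 2) by rewrite -big_distrl /= sum1 mul1r.
rewrite /poisson_CH_at big_distrr -big_split.
apply: ler_sum => c _ /=; rewrite [d * _]mulrCA -mulrDr ler_wpM2l ?(ltW (pi_gt0 _)) //.
by apply: renyi_le_poisson_div; rewrite ?a_gt0 ?aM.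
Qed.

Lemma poisson_CH_minimiser : exists x y, ~~ same_super q x y /\
  forall x' y', ~~ same_super q x' y' ->
    poisson_CH pi (rate a) x y <= poisson_CH pi (rate a) x' y'.
Proof.
have [x0 [y0 xy0]] := exists_split_pair q_range.
pose P (z : leaf t * leaf t) := ~~ same_super q z.1 z.2.
case: (@Order.TotalTheory.arg_minP _ _ _ (x0, y0) P (fun z => poisson_CH pi (rate a) z.1 z.2) xy0) => -[x y] /= xy H.
exists x, y; split=> [|x' y' xy']; [exact: xy|exact: (H (x', y') xy')].
Qed.

Lemma min_CH_ge (J : R) :
  (forall x y, ~~ same_super q x y -> J <= poisson_CH pi (rate a) x y) ->
  ((d * J)%:E <= min_CH pi (fun u => (a u * d)%R) q)%E.
Proof.
move=> HJ; apply: le_bigmin => [|[x y] /=]; first exact: leey.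
rewrite split_pairE ?(andP q_range).1 // => /HJ xyJ; rewrite lee_fin.
by apply: le_trans (poisson_CH_le_CH x y); rewrite ler_pM2l.
Qed.

Lemma min_CH_le x y : ~~ same_super q x y ->
  (min_CH pi (fun u => (a u * d)%R) q <= (CH pi (fun u => (a u * d)%R) x y)%:E)%E.
Proof.
move=> xy; apply: (@bigmin_inf _ _ _ _ (x, y)) => //=.
by rewrite split_pairE ?(andP q_range).1.
Qed.

End MinCH.

Lemma exists_child (t : btree) q : (1 <= q <= tree_depth t)%N -> exists u v : node t, child u v.
Proof.
move=> /andP[q1 qd]; have {q1 qd} : (0 < tree_depth t)%N by exact: leq_trans q1 qd.
case: t => [|l r] d0.
  suff : (tree_depth Leaf <= 0)%N by rewrite leqNgt d0.
  by apply/bigmax_leqP => u _; rewrite /level; have := valP u; rewrite inE => /eqP ->.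
have vP : [:: false] \in addresses (Node l r).
  rewrite /= inE mem_cat; apply/orP; right; apply/orP; left.
  by apply: map_f; exact: tree_root_subproof.
exists (tree_root (Node l r)), (SeqSub vP); apply/existsP; exists false.
exact: eqxx.
Qed.

(** The allowed error [J * e / (2 + e)] is such that [1 + e / (2 + e) = (1 + e) / (1 + e / 2)]: it
    consumes half of the margin. *)
Lemma threshold_slack (R : realType) (e L N d J M : R) : 0 < e -> 0 <= N -> 0 < d ->
  22 * M ^+ 2 * d <= J * e / (2 + e) -> (1 + e) * L <= N * (d * J + 22 * (M * d) ^+ 2) ->
  (1 + e / 2) * L <= N * d * J.
Proof.
move=> e0 N0 d0 Md HL.
have H : N * (d * J + 22 * (M * d) ^+ 2) <= N * (d * J + d * (J * e / (2 + e))).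
  rewrite ler_wpM2l // lerD2l (_ : 22 * (M * d) ^+ 2 = d * (22 * M ^+ 2 * d)); last by ring.
  by rewrite ler_pM2l.
have e2 : 2 + e != 0 by rewrite gt_eqF // addr_gt0.
have E : N * (d * J + d * (J * e / (2 + e))) = N * d * J * ((1 + e) / (1 + e / 2)).
  have e3 : 1 + e / 2 != 0 by rewrite gt_eqF // addr_gt0 // divr_gt0.
  by field; rewrite e2.
have := le_trans HL (le_trans H _); rewrite E => /(_ _ (lexx _)).
rewrite mulrA ler_pdivlMr; last by rewrite addr_gt0 // divr_gt0.
by rewrite mulrAC [_ * (1 + e)]mulrC -mulrA ler_pM2l // ?addr_gt0 // mulrC.
Qed.

Section Thresholds.
Variables (R : realType) (t : btree) (pi : leaf t -> R) (a : node t -> R) (delta : nat -> R) (q : nat).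
Hypothesis pi_gt0 : forall c, 0 < pi c.
Hypothesis pi_sum1 : \sum_c pi c = 1.
Hypothesis a_gt0 : forall u, 0 < a u.
Hypothesis p_valid : forall N, (0 < N)%N -> connection_function (fun u => a u * delta N).
Hypothesis q_range : (1 <= q <= tree_depth t)%N.

(** Nonnegative edge probabilities give [0 <= delta N], and their strict increase from a parent to a
    child excludes 0. *)
Lemma delta_gt0 N : (0 < N)%N -> 0 < delta N.
Proof.
move=> /p_valid[p01 p_lt]; have [u [v uv]] := exists_child q_range.
have := p_lt _ _ uv; have /andP[+ _] := p01 u.
rewrite pmulr_rge0 // => d0 lt; rewrite lt_neqAle eq_sym d0 andbT.
by apply: contraTN lt => /eqP ->; rewrite !mulr0 ltxx.
Qed.

Lemma a_child u v : child u v -> a u < a v.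
Proof.
by move=> uv; have := (p_valid (ltn0Sn 0)).2 _ _ uv; rewrite ltr_pM2r // delta_gt0.
Qed.

Let p01 N : (0 < N)%N -> forall u, 0 <= a u * delta N <= 1.
Proof. by move=> /p_valid[]. Qed.

Let p_le1 N : (0 < N)%N -> forall u, a u * delta N <= 1.
Proof. by move=> N0 u; case/andP: (p01 N0 u). Qed.

Let near_ln_gt0 : \forall N \near \oo, (0 < N)%N /\ 0 < ln (N%:R : R).
Proof.
exists 2%N => // N /= N2; split; first exact: ltn_trans N2.
by rewrite ln_gt0 // ltr1n.
Qed.

Lemma impossible_below_threshold :
  (limn_esup (fun N => (N%:R / ln N%:R)%:E * min_CH pi (fun u => (a u * delta N)%R) q) < 1)%E ->
  ~ exists est : estimator t q, exact_recovery pi (fun N u => a u * delta N) est.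
Proof.
move=> /limn_esup_lt_near[e e0 below] [est rec].
have [x [y [xy xy_min]]] := poisson_CH_minimiser pi a q_range.
have [|c c0 fail] := @impossibility _ _ _ _ _ _ pi_gt0 pi_sum1 a_gt0 a_child delta_gt0 p01 x y e xy e0.
  apply: filterS2 near_ln_gt0 below => N [N0 lnN] /=.
  have Ige := min_CH_ge pi_gt0 a_gt0 q_range (delta_gt0 N0) (p_le1 N0) xy_min.
  have NlnN : 0 < (N%:R / ln N%:R : R) by rewrite divr_gt0 // ltr0n.
  move=> /(le_trans (lee_wpmul2l (ltW NlnN : (0 <= (_)%:E)%E) Ige)).
  rewrite -EFinM lee_fin mulrAC ler_pdivrMr // mulrA.
  exact.
exact: (failure_prob_of_exact_recovery rec c0 (fail est)).
Qed.

Lemma possible_above_threshold :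
  (1 < limn_einf (fun N => (N%:R / ln N%:R)%:E * min_CH pi (fun u => (a u * delta N)%R) q))%E ->
  exists est : estimator t q, exact_recovery pi (fun N u => a u * delta N) est.
Proof.
move=> /limn_einf_gt_near[e e0 above].
have [x [y [xy xy_min]]] := poisson_CH_minimiser pi a q_range.
set J := poisson_CH pi (rate a) x y in xy_min.
have neq_xy : x != y by apply: contraNneq xy => ->; exact: eqxx.
have J0 : 0 < J.
  apply: (@poisson_CH_gt0 _ _ _ _ pi_gt0 _ x y x) => [u v|]; first exact: a_gt0.
  have -> : rate a y x = rate a x y by exact: rateC.
  by rewrite gt_eqF // rate_lt //; exact: a_child.
have [M M0 aM] := fin_ub a.
have e2 : 0 < e / 2 by rewrite divr_gt0.
have [|est fail] := @achievability _ _ _ _ _ _ pi_gt0 pi_sum1 a_gt0 a_child delta_gt0 p01 J (e / 2) J0 e2 xy_min _; last first.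
  exists est.
  exact: (exact_recovery_of_failure_prob (fun c => ltW (pi_gt0 c)) pi_sum1 p01 fail).
pose d0 := Num.min (8 * M)^-1 (J * e / (2 + e) / (22 * M ^+ 2)).
have d00 : 0 < d0.
  by rewrite lt_min invr_gt0 !divr_gt0 ?mulr_gt0 ?exprn_gt0 ?addr_gt0.
apply: filterS3 near_ln_gt0 above (near_ln_small ((1 + e / 2) / (d0 * J))) => N [N0 lnN] Ige lnN_small.
(* If [delta N] is at least [d0], then [N * delta N * J] is linear in [N] and exceeds any multiple
   of the logarithm; otherwise the second-order comparison of divergences applies. *)
case: (lerP d0 (delta N)) => [dle|].
  apply: le_trans (_ : N%:R * (d0 * J) <= _); last by rewrite -mulrA ler_wpM2l // ler_pM2r.
  by move: lnN_small; rewrite mulrAC ler_pdivrMr // mulr_gt0.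
rewrite lt_min => /andP[d8 dM].
have {}d8 : 8 * M * delta N <= 1.
  by rewrite -ler_pdivlMl ?mulr_gt0 // mulr1 ltW.
have Ile := min_CH_le pi a q_range (delta N) xy.
have Cle := CH_le_poisson_CH pi_gt0 a_gt0 (delta_gt0 N0) (p_le1 N0) x y aM d8 pi_sum1.
have NlnN : 0 <= (N%:R / ln N%:R : R) by rewrite divr_ge0 // ltW.
apply: (threshold_slack e0 (ler0n _ N) (delta_gt0 N0) (M := M)).
  by move: dM; rewrite ltr_pdivlMr ?mulr_gt0 ?exprn_gt0 // mulrC => /ltW.
apply: le_trans (ler_wpM2l (ler0n _ N) Cle).
move: (le_trans Ige (lee_wpmul2l (NlnN : (0 <= (_)%:E)%E) Ile)).
by rewrite -EFinM lee_fin mulrAC ler_pdivlMr.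
Qed.

End Thresholds.

Local Close Scope classical_set_scope.

Theorem theorem3 (R : realType) (t : btree) (pi : leaf t -> R)
    (a : node t -> R) (delta : nat -> R) (q : nat)
    (pi_gt0_lt1 : forall c, 0 < pi c < 1)
    (pi_sum1 : \sum_(c : leaf t) pi c = 1)
    (a_gt0 : forall u, 0 < a u)
    (p_valid : forall N, (0 < N)%N ->
       connection_function (fun u => a u * delta N))
    (q_range : (1 <= q <= tree_depth t)%N) :
  let p N u := a u * delta N in
  let I N := min_CH pi (p N) q in
  ((limn_esup (fun N => (N%:R / ln N%:R)%:E * I N) < 1)%E ->
     ~ exists est : estimator t q, exact_recovery pi p est) /\
  ((1 < limn_einf (fun N => (N%:R / ln N%:R)%:E * I N))%E ->
     exists est : estimator t q, exact_recovery pi p est).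
Proof.
have pi_gt0 c : 0 < pi c by case/andP: (pi_gt0_lt1 c).
by split; [exact: impossible_below_threshold|exact: possible_above_threshold].
Qed.
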